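(* Let $\alpha_1,\alpha_2,\ldots,\alpha_N$ be nonzero complex numbers. Then the standard module $V=\mathbb{C}^P$ supports a $U_{q^{1/2}}(\widehat{\mathfrak{sl}}_2)$-module structure on which the Chevalley generators act as follows: \[ e_0^{+}\mapsto q^{(1-N)/2}\sum_{m=1}^N \alpha_m R_m,\qquad e_1^{+}\mapsto q^{(N-1)/2}\sum_{m=1}^N (L_mR_m)^{-1}L_m, \] \[ e_0^{-}\mapsto \sum_{m=1}^N \alpha_m^{-1} L_m,\qquad e_1^{-}\mapsto \sum_{m=1}^N (R_mL_m)^{-1}R_m, \] \[ k_0\mapsto \prod_{m=1}^N K_m^{-1},\quad k_0^{-1}\mapsto \prod_{m=1}^N K_m,\quad k_1\mapsto \prod_{m=1}^N K_m,\quad k_1^{-1}\mapsto \prod_{m=1}^N K_m^{-1}. \]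
   Context: Let $q$ be a prime power, $\mathbb{F}_q$ the field with $q$ elements, $N\ge 1$ an integer, $H$ an $N$-dimensional vector space over $\mathbb{F}_q$, and $P$ the set of all subspaces of $H$. Fix a full flag $0=x_0\subsetneq x_1\subsetneq\cdots\subsetneq x_N=H$ with $\dim x_i=i$. For $y\in P$, its location is the unique $\mu=(\mu_1,\ldots,\mu_N)\in\{0,1\}^N$ with $\dim(y\cap x_m)=\mu_1+\cdots+\mu_m$ for $1\le m\le N$. Let $P_\mu$ be the set of subspaces with location $\mu$ (and $P_\mu=\emptyset$ for $\mu\in\mathbb{Z}^N\setminus\{0,1\}^N$); $|\mu|=\mu_1+\cdots+\mu_N$; $\widehat{m}$ denotes the $m$-th unit vector in $\mathbb{Z}^N$. We say $y$ covers $z$ if $z\subseteq y$ and $\dim z=\dim y-1$, and $y$ $m$-covers $z$ if $y$ covers $z$ and the location of $y$ equals the location of $z$ plus $\widehat{m}$. Let $V=\mathbb{C}^P$ (column vectors indexed by $P$), acted on by $\mathrm{Mat}_P(\mathbb{C})$. For $\mu\in\mathbb{Z}^N$, $E^*_\mu$ is the diagonal matrix with $(y,y)$-entry $1$ if $y\in P_\mu$ and $0$ otherwise. $K_m$ is the diagonal matrix with $(K_m)_{y,y}=q^{1/2-\mu_m}$ for $y\in P_\mu$. $L_m\in\mathrm{Mat}_P(\mathbb{C})$ has $(y,z)$-entry $1$ if $z$ $m$-covers $y$ and $0$ otherwise, and $R_m=L_m^T$. Fix a basis $v_1,\ldots,v_N$ of $H$ with $x_i=\mathrm{span}(v_1,\ldots,v_i)$.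 For $\mu\in\{0,1\}^N$ let $S_\mu=\{s:\mu_s=0\}$, $T_\mu=\{t:\mu_t=1\}$, $B_\mu=\{(s,t)\in S_\mu\times T_\mu: s<t\}$, $S_\mu(m)=\{s\in S_\mu:s\le m\}$, $T_\mu(m)=\{t\in T_\mu: t\ge m\}$. For $\mu\ne(0,\ldots,0),(1,\ldots,1)$, let $\mathcal{M}_\mu(\mathbb{F}_q)$ be the set of $S_\mu\times T_\mu$ matrices over $\mathbb{F}_q$ whose nonzero entries lie in positions of $B_\mu$; each $y\in P_\mu$ has a unique matrix form $Y\in\mathcal{M}_\mu(\mathbb{F}_q)$ such that the vectors $\sum_{s\in S_\mu}Y_{s,t}v_s+v_t$ ($t\in T_\mu$) form a basis of $y$. For $M\in\mathcal{M}_\mu(\mathbb{F}_q)$ and $(s,t)\in B_\mu$, let $M(s,t)$ be the submatrix with rows $\{s'\in S_\mu: s'\le s\}$ and columns $\{t'\in T_\mu:t'\ge t\}$; let $s^-$ be the largest element of $S_\mu$ smaller than $s$ ($s^-=0$ if none) and $t^+$ the smallest element of $T_\mu$ larger than $t$ ($t^+=N+1$ if none); put $r^-=\mathrm{rank}\,M(s^-,t)$ (or $0$ if $s^-=0$), $r^+=\mathrm{rank}\,M(s,t^+)$ (or $0$ if $t^+=N+1$), $r^{-+}=\mathrm{rank}\,M(s^-,t^+)$ (or $0$ if $s^-=0$ or $t^+=N+1$). Let $\sigma(M)$ be the set of $(s,t)\in B_\mu$ with $r^-=r^+=r^{-+}=\mathrm{rank}\,M(s,t)-1$. The type of $y\in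 P_\mu$ is the set of all indices $s$ and $t$ with $(s,t)\in\sigma(Y)$ (a subset of $\{1,\ldots,N\}$ of even size); if $\mu$ is all zeros or all ones the type is $\emptyset$. Fix a nontrivial character $\chi$ of $(\mathbb{F}_q,+)$. For $y\in P_\mu$ define $\chi_y\in V$: if $\mu$ is all zeros or all ones, $\chi_y$ is the indicator vector of $y$; otherwise $\chi_y(z)=\chi(\mathrm{tr}(YZ^T))$ for $z\in P_\mu$ with matrix form $Z$, and $\chi_y(z)=0$ for $z\notin P_\mu$. For $\lambda\subseteq\{1,\ldots,N\}$ of even size let $V_\lambda$ be the span of the $\chi_y$ with $y$ of type $\lambda$; then $V$ is the direct sum of the $V_\lambda$, and $E_\lambda$ denotes the projection onto $V_\lambda$ along the sum of the other $V_{\lambda'}$ (it does not depend on the choice of basis or $\chi$). For $1\le m\le N$, $\mu\in\{0,1\}^N$ and $\lambda$ of even size set $\kappa(m,\mu,\lambda)=|S_\mu(m-1)\setminus\lambda|+|T_\mu(m+1)\setminus\lambda|+|\lambda|/2$, and define the matrices $(L_mR_m)^{-1}L_m=\sum_{\mu,\lambda}q^{-\kappa(m,\mu,\lambda)}L_mE^*_\mu E_\lambda$ and $(R_mL_m)^{-1}R_m=\sum_{\mu,\lambda}q^{-\kappa(m,\mu,\lambda)}R_mE^*_\mu E_\lambda$ (sums over $\mu\in\{0,1\}^N$ and $\lambda\subseteq\{1,\ldots,N\}$ of even size); these are notations, not products. $U_{q^{1/2}}(\widehat{\mathfrak{sl}}_2)$ is the associative $\mathbb{C}$-algebra with generators $e_i^{\pm},k_i,k_i^{-1}$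 ($i=0,1$) and relations (writing $t=q^{1/2}$, $[3]_t=t^2+1+t^{-2}$): $k_ik_i^{-1}=k_i^{-1}k_i=1$, $k_0k_1=k_1k_0$; $k_ie_i^{\pm}=t^{\pm2}e_i^{\pm}k_i$, $k_ie_j^{\pm}=t^{\mp2}e_j^{\pm}k_i$ for $i\ne j$; $e_i^+e_i^--e_i^-e_i^+=(k_i-k_i^{-1})/(t-t^{-1})$; $e_0^{\pm}e_1^{\mp}=e_1^{\mp}e_0^{\pm}$; and for $i\ne j$, $(e_i^{\pm})^3e_j^{\pm}-[3]_t(e_i^{\pm})^2e_j^{\pm}e_i^{\pm}+[3]_te_i^{\pm}e_j^{\pm}(e_i^{\pm})^2-e_j^{\pm}(e_i^{\pm})^3=0$. *)

(* Defs.v *)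
From HB Require Import structures.
From mathcomp Require Import all_boot all_order all_algebra.
From mathcomp Require Import boolp reals complex.

Set Implicit Arguments.
Unset Strict Implicit.
Unset Printing Implicit Defensive.

Import GRing.Theory Num.Theory.

Local Open Scope ring_scope.

(* The algebra U_t(sl2-hat) is the quotient of the set of noncommutative
   polynomial expressions in its generators by uq_cong, the smallest congruence
   that contains the axioms of associative unital algebras over C and the
   defining relations uq_rel. *)

Inductive uq_gen :=
  | GenE of bool & 'I_2   (* GenE true i = e_i^+ and GenE false i = e_i^- *)
  | GenK of 'I_2
  | GenKV of 'I_2.

Inductive uq_term (C : Type) :=
  | TGen of uq_gen
  | TCst of C
  | TAdd of uq_term C & uq_term C
  | TMul of uq_term C & uq_term C.

Arguments TGen {C}.

Declare Scope uq_scope.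
Delimit Scope uq_scope with uq.
Bind Scope uq_scope with uq_term.

Section UqAlgebra.

Variables (C : fieldType) (t : C).

Local Notation term := (uq_term C).

HB.instance Definition _ := gen_eqMixin term.
HB.instance Definition _ := gen_choiceMixin term.

Local Notation "a %:c" := (@TCst C a) (at level 2, format "a %:c") : uq_scope.
Local Infix "+" := (@TAdd C) : uq_scope.
Local Infix "*" := (@TMul C) : uq_scope.
Local Notation "x - y" := (x + (-1)%R%:c * y)%uq : uq_scope.
Local Notation e s i := (@TGen C (GenE s i)).
Local Notation k i := (@TGen C (GenK i)).
Local Notation kV i := (@TGen C (GenKV i)).

Definition uq_t2 (s : bool) : C := if s then t ^+ 2 else t ^- 2.

Definition uq_three : C := t ^+ 2 + 1 + t ^- 2.

Inductive uq_rel : term -> term -> Prop :=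
  | RelKKV i : uq_rel (k i * kV i) 1%R%:c
  | RelKVK i : uq_rel (kV i * k i) 1%R%:c
  | RelKK : uq_rel (k ord0 * k ord_max) (k ord_max * k ord0)
  | RelKE s i : uq_rel (k i * e s i) ((uq_t2 s)%:c * (e s i * k i))
  | RelKE_neq s i j : i != j ->
      uq_rel (k i * e s j) ((uq_t2 (~~ s))%:c * (e s j * k i))
  | RelEF i : uq_rel (e true i * e false i - e false i * e true i)
                     ((t - t^-1)^-1%R%:c * (k i - kV i))
  | RelEE s : uq_rel (e s ord0 * e (~~ s) ord_max) (e (~~ s) ord_max * e s ord0)
  | RelSerre s i j : i != j ->
      uq_rel (e s i * e s i * e s i * e s j
              - uq_three%:c * (e s i * e s i * e s j * e s i)
              + uq_three%:c * (e s i * e s j * e s i * e s i)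
              - e s j * e s i * e s i * e s i)
             0%R%:c.

Inductive uq_cong : term -> term -> Prop :=
  | CongRel x y : uq_rel x y -> uq_cong x y
  | CongRefl x : uq_cong x x
  | CongSym x y : uq_cong x y -> uq_cong y x
  | CongTrans y x z : uq_cong x y -> uq_cong y z -> uq_cong x z
  | CongAdd x x' y y' : uq_cong x x' -> uq_cong y y' -> uq_cong (x + y) (x' + y')
  | CongMul x x' y y' : uq_cong x x' -> uq_cong y y' -> uq_cong (x * y) (x' * y')
  | CongAddA x y z : uq_cong (x + (y + z)) (x + y + z)
  | CongAddC x y : uq_cong (x + y) (y + x)
  | CongAdd0 x : uq_cong (0%R%:c + x) x
  | CongAddN x : uq_cong ((-1)%R%:c * x + x) 0%R%:c
  | CongMulA x y z : uq_cong (x * (y * z)) (x * y * z)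
  | CongMul1 x : uq_cong (1%R%:c * x) x
  | CongMulDl x y z : uq_cong ((x + y) * z) (x * z + y * z)
  | CongMulDr x y z : uq_cong (x * (y + z)) (x * y + x * z)
  | CongCstD a b : uq_cong (a + b)%R%:c (a%:c + b%:c)
  | CongCstM a b : uq_cong (a * b)%R%:c (a%:c * b%:c)
  | CongCstC a x : uq_cong (a%:c * x) (x * a%:c).

Definition uq_eq : rel term := fun x y => `[< uq_cong x y >].

Lemma uq_eq_equiv : equiv_class_of uq_eq.
Proof.
split=> [x|x y|y x z]; first exact/asboolP/CongRefl.
- by apply/asboolP/asboolP => /CongSym.
- by move=> /asboolP xy /asboolP yz; apply/asboolP/(CongTrans xy).
Qed.

Canonical uq_eq_equiv_rel := EquivRelPack uq_eq_equiv.

Definition uq_sl2hat := {eq_quot uq_eq_equiv_rel}%qT.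

HB.instance Definition _ := Choice.on uq_sl2hat.
HB.instance Definition _ := EqQuotient.on uq_sl2hat.

Local Notation U := uq_sl2hat.

Definition uq_pi (x : term) : U := \pi_(U)%qT x.

Lemma uq_piP x y : uq_cong x y <-> uq_pi x = uq_pi y.
Proof.
rewrite /uq_pi; split => [xy|/eqmodP /asboolP //].
exact/eqmodP/asboolP.
Qed.

Lemma uq_pi_repr (u : U) : uq_pi (repr u) = u.
Proof. exact: reprK. Qed.

Lemma uq_repr_pi x : uq_cong (repr (uq_pi x)) x.
Proof. by apply/uq_piP; rewrite uq_pi_repr. Qed.

Definition uq_add (u v : U) : U := uq_pi (repr u + repr v).
Definition uq_mul (u v : U) : U := uq_pi (repr u * repr v).
Definition uq_opp (u : U) : U := uq_pi ((-1)%R%:c * repr u).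
Definition uq_scale (a : C) (u : U) : U := uq_pi (a%:c * repr u).

Lemma uq_addE x y : uq_add (uq_pi x) (uq_pi y) = uq_pi (x + y).
Proof. by apply/uq_piP/CongAdd; exact: uq_repr_pi. Qed.

Lemma uq_mulE x y : uq_mul (uq_pi x) (uq_pi y) = uq_pi (x * y).
Proof. by apply/uq_piP/CongMul; exact: uq_repr_pi. Qed.

Lemma uq_oppE x : uq_opp (uq_pi x) = uq_pi ((-1)%R%:c * x).
Proof. by apply/uq_piP/CongMul; [exact: CongRefl|exact: uq_repr_pi]. Qed.

Lemma uq_scaleE a x : uq_scale a (uq_pi x) = uq_pi (a%:c * x).
Proof. by apply/uq_piP/CongMul; [exact: CongRefl|exact: uq_repr_pi]. Qed.

Lemma uq_ind (Q : U -> Prop) : (forall x, Q (uq_pi x)) -> forall u, Q u.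
Proof. by move=> H u; rewrite -(uq_pi_repr u). Qed.

Lemma uq_addA : associative uq_add.
Proof.
elim/uq_ind=> x; elim/uq_ind=> y; elim/uq_ind=> z; rewrite !uq_addE.
exact/uq_piP/CongAddA.
Qed.

Lemma uq_addC : commutative uq_add.
Proof.
by elim/uq_ind=> x; elim/uq_ind=> y; rewrite !uq_addE; exact/uq_piP/CongAddC.
Qed.

Lemma uq_add0 : left_id (uq_pi 0%R%:c) uq_add.
Proof. by elim/uq_ind=> x; rewrite uq_addE; exact/uq_piP/CongAdd0. Qed.

Lemma uq_addN : left_inverse (uq_pi 0%R%:c) uq_opp uq_add.
Proof. by elim/uq_ind=> x; rewrite uq_oppE uq_addE; exact/uq_piP/CongAddN. Qed.

HB.instance Definition _ :=
  GRing.isZmodule.Build U uq_addA uq_addC uq_add0 uq_addN.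

Lemma uq_mulA : associative uq_mul.
Proof.
elim/uq_ind=> x; elim/uq_ind=> y; elim/uq_ind=> z; rewrite !uq_mulE.
exact/uq_piP/CongMulA.
Qed.

Lemma uq_mul1 : left_id (uq_pi 1%R%:c) uq_mul.
Proof. by elim/uq_ind=> x; rewrite uq_mulE; exact/uq_piP/CongMul1. Qed.

Lemma uq_mulr1 : right_id (uq_pi 1%R%:c) uq_mul.
Proof.
elim/uq_ind=> x; rewrite uq_mulE; apply/uq_piP.
exact: CongTrans (CongSym (CongCstC _ _)) (CongMul1 _).
Qed.

Lemma uq_mulDl : left_distributive uq_mul +%R.
Proof.
elim/uq_ind=> x; elim/uq_ind=> y; elim/uq_ind=> z.
by rewrite /GRing.add /= !(uq_mulE, uq_addE); exact/uq_piP/CongMulDl.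
Qed.

Lemma uq_mulDr : right_distributive uq_mul +%R.
Proof.
elim/uq_ind=> x; elim/uq_ind=> y; elim/uq_ind=> z.
by rewrite /GRing.add /= !(uq_mulE, uq_addE); exact/uq_piP/CongMulDr.
Qed.

(* The trivial representation, which shows that the algebra is not zero. *)
Fixpoint uq_counit (x : term) : C :=
  match x with
  | TGen (GenE _ _) => 0
  | TGen _ => 1
  | TCst a => a
  | TAdd x y => uq_counit x + uq_counit y
  | TMul x y => uq_counit x * uq_counit y
  end.

Lemma uq_counit_rel x y : uq_rel x y -> uq_counit x = uq_counit y.
Proof.
by case=> * /=; rewrite ?(mul0r, mulr0, addr0, mulr1, mulN1r, subrr, oppr0).
Qed.

Lemma uq_counit_cong x y : uq_cong x y -> uq_counit x = uq_counit y.
Proof.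
elim=> /=; do ?[by move=> *; exact: uq_counit_rel | by move=> *; congruence].
- by move=> *; rewrite addrA.
- by move=> *; rewrite addrC.
- by move=> *; rewrite add0r.
- by move=> *; rewrite mulN1r addNr.
- by move=> *; rewrite mulrA.
- by move=> *; rewrite mul1r.
- by move=> *; rewrite mulrDl.
- by move=> *; rewrite mulrDr.
- by move=> *; rewrite mulrC.
Qed.

Lemma uq_one_neq0 : uq_pi 1%R%:c != 0.
Proof.
apply/eqP => /uq_piP /uq_counit_cong /= /eqP; by rewrite oner_eq0.
Qed.

HB.instance Definition _ := GRing.Zmodule_isNzRing.Build U
  uq_mulA uq_mul1 uq_mulr1 uq_mulDl uq_mulDr uq_one_neq0.

Lemma uq_scaleA a b u : uq_scale a (uq_scale b u) = uq_scale (a * b) u.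
Proof.
elim/uq_ind: u => x; rewrite !uq_scaleE; apply/uq_piP.
apply: CongTrans (CongMulA _ _ _) _.
exact: CongMul (CongSym (CongCstM _ _)) (CongRefl _).
Qed.

Lemma uq_scale1 : left_id 1 uq_scale.
Proof. by elim/uq_ind=> x; rewrite uq_scaleE; exact/uq_piP/CongMul1. Qed.

Lemma uq_scaleDr : right_distributive uq_scale +%R.
Proof.
move=> a; elim/uq_ind=> x; elim/uq_ind=> y.
rewrite /GRing.add /= !(uq_scaleE, uq_addE); exact/uq_piP/CongMulDr.
Qed.

Lemma uq_scaleDl u : {morph uq_scale^~ u : a b / a + b}.
Proof.
move=> a b; elim/uq_ind: u => x.
rewrite /GRing.add /= !(uq_scaleE, uq_addE); apply/uq_piP.
exact: CongTrans (CongMul (CongCstD _ _) (CongRefl _)) (CongMulDl _ _ _).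
Qed.

HB.instance Definition _ := GRing.Zmodule_isLmodule.Build C U
  uq_scaleA uq_scale1 uq_scaleDr uq_scaleDl.

Lemma uq_scaleAl (a : C) (u v : U) : a *: (u * v) = a *: u * v.
Proof.
elim/uq_ind: u => x; elim/uq_ind: v => y.
rewrite /GRing.mul /GRing.scale /= !(uq_mulE, uq_scaleE).
exact/uq_piP/CongMulA.
Qed.

HB.instance Definition _ := GRing.Lmodule_isLalgebra.Build C U uq_scaleAl.

Lemma uq_scaleAr (a : C) (u v : U) : a *: (u * v) = u * (a *: v).
Proof.
elim/uq_ind: u => x; elim/uq_ind: v => y.
rewrite /GRing.mul /GRing.scale /= !(uq_mulE, uq_scaleE); apply/uq_piP.
apply: CongTrans (CongMulA _ _ _) _.
apply: CongTrans (CongMul (CongCstC _ _) (CongRefl _)) _.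
exact: CongSym (CongMulA _ _ _).
Qed.

HB.instance Definition _ := GRing.Lalgebra_isAlgebra.Build C U uq_scaleAr.

Definition uq_e (s : bool) (i : 'I_2) : U := uq_pi (e s i).
Definition uq_k (i : 'I_2) : U := uq_pi (k i).
Definition uq_kV (i : 'I_2) : U := uq_pi (kV i).

End UqAlgebra.

(* Over a finite field the subspaces of a finite dimensional space form a
   finite type: they are encoded by matrices in reduced form. *)
Section FiniteVspace.

Import VectorInternalTheory.

HB.instance Definition _ (F : finFieldType) (H : vectType F) :=
  [Countable of {vspace H} by <:].
HB.instance Definition _ (F : finFieldType) (H : vectType F) :=
  [Finite of {vspace H} by <:].

End FiniteVspace.

(* The indices 1, ..., N are encoded as 'I_N, shifted down by one; a location
   is an element of {ffun 'I_N -> bool}, with true standing for 1. *)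

Definition full_flag (F : fieldType) (H : vectType F) (N : nat)
    (x : 'I_N.+1 -> {vspace H}) : Prop :=
  [/\ x ord0 = 0%VS, x ord_max = fullv,
      forall i j : 'I_N.+1, (i <= j)%N -> (x i <= x j)%VS
    & forall i, \dim (x i) = i].

Definition is_add_char (F : nzRingType) (C : nzRingType) (chi : F -> C) : Prop :=
  chi 0 = 1 /\ {morph chi : a b / a + b >-> a * b}.

Section MatrixForms.

Variables (F : fieldType) (N : nat) (mu : {ffun 'I_N -> bool}).

Definition trivial_loc : bool :=
  (mu == [ffun=> false]) || (mu == [ffun=> true]).

Definition Sset : {set 'I_N} := [set s | ~~ mu s].
Definition Tset : {set 'I_N} := [set t | mu t].
Definition Bset : {set 'I_N * 'I_N} :=
  [set p | [&& p.1 \in Sset, p.2 \in Tset & (p.1 < p.2)%N]].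

(* S_mu x T_mu matrices are encoded as N x N matrices that vanish outside of
   S_mu x T_mu. *)
Definition Mspace : pred 'M[F]_N :=
  fun M => [forall s, forall t, (M s t != 0) ==> ((s, t) \in Bset)].

(* The rank of the submatrix on the rows s' < a of S_mu and the columns
   t' >= b of T_mu. As s' <= s^- iff s' < s in S_mu and t' >= t^+ iff t' > t
   in T_mu, the ranks of M(s,t), M(s^-,t), M(s,t^+) and M(s^-,t^+) are obtained
   with a = s + 1 or s and b = t or t + 1; an empty submatrix has rank 0. *)
Definition corner_rank (M : 'M[F]_N) (a b : nat) : nat :=
  \rank (\matrix_(i, j)
    if [&& i \in Sset, j \in Tset, (i < a)%N & (b <= j)%N] then M i j else 0).

Definition sigma_set (M : 'M[F]_N) : {set 'I_N * 'I_N} :=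
  [set p in Bset |
    let r := corner_rank M p.1.+1 p.2 in
    [&& (corner_rank M p.1 p.2).+1 == r,
        (corner_rank M p.1.+1 p.2.+1).+1 == r
      & (corner_rank M p.1 p.2.+1).+1 == r]].

End MatrixForms.

Section Subspaces.

Variables (F : finFieldType) (H : vectType F) (N : nat).
Variable x : 'I_N.+1 -> {vspace H}.

Local Notation P := {vspace H}.

Definition is_location (y : P) (mu : {ffun 'I_N -> bool}) : bool :=
  [forall m : 'I_N,
    \dim (y :&: x (lift ord0 m))%VS == (\sum_(i < N | (i <= m)%N) mu i)%N].

(* If x is a full flag then every subspace has exactly one location. *)
Definition location (y : P) : {ffun 'I_N -> bool} :=
  odflt [ffun=> false] [pick mu | is_location y mu].

Definition covers (y z : P) : bool := (z <= y)%VS && (\dim y == (\dim z).+1).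

Definition mcovers (m : 'I_N) (y z : P) : bool :=
  covers y z &&
  [forall i, (location y i : nat) == (location z i + (i == m))%N].

Variable v : N.-tuple H.

Definition is_matrix_form (y : P) (Y : 'M[F]_N) : bool :=
  let mu := location y in
  Mspace mu Y &&
  basis_of y [seq \sum_(s in Sset mu) Y s t *: tnth v s + tnth v t
             | t in Tset mu].

(* If v is a basis adapted to x then every subspace has exactly one matrix
   form; it is 0 when the location is constant. *)
Definition matrix_form (y : P) : 'M[F]_N :=
  odflt 0 [pick Y | is_matrix_form y Y].

Definition vtype (y : P) : {set 'I_N} :=
  let mu := location y in
  if trivial_loc mu then set0
  else [set i | [exists p in sigma_set mu (matrix_form y),
                  (i == p.1) || (i == p.2)]].

End Subspaces.

Section StandardModule.

Variables (F : finFieldType) (H : vectType F) (N : nat).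
Variable C : numClosedFieldType.
Variables (x : 'I_N.+1 -> {vspace H}) (v : N.-tuple H) (chi : F -> C).

Local Notation P := {vspace H}.
Local Notation dimV := #|{: P}|.
Local Notation q := (#|F|%:R : C).

Definition qhalf : C := sqrtC q.

(* Matrices and column vectors indexed by P, through the enumeration of P. *)
Definition mx_on (f : P -> P -> C) : 'M[C]_dimV :=
  \matrix_(i, j) f (enum_val i) (enum_val j).
Definition cv_on (f : P -> C) : 'cV[C]_dimV := \col_i f (enum_val i).

Definition Estar (mu : {ffun 'I_N -> bool}) : 'M[C]_dimV :=
  mx_on (fun y z => ((y == z) && is_location x y mu)%:R).

(* q^(1/2 - mu_m) = (q^(1/2))^(1 - 2 mu_m) *)
Definition Kmat (m : 'I_N) : 'M[C]_dimV :=
  mx_on (fun y z =>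
    if y == z then qhalf ^ (1 - 2 * (location x y m : nat)%:Z) else 0).

Definition Lmat (m : 'I_N) : 'M[C]_dimV :=
  mx_on (fun y z => (mcovers x m z y)%:R).

Definition Rmat (m : 'I_N) : 'M[C]_dimV := (Lmat m)^T.

Definition chi_vec (y : P) : 'cV[C]_dimV :=
  let mu := location x y in
  if trivial_loc mu then cv_on (fun z => (z == y)%:R)
  else cv_on (fun z =>
    if is_location x z mu
    then chi (\tr (matrix_form x v y *m (matrix_form x v z)^T)) else 0).

Definition Vtype (lam : {set 'I_N}) : {vspace 'cV[C]_dimV} :=
  <<[seq chi_vec y | y in [pred y : P | vtype x v y == lam]]>>%VS.

(* daddv_pi U W is the projection onto U along W when U and W are in direct sum,
   which holds here for a full flag, an adapted basis and a nontrivial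
   character; its matrix acts on column vectors on the left. *)
Definition Etype (lam : {set 'I_N}) : 'M[C]_dimV :=
  \matrix_(i, j)
    daddv_pi (Vtype lam)
      (\sum_(lam' : {set 'I_N} | ~~ odd #|lam'| && (lam' != lam)) Vtype lam')%VS
      (delta_mx j 0) i 0.

Definition kappa (m : 'I_N) (mu : {ffun 'I_N -> bool}) (lam : {set 'I_N}) : nat :=
  (#|[set s in Sset mu | (s < m)%N] :\: lam|
   + #|[set t in Tset mu | (m < t)%N] :\: lam|
   + #|lam|./2)%N.

(* (L_m R_m)^-1 L_m and (R_m L_m)^-1 R_m, which are not actual products. *)
Definition LRVL (m : 'I_N) : 'M[C]_dimV :=
  \sum_mu \sum_(lam : {set 'I_N} | ~~ odd #|lam|)
    q ^- kappa m mu lam *: (Lmat m *m Estar mu *m Etype lam).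

Definition RLVR (m : 'I_N) : 'M[C]_dimV :=
  \sum_mu \sum_(lam : {set 'I_N} | ~~ odd #|lam|)
    q ^- kappa m mu lam *: (Rmat m *m Estar mu *m Etype lam).

End StandardModule.

(* Main.v *)
(* The matrices A_m = L_m R_m + R_m L_m are convolution operators on the matrix
   forms, so the characters chi_y are eigenvectors: the eigenvalue of chi_y is 0 if
   m belongs to the type of y and q^kappa(m, mu, lambda) otherwise.  Hence
   (L_m R_m)^-1 L_m = L_m A_m^+ and (R_m L_m)^-1 R_m = R_m A_m^+, where A_m^+ is the
   group inverse of A_m.  As A_m commutes with every L_n and R_n up to a power of q,
   so does A_m^+, and the relations between the e_i^+ and the e_j^- reduce to
   L_n L_m = q L_m L_n (m < n), L_m R_n = R_n L_m (m <> n), L_m^2 = 0, and to the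
   two sums of the diagonal commutators, which telescope.  The Serre relations
   follow from the other relations by finite dimensionality.

   The type of y is governed by the ranks D(i) of the blocks of Y on the rows < i
   and the columns >= i (with indices from 0): D goes up by one at the indices of
   the type that lie in S_mu, goes down by one at those that lie in T_mu, and is
   constant elsewhere.  In particular a type has as many elements in S_mu as in
   T_mu. *)

Require Import Defs.
From HB Require Import structures.
From mathcomp Require Import all_boot all_order all_algebra.
From mathcomp Require Import ring zify.
From mathcomp Require Import reals complex.

Set Implicit Arguments.
Unset Strict Implicit.
Unset Printing Implicit Defensive.

Import Order.TTheory GRing.Theory Num.Theory.

Local Open Scope ring_scope.

(** * Group inverses and the quantum Serre relations *)

(** The definition of (L_m R_m)^-1 L_m gives [chi_y] the weight q^-kappa even when m lies in the
    type of y, where A_m^+ vanishes. The two agree because L_m and R_m both kill such a [chi_y]: R_m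
    is the transpose of the real matrix L_m, so R_m L_m chi_y = 0 forces L_m chi_y = 0, and likewise
    for R_m. Thus the proof works with the eigenvalues of L_m R_m and R_m L_m and never computes the
    image of a character under L_m. These eigenvalues come from a count. A step up and a step down
    along m add a rank one matrix to the matrix form. Summing the character over one factor of it
    leaves the number of ways to write row m, or column m, of the form of y as a combination of the
    rows above it, or of the columns to its right, inside the block cut at m. There is no way
    exactly when m is in the type. In e_0^+ e_1^- = e_1^- e_0^+ and in the terms m <> n of the
    commutators, the powers of q produced by L_n, R_n and A_m^+ cancel term by term, whatever the
    coefficients alpha_m. *)

Section GroupInverse.

Variables (C : fieldType) (n : nat) (Q G : 'M[C]_n).
Hypotheses (QG : Q *m G = G *m Q) (QGQ : Q *m G *m Q = Q) (GQG : G *m Q *m G = G).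

(** The idempotent p = Q G commutes with X, because Q X = a X Q makes both p X and X p equal to p X
    p. Hence G X = G p X = G X Q G = a^-1 G Q X G = a^-1 X G. *)
Lemma group_inverse_comm (a : C) (X : 'M[C]_n) :
  a != 0 -> Q *m X = a *: (X *m Q) -> G *m X = a^-1 *: (X *m G).
Proof.
move=> a0 QX.
have XQ : X *m Q = a^-1 *: (Q *m X) by rewrite QX scalerA mulVf // scale1r.
have pXp1 : Q *m G *m X *m (Q *m G) = Q *m G *m X.
  rewrite QG -!mulmxA [Q *m (X *m _)]mulmxA QX -scalemxAl -!mulmxA.
  by rewrite [Q *m (G *m Q)]mulmxA QGQ.
have pXp2 : Q *m G *m X *m (Q *m G) = X *m (Q *m G).
  rewrite -!mulmxA [X *m (Q *m _)]mulmxA XQ -!scalemxAl -!scalemxAr -!mulmxA.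
  by rewrite [Q *m (G *m (Q *m _))]mulmxA [Q *m G *m _]mulmxA QGQ.
have pX : Q *m G *m X = X *m (Q *m G) by rewrite -pXp1 pXp2.
have GX : G *m X = G *m X *m Q *m G by rewrite -{1}GQG -!mulmxA -pX !mulmxA.
by rewrite GX -[G *m X *m Q]mulmxA XQ -scalemxAr -scalemxAl mulmxA -QG pX -!mulmxA
  [Q *m (G *m G)]mulmxA QG GQG.
Qed.

End GroupInverse.

(** * The quantum Serre relation from a nilpotent adjoint action *)

Section Serre.

Variables (C : numFieldType) (n : nat) (t : C) (E F X K K' : 'M[C]_n).
Hypotheses (t1 : 1 < t) (KK' : K *m K' = 1%:M).
Hypotheses (KE : K *m E = t ^+ 2 *: (E *m K)) (K'E : K' *m E = t ^- 2 *: (E *m K')).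
Hypotheses (KX : K *m X = t ^- 2 *: (X *m K)) (K'X : K' *m X = t ^+ 2 *: (X *m K')).
Hypotheses (FX : F *m X = X *m F).
Hypothesis FE : F *m E = E *m F + (t - t^-1)^-1 *: (K' - K).
Variable M : nat.
Hypothesis nilE : iter M (mulmx E) 1%:M = 0.

Let t0 : t != 0. Proof. by rewrite gt_eqF // (lt_trans ltr01 t1). Qed.

(** The scalar t^(2i-2) by which conjugation by [K] acts on [q_ad i]; X itself has weight -2. *)
Let u i : C := t ^+ (2 * i) / t ^+ 2.

Fixpoint q_ad i : 'M[C]_n :=
  if i is j.+1 then E *m q_ad j - u j *: (q_ad j *m E) else X.

(** This sum equals [i]_t [3-i]_t, the usual coefficient for a vector of lowest weight -2: it
    vanishes at i = 3 and not later. *)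
Let c i : C := \sum_(j < i) (t - t^-1)^-1 * ((u j)^-1 - u j).

Let uS j : u j.+1 = t ^+ 2 * u j.
Proof. by rewrite /u mulnS exprD mulrA. Qed.

Let K_q_ad i : K *m q_ad i = u i *: (q_ad i *m K).
Proof.
elim: i => [|i IH] /=; first by rewrite /u muln0 expr0 mul1r.
rewrite mulmxBr mulmxBl -!scalemxAr -!scalemxAl !mulmxA KE IH -!scalemxAl.
rewrite -!mulmxA IH KE -!scalemxAr !scalerBr !scalerA uS.
by congr (_ *: _ - _ *: _); ring.
Qed.

Let K'_q_ad i : K' *m q_ad i = (u i)^-1 *: (q_ad i *m K').
Proof.
elim: i => [|i IH] /=; first by rewrite /u muln0 expr0 mul1r invrK.
rewrite mulmxBr mulmxBl -!scalemxAr -!scalemxAl !mulmxA K'E IH -!scalemxAl.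
rewrite -!mulmxA IH K'E -!scalemxAr !scalerBr !scalerA uS.
have u0 : u i != 0 by rewrite mulf_neq0 ?invr_neq0 ?expf_neq0.
by congr (_ *: _ - _ *: _); field; rewrite u0 t0.
Qed.

(** Moving F past one more E produces a term in K and a term in K'. The factor [u j] in [q_ad] is
    the one for which the two K terms cancel, so only a multiple of [q_ad i *m K'] accumulates. *)
Let F_q_ad i :
  F *m q_ad i.+1 = q_ad i.+1 *m F + c i.+1 *: (q_ad i *m K').
Proof.
have key j Z : F *m q_ad j = q_ad j *m F + Z ->
    F *m q_ad j.+1 = q_ad j.+1 *m F + (E *m Z - u j *: (Z *m E))
      + ((t - t^-1)^-1 * ((u j)^-1 - u j)) *: (q_ad j *m K').
  move=> FZ /=; rewrite mulmxBr mulmxBl -scalemxAr -scalemxAl.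
  rewrite [F *m (E *m _)]mulmxA FE mulmxDl -mulmxA FZ.
  rewrite [F *m (_ *m E)]mulmxA FZ mulmxDl -[q_ad j *m F *m E]mulmxA FE.
  rewrite -scalemxAl mulmxBl K_q_ad K'_q_ad.
  rewrite !mulmxDr -!scalemxAr mulmxBr !mulmxA.
  set a := E *m _ *m F; set b := E *m Z; set d := q_ad j *m K'.
  set e := q_ad j *m K; set f := _ *m F; set g := Z *m E.
  by apply/matrixP => k l; rewrite !mxE; ring.
elim: i => [|i IH].
  rewrite (key 0%N 0) ?mulmx0 ?mul0mx ?scaler0 ?subr0 ?addr0 //.
  by rewrite /c big_ord1.
rewrite (key _ _ IH) -addrA; congr (_ + _).
rewrite -scalemxAr -[c _ *: _ *m E]scalemxAl -[_ *m K' *m E]mulmxA K'E -scalemxAr.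
rewrite [c i.+2]/c big_ord_recr /= -/(c i.+1) scalerDl; congr (_ + _).
rewrite mulmxBl -scalemxAl !mulmxA scalerBr !scalerA uS.
by congr (_ - _ *: _); field.
Qed.

(** Expanding [q_ad i] gives products E^k X E^l with k + l = i; together with the outer factors one
    of the two powers of E reaches M. *)
Let nil_q_ad i a b : (2 * M <= i + a + b)%N ->
  iter a (mulmx E) (q_ad i *m iter b (mulmx E) 1%:M) = 0.
Proof.
have iterM m Z : iter m (mulmx E) Z = iter m (mulmx E) 1%:M *m Z.
  by elim: m => /= [|m ->]; rewrite ?mul1mx // mulmxA.
have iter0 m : (M <= m)%N -> iter m (mulmx E) 1%:M = 0.
  by move=> /subnK <-; rewrite iterD nilE iterM mulmx0.
elim: i a b => [|i IH] a b ab /=.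
  rewrite iterM; case: (leqP M a) => Ma; first by rewrite iter0 // mul0mx.
  rewrite [iter b _ _]iter0 ?mulmx0 // -(leq_add2l M) addnn -mul2n.
  by rewrite (leq_trans ab) // add0n leq_add2r ltnW.
rewrite iterM mulmxBl mulmxBr -scalemxAl -scalemxAr.
have -> : iter a (mulmx E) 1%:M *m (E *m q_ad i *m iter b (mulmx E) 1%:M)
    = iter a.+1 (mulmx E) (q_ad i *m iter b (mulmx E) 1%:M).
  by rewrite iterSr -mulmxA -iterM.
rewrite IH; last by rewrite addnS.
by rewrite -mulmxA -iterM -[E *m _]/(iter b.+1 _ _) IH ?scaler0 ?subr0 // addnS.
Qed.

Let c3 : c 3 = 0.
Proof.
rewrite /c !big_ord_recl big_ord0 /u /bump /=.
have tt : t - t^-1 != 0.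
  by rewrite subr_eq0 gt_eqF // (lt_trans _ t1) // invf_lt1 // (lt_trans ltr01).
have t2 : t ^+ 2 - 1 != 0.
  by rewrite subr_eq0 gt_eqF // exprn_egt1.
by field; rewrite t0.
Qed.

(** From [c 3 = 0] on all increments are negative, since t > 1 gives [u j] > 1 for j >= 3. *)
Let c_neq0 i : c i.+4 != 0.
Proof.
suff: c i.+4 < 0 by move/lt_eqF ->.
have tgt0 : 0 < t by rewrite (lt_trans ltr01).
have d0 : 0 < (t - t^-1)^-1.
  by rewrite invr_gt0 subr_gt0 (lt_trans _ t1) // invf_lt1.
have lt0 j : (t - t^-1)^-1 * ((u j.+3)^-1 - u j.+3) < 0.
  rewrite pmulr_rlt0 // subr_lt0; have u1 : 1 < u j.+3.
    by rewrite uS /u mulrCA divff ?expf_neq0 // mulr1 exprn_egt1.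
  by rewrite (lt_trans _ u1) // invf_lt1 // (lt_trans ltr01).
elim: i => [|i IH]; rewrite /c big_ord_recr /= -/(c _) ?c3 ?add0r //.
by rewrite -oppr_gt0 opprD addr_gt0 ?oppr_gt0.
Qed.

(* q_ad i is a weight vector of the adjoint action of an sl2-triple; X has weight
   -2, so F kills q_ad 3, of weight 4, and nilpotency of E forces q_ad 3 = 0. *)
Lemma q_serre : let w := t ^+ 2 + 1 + t ^- 2 in
  E *m E *m E *m X - w *: (E *m E *m X *m E) + w *: (E *m X *m E *m E)
  - X *m E *m E *m E = 0.
Proof.
have q_ad3 : q_ad 3 = 0.
  have down i : q_ad i.+4 = 0 -> q_ad i.+3 = 0.
    move=> q0; have := F_q_ad i.+3; rewrite q0 mulmx0 mul0mx add0r.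
    move/esym/eqP; rewrite scaler_eq0 (negPf (c_neq0 i)) => /eqP q1.
    have K'K : K' *m K = 1%:M by apply: mulmx1C.
    by rewrite -[q_ad _]mulmx1 -K'K mulmxA q1 mul0mx.
  have : q_ad (2 * M).+3 = 0.
    have := @nil_q_ad (2 * M).+3 0 0.
    by rewrite /= mulmx1 => -> //; rewrite !addn0 -addn3 leq_addr.
  elim: (2 * M)%N => [|m IH q0]; first exact: id.
  exact: IH (down _ q0).
have El a A B : E *m (A - a *: B) = E *m A - a *: (E *m B).
  by rewrite mulmxBr scalemxAr.
have Er a A B : (A - a *: B) *m E = A *m E - a *: (B *m E).
  by rewrite mulmxBl scalemxAl.
rewrite -q_ad3 /= !(El, Er) !mulmxA.
move: (E *m E *m E *m X) (E *m E *m X *m E) (E *m X *m E *m E) => a b d.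
move: (X *m E *m E *m E) => e; rewrite /u.
by apply/matrixP => k l; rewrite !mxE; field.
Qed.

End Serre.

(** * Representations of the quotient algebra *)

Section UqRepresentation.

Variables (C : fieldType) (t : C) (n : nat).
Variables (e : bool -> 'I_2 -> 'M[C]_n) (k kV : 'I_2 -> 'M[C]_n).

Fixpoint uq_eval (x : uq_term C) : 'M[C]_n :=
  match x with
  | TGen (GenE s i) => e s i
  | TGen (GenK i) => k i
  | TGen (GenKV i) => kV i
  | TCst a => a%:M
  | TAdd x y => uq_eval x + uq_eval y
  | TMul x y => uq_eval x *m uq_eval y
  end.

Hypothesis eval_rel : forall x y, uq_rel t x y -> uq_eval x = uq_eval y.

Lemma uq_eval_cong x y : uq_cong t x y -> uq_eval x = uq_eval y.
Proof.
elim=> /=; do ?[by move=> *; exact: eval_rel | by move=> *; congruence].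
- by move=> *; rewrite addrA.
- by move=> *; rewrite addrC.
- by move=> *; rewrite raddf0 add0r.
- by move=> z; rewrite mul_scalar_mx scaleN1r addNr raddf0.
- by move=> *; rewrite mulmxA.
- by move=> *; rewrite mul1mx.
- by move=> *; rewrite mulmxDl.
- by move=> *; rewrite mulmxDr.
- by move=> *; rewrite raddfD.
- by move=> *; rewrite scalar_mxM.
- by move=> *; rewrite scalar_mxC.
Qed.

Definition uq_repr (u : uq_sl2hat t) : 'M[C]_n := uq_eval (repr u).

Lemma uq_repr_piE x : uq_repr (uq_pi t x) = uq_eval x.
Proof. exact/uq_eval_cong/uq_repr_pi. Qed.

Fact uq_repr_is_zmod_morphism : zmod_morphism uq_repr.
Proof.
elim/uq_ind=> x; elim/uq_ind=> y.
have -> : uq_pi t x - uq_pi t y = uq_pi t (TAdd x (TMul (TCst (-1)) y)).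
  by rewrite /GRing.opp /GRing.add /= uq_oppE uq_addE.
by rewrite !uq_repr_piE /= mul_scalar_mx scaleN1r.
Qed.

Fact uq_repr_is_monoid_morphism : monoid_morphism uq_repr.
Proof.
split; first by rewrite uq_repr_piE.
elim/uq_ind=> x; elim/uq_ind=> y.
by rewrite /GRing.mul /= uq_mulE !uq_repr_piE.
Qed.

Fact uq_repr_is_scalable : scalable uq_repr.
Proof.
move=> a; elim/uq_ind=> x.
by rewrite {1}/GRing.scale /= uq_scaleE !uq_repr_piE /= mul_scalar_mx.
Qed.

HB.instance Definition _ :=
  GRing.isZmodMorphism.Build _ _ uq_repr uq_repr_is_zmod_morphism.
HB.instance Definition _ :=
  GRing.isMonoidMorphism.Build _ _ uq_repr uq_repr_is_monoid_morphism.
HB.instance Definition _ :=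
  GRing.isScalable.Build _ _ _ _ uq_repr uq_repr_is_scalable.

Lemma uq_representation : exists rho : {lrmorphism uq_sl2hat t -> 'M[C]_n},
  [/\ forall s i, rho (uq_e t s i) = e s i,
      forall i, rho (uq_k t i) = k i & forall i, rho (uq_kV t i) = kV i].
Proof. by exists uq_repr; split=> *; rewrite /= uq_repr_piE. Qed.

End UqRepresentation.

(** * From raising and lowering operators to a module *)

Section Homogeneous.

Variables (C : fieldType) (n : nat) (g : 'I_n -> int).

Definition homog (s : int) (A : 'M[C]_n) : Prop :=
  forall i j, A i j != 0 -> g i = g j + s.

Lemma homog0 s : homog s 0.
Proof. by move=> i j; rewrite mxE eqxx. Qed.

Lemma homog1 : homog 0 1%:M.
Proof.
move=> i j; rewrite mxE addr0; case: (altP (i =P j)) => [-> //|_].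
by rewrite eqxx.
Qed.

Lemma homogD s A B : homog s A -> homog s B -> homog s (A + B).
Proof.
move=> hA hB i j; rewrite mxE; case: (altP (A i j =P 0)) => [-> | /hA //].
by rewrite add0r => /hB.
Qed.

Lemma homogZ s a A : homog s A -> homog s (a *: A).
Proof. by move=> hA i j; rewrite mxE mulf_eq0 => /norP[_ /hA]. Qed.

Lemma homog_sum s (I : finType) (P : pred I) (A : I -> 'M[C]_n) :
  (forall i, P i -> homog s (A i)) -> homog s (\sum_(i | P i) A i).
Proof. by move=> hA; apply: big_ind => //; [exact: homog0|exact: homogD]. Qed.

Lemma homogM s s' A B : homog s A -> homog s' B -> homog (s' + s) (A *m B).
Proof.
move=> hA hB i j; rewrite mxE => nz.
have [k] : exists k, A i k * B k j != 0.
  by apply/existsP; apply: contraNT nz => /existsPn h;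
    rewrite big1 // => k _; apply/eqP; move: (h k); rewrite negbK.
by rewrite mulf_eq0 => /norP[/hA -> /hB ->]; rewrite addrA.
Qed.

(** The power N + 1 shifts the degree by (N + 1) s, which the range from 0 to N cannot
    accommodate. *)
Lemma homog_nilp s A (N : nat) : s != 0 -> homog s A ->
  (forall i, 0 <= g i <= N%:Z) -> iter N.+1 (mulmx A) 1%:M = 0.
Proof.
move=> s0 hA gN.
have hi m : homog (s * m%:Z) (iter m (mulmx A) 1%:M).
  elim: m => [|m IH]; first by rewrite mulr0; exact: homog1.
  by rewrite -addn1 PoszD mulrDr mulr1 addn1; apply: homogM.
apply/matrixP => i j; rewrite [RHS]mxE; apply/eqP/negP => /negP /hi.
move: (gN i) (gN j); nia.
Qed.

Lemma homog_diag (t : C) (a b s : int) A : t != 0 -> homog s A ->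
  diag_mx (\row_i t ^ (a + b * g i)) *m A
  = t ^ (b * s) *: (A *m diag_mx (\row_i t ^ (a + b * g i))).
Proof.
move=> t0 hA; apply/matrixP => i j; rewrite mul_diag_mx mul_mx_diag !mxE.
case: (altP (A i j =P 0)) => [->|/hA ->]; first by rewrite mul0r !mulr0.
rewrite mulrDr addrA; move: (a + _) => z.
by rewrite expfzDr // mulrAC mulrC [A i j * _]mulrC.
Qed.

End Homogeneous.

Section UqFromRaisingLowering.

Variables (C : numFieldType) (t : C) (n N : nat) (g : 'I_n -> int).
Variables (L G : 'I_N -> 'M[C]_n) (alpha : 'I_N -> C).

Local Notation q := (t ^+ 2).
Local Notation R m := (L m)^T.
(** [Q m] is the matrix A_m and [G m] stands for its group inverse; (L_m R_m)^-1 L_m appears below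
    as [L m *m G m]. *)
Let Q m := L m *m R m + R m *m L m.

Hypotheses (t1 : 1 < t) (gN : forall i, 0 <= g i <= N%:Z).
Hypothesis alpha0 : forall m, alpha m != 0.
Hypotheses (hL : forall m, homog g (-1) (L m)) (hG : forall m, homog g 0 (G m)).
Hypothesis LL0 : forall m, L m *m L m = 0.
Hypothesis LLq : forall m m' : 'I_N, (m < m')%N ->
  L m' *m L m = q *: (L m *m L m').
Hypothesis LRC : forall m m' : 'I_N, m != m' -> L m *m R m' = R m' *m L m.
Hypotheses (QG : forall m, Q m *m G m = G m *m Q m)
  (QGQ : forall m, Q m *m G m *m Q m = Q m)
  (GQG : forall m, G m *m Q m *m G m = G m).

Let K := diag_mx (\row_i t ^ (N%:Z + (-2) * g i)).
Let K' := diag_mx (\row_i t ^ (- N%:Z + 2 * g i)).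

Hypothesis sumRL : t ^ (1 - N%:Z) *: \sum_m (R m *m L m - L m *m R m)
  = (t - t^-1)^-1 *: (K' - K).
Hypothesis sumLR :
  t ^ (N%:Z - 1) *: \sum_m (L m *m R m - R m *m L m) *m (G m *m G m)
  = (t - t^-1)^-1 *: (K - K').

Let t0 : t != 0. Proof. by rewrite gt_eqF // (lt_trans ltr01 t1). Qed.
Let q0 : q != 0. Proof. by rewrite expf_neq0. Qed.

(** The factor in L_m L_m' = eps L_m' L_m. On the diagonal L_m^2 = 0 would admit any value; 1 is the
    one that is also right for [Q m] and [L m]. *)
Let eps (m m' : nat) : C := if (m < m')%N then q^-1 else if (m' < m)%N then q else 1.

Let eps0 m m' : eps m m' != 0.
Proof. by rewrite /eps; do 2?case: ifP => _; rewrite ?invr_neq0 ?oner_eq0. Qed.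

Let epsV m m' : eps m' m = (eps m m')^-1.
Proof. by rewrite /eps; case: ltngtP; rewrite ?invrK ?invr1. Qed.

Let LLe m m' : L m *m L m' = eps m m' *: (L m' *m L m).
Proof.
rewrite /eps; case: (ltngtP m m') => [lt|lt|/val_inj ->].
- by rewrite (LLq lt) scalerA mulVf // scale1r.
- by rewrite (LLq lt).
- by rewrite LL0 scaler0.
Qed.

Let RRe m m' : R m *m R m' = (eps m m')^-1 *: (R m' *m R m).
Proof. by rewrite -!trmx_mul LLe linearZ /= epsV. Qed.

Let RLC m m' : m != m' -> R m *m L m' = L m' *m R m.
Proof. by rewrite eq_sym => /LRC. Qed.

(** For m <> m' the factor [R m] commutes with [L m'], so both summands of [Q m] pick up the factor
    of [L m]. For m = m' both sides reduce to L R L. *)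
Let QL m m' : Q m *m L m' = eps m m' *: (L m' *m Q m).
Proof.
rewrite /Q mulmxDl mulmxDr -!mulmxA; case: (altP (m =P m')) => [<-|mm'].
  by rewrite LL0 mulmx0 addr0 [L m *m (L m *m _)]mulmxA LL0 mul0mx add0r /eps ltnn
    scale1r.
rewrite RLC // mulmxA LLe -scalemxAl -scalemxAr scalerDr.
by rewrite -mulmxA [R m *m (L m' *m _)]mulmxA RLC // -mulmxA.
Qed.

Let QR m m' : Q m *m R m' = (eps m m')^-1 *: (R m' *m Q m).
Proof.
rewrite /Q mulmxDl mulmxDr -!mulmxA; case: (altP (m =P m')) => [<-|mm'].
  have RR0 : R m *m R m = 0 by rewrite -trmx_mul LL0 trmx0.
  by rewrite RR0 mulmx0 add0r [R m *m (R m *m _)]mulmxA RR0 mul0mx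
    /eps ltnn invr1 scale1r addr0.
rewrite [X in L m *m X]RRe -scalemxAr [L m *m (R m' *m _)]mulmxA LRC //.
rewrite [X in _ + X]mulmxA [R m *m R m']RRe -scalemxAl -scalerDr.
by rewrite -!mulmxA.
Qed.

Let GL m m' : G m *m L m' = (eps m m')^-1 *: (L m' *m G m).
Proof. exact: (group_inverse_comm (QG m) (QGQ m) (GQG m) _ (QL m m')). Qed.

Let GR m m' : G m *m R m' = eps m m' *: (R m' *m G m).
Proof.
rewrite -[eps _ _]invrK.
apply: (group_inverse_comm (QG m) (QGQ m) (GQG m) _ (QR m m')).
by rewrite invr_neq0.
Qed.

(** The factors from [L m'] and [R m'] are inverse to each other, so the [Q m] commute; passing to
    the group inverse in each argument gives the claim. *)
Let GG m m' : G m *m G m' = G m' *m G m.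
Proof.
have QQ : Q m *m Q m' = 1 *: (Q m' *m Q m).
  rewrite {2 3}/Q mulmxDr mulmxDl scale1r !mulmxA QL QR -!scalemxAl.
  by rewrite -!mulmxA QL QR -!scalemxAr !scalerA mulfV // mulVf // !scale1r.
have := group_inverse_comm (QG m) (QGQ m) (GQG m) (oner_neq0 _) QQ.
rewrite invr1 scale1r => /esym; rewrite -[RHS]scale1r => GQ.
have := group_inverse_comm (QG m') (QGQ m') (GQG m') (oner_neq0 _) GQ.
by rewrite invr1 scale1r.
Qed.

Let ep0 := t ^ (1 - N%:Z) *: \sum_m alpha m *: R m.
Let em0 := \sum_m (alpha m)^-1 *: L m.
Let ep1 := t ^ (N%:Z - 1) *: \sum_m L m *m G m.
Let em1 := \sum_m R m *m G m.

(** Term by term: the factor from moving [R m] past [G m'] cancels the one from exchanging [R m] and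
    [R m']. *)
Let ep0_em1 : ep0 *m em1 = em1 *m ep0.
Proof.
rewrite /ep0 /em1 -scalemxAl -scalemxAr; congr (_ *: _).
rewrite mulmx_suml mulmx_sumr; apply: eq_bigr => m _.
rewrite mulmx_suml mulmx_sumr; apply: eq_bigr => m' _.
rewrite -scalemxAl -scalemxAr -mulmxA GR mulmxA RRe -scalemxAl -scalemxAr.
by rewrite mulmxA (epsV m m').
Qed.

Let em0_ep1 : em0 *m ep1 = ep1 *m em0.
Proof.
rewrite /em0 /ep1 -scalemxAl -scalemxAr; congr (_ *: _).
rewrite mulmx_suml mulmx_sumr; apply: eq_bigr => m _.
rewrite mulmx_suml mulmx_sumr; apply: eq_bigr => m' _.
rewrite -scalemxAl -scalemxAr -mulmxA GL mulmxA LLe -scalemxAl -scalemxAr.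
by rewrite mulmxA (epsV m m') invrK.
Qed.

Let commutator_sum (A B : 'I_N -> 'M[C]_n) :
  (forall m m', m != m' -> A m *m B m' = B m' *m A m) ->
  (\sum_m A m) *m (\sum_m B m) - (\sum_m B m) *m (\sum_m A m)
  = \sum_m (A m *m B m - B m *m A m).
Proof.
move=> AB; rewrite !mulmx_suml; under eq_bigr do rewrite mulmx_sumr.
under [X in _ - X]eq_bigr do rewrite mulmx_sumr.
rewrite exchange_big -sumrB /=; apply: eq_bigr => m _.
rewrite -sumrB (bigD1 m) //= big1 ?addr0 // => m' mm'.
by rewrite AB ?subrr.
Qed.

Let ep0_em0 : ep0 *m em0 - em0 *m ep0 = (t - t^-1)^-1 *: (K' - K).
Proof.
rewrite -scalemxAl -scalemxAr -scalerBr -sumRL; congr (_ *: _).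
rewrite commutator_sum => [|m m' mm'].
  apply: eq_bigr => m _; rewrite -!scalemxAl -!scalemxAr !scalerA.
  by rewrite mulVf // mulfV // !scale1r.
by rewrite -!scalemxAl -!scalemxAr RLC // !scalerA mulrC.
Qed.

(** Off the diagonal the [eps] factors cancel once more. On it [G m] commutes with [L m] and [R m],
    so that L G R G = L R G^2; this is where the square of G in [sumLR] comes from. *)
Let ep1_em1 : ep1 *m em1 - em1 *m ep1 = (t - t^-1)^-1 *: (K - K').
Proof.
rewrite -scalemxAl -scalemxAr -scalerBr -sumLR; congr (_ *: _).
rewrite commutator_sum => [|m m' mm'].
  apply: eq_bigr => m _; rewrite -![_ *m G m *m _]mulmxA.
  rewrite ![G m *m (_ *m _)]mulmxA GR GL /eps ltnn invr1 !scale1r.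
  by rewrite mulmxBl !mulmxA.
rewrite -![_ *m G _ *m _]mulmxA ![G _ *m (_ *m _)]mulmxA GR GL.
rewrite -!scalemxAl -!scalemxAr (epsV m m') invrK !mulmxA LRC //.
by rewrite -!mulmxA [G m *m G m']GG.
Qed.

Let KK' : K *m K' = 1%:M.
Proof.
apply/matrixP => i j; rewrite mul_diag_mx !mxE.
case: eqVneq => [->|_]; last by rewrite !mulr0n mulr0.
by rewrite !mulr1n -expfzDr // (_ : _ + _ = 0) //; ring.
Qed.

Let K'K : K' *m K = 1%:M. Proof. exact/mulmx1C/KK'. Qed.

Let gen_e (s : bool) (i : 'I_2) : 'M[C]_n :=
  if i == ord0 then (if s then ep0 else em0) else (if s then ep1 else em1).
Let gen_k (i : 'I_2) := if i == ord0 then K' else K.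
Let gen_kV (i : 'I_2) := if i == ord0 then K else K'.

Let hR m : homog g 1 (R m).
Proof. by move=> i j; rewrite mxE => /hL ->; rewrite subrK. Qed.

Let dir (s : bool) (i : 'I_2) : int := (-1) ^+ ((i != ord0) (+) ~~ s).

Let h_gen s i : homog g (dir s i) (gen_e s i).
Proof.
have hp1 : homog g (-1) ep1.
  by apply/homogZ/homog_sum => m _; rewrite -[-1]add0r; apply: homogM.
have hm1 : homog g 1 em1.
  by apply/homog_sum => m _; rewrite -[1]add0r; apply: homogM.
have hp0 : homog g 1 ep0 by apply/homogZ/homog_sum => m _; apply/homogZ.
have hm0 : homog g (-1) em0 by apply/homog_sum => m _; apply/homogZ.
by rewrite /gen_e /dir; case: eqP => _; case: s.
Qed.

Let ord2 (i : 'I_2) : i = ord0 \/ i = ord_max.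
Proof. by case: i => [[|[|//]] lt]; [left|right]; apply/val_inj. Qed.

Let expt2 (s : bool) : t ^ ((-1) ^+ (~~ s) * 2 : int) = uq_t2 t s.
Proof. by case: s; rewrite /= ?mul1r. Qed.

Let expt2V (s : bool) : t ^ ((-1) ^+ (~~ s) * -2 : int) = uq_t2 t (~~ s).
Proof. by case: s; rewrite /= ?mul1r. Qed.

Let K'A s A : homog g ((-1) ^+ (~~ s)) A -> K' *m A = uq_t2 t s *: (A *m K').
Proof. by move=> hA; rewrite /K' (homog_diag _ _ t0 hA) mulrC expt2. Qed.

Let KA s A : homog g ((-1) ^+ (~~ s)) A -> K *m A = uq_t2 t (~~ s) *: (A *m K).
Proof. by move=> hA; rewrite /K (homog_diag _ _ t0 hA) mulrC expt2V. Qed.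

Let gen_ke s i j : gen_k i *m gen_e s j =
  uq_t2 t ((i != j) (+) s) *: (gen_e s j *m gen_k i).
Proof.
have := @h_gen s j; rewrite /dir /gen_k.
by case: (ord2 i) => ->; case: (ord2 j) => ->; case: s => hA;
  first [exact: (@K'A true) | exact: (@K'A false)
        | exact: (@KA true) | exact: (@KA false)].
Qed.

Let gen_kVe s i j : gen_kV i *m gen_e s j =
  uq_t2 t ((i == j) (+) s) *: (gen_e s j *m gen_kV i).
Proof.
have := @h_gen s j; rewrite /dir /gen_kV.
by case: (ord2 i) => ->; case: (ord2 j) => ->; case: s => hA;
  first [exact: (@K'A true) | exact: (@K'A false)
        | exact: (@KA true) | exact: (@KA false)].
Qed.

Let gen_kkV i : gen_k i *m gen_kV i = 1%:M.
Proof. by rewrite /gen_k /gen_kV; case: eqP. Qed.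

Let gen_kVk i : gen_kV i *m gen_k i = 1%:M.
Proof. by rewrite /gen_k /gen_kV; case: eqP. Qed.

Let gen_ef i : gen_e true i *m gen_e false i - gen_e false i *m gen_e true i
  = (t - t^-1)^-1 *: (gen_k i - gen_kV i).
Proof. by case: (ord2 i) => ->; rewrite /gen_e /=. Qed.

Let gen_ee s i j : i != j -> gen_e s i *m gen_e (~~ s) j = gen_e (~~ s) j *m gen_e
  s i.
Proof. by case: (ord2 i) => ->; case: (ord2 j) => -> //; case: s => _. Qed.

Let gen_serre s i j : i != j -> let w := uq_three t in
  gen_e s i *m gen_e s i *m gen_e s i *m gen_e s j
  - w *: (gen_e s i *m gen_e s i *m gen_e s j *m gen_e s i)
  + w *: (gen_e s i *m gen_e s j *m gen_e s i *m gen_e s i)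
  - gen_e s j *m gen_e s i *m gen_e s i *m gen_e s i = 0.
Proof.
move=> ij w.
have nil : iter N.+1 (mulmx (gen_e s i)) 1%:M = 0.
  apply: homog_nilp (@h_gen s i) gN.
  by rewrite /dir; case: (_ (+) _).
have ji : (j != i) by rewrite eq_sym.
case: s nil => nil.
- apply: (@q_serre _ _ t (gen_e true i) (gen_e false i) _ (gen_k i) (gen_kV i)) nil
  => //.
  + by rewrite gen_ke eqxx.
  + by rewrite gen_kVe eqxx.
  + by rewrite gen_ke ij.
  + by rewrite gen_kVe (negPf ij).
  + by rewrite (@gen_ee false).
  + by rewrite -[gen_kV i - _]opprB scalerN -gen_ef opprB addrC subrK.
(* For the e_i^- the same triple is used with e_i^+ and e_i^- exchanged and k_i replaced by its
   inverse. *)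
- apply: (@q_serre _ _ t (gen_e false i) (gen_e true i) _ (gen_kV i) (gen_k i)) nil
  => //.
  + by rewrite gen_kVe eqxx.
  + by rewrite gen_ke eqxx.
  + by rewrite gen_kVe (negPf ij).
  + by rewrite gen_ke ij.
  + by rewrite (@gen_ee true).
  + by rewrite -gen_ef addrC subrK.
Qed.

Lemma uq_from_raising_lowering :
  exists rho : {lrmorphism uq_sl2hat t -> 'M[C]_n},
    [/\ rho (uq_e t true ord0) = ep0, rho (uq_e t true ord_max) = ep1,
        rho (uq_e t false ord0) = em0 & rho (uq_e t false ord_max) = em1]
    /\ [/\ rho (uq_k t ord0) = K', rho (uq_kV t ord0) = K,
        rho (uq_k t ord_max) = K & rho (uq_kV t ord_max) = K'].
Proof.
have [|rho [rho_e rho_k rho_kV]] := @uq_representation C t n gen_e gen_k gen_kV.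
  move=> x y; case=> /= [i|i||s i|s i j ij|i|s|s i j ij].
  - exact: gen_kkV.
  - exact: gen_kVk.
  - exact: etrans K'K (esym KK').
  - by rewrite mul_scalar_mx gen_ke eqxx.
  - by rewrite mul_scalar_mx gen_ke ij.
  - by rewrite !mul_scalar_mx !scaleN1r gen_ef.
  - exact: gen_ee.
  - by rewrite !mul_scalar_mx !scaleN1r raddf0 gen_serre.
by exists rho; rewrite !rho_e !rho_k !rho_kV.
Qed.

End UqFromRaisingLowering.

(** * Masked matrices, solution counts and additive characters *)

Section MaskedMatrices.

Variables (F : fieldType) (N : nat).
Implicit Types (P Q : pred 'I_N) (M : 'M[F]_N).

(** Blocks are kept at size N x N and padded with zeros, as in [corner_rank], so that blocks with
    different index sets have the same matrix type. *)
Definition mskmx P Q M : 'M[F]_N :=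
  \matrix_(i, j) if P i && Q j then M i j else 0.

Lemma mskmx_tr P Q M : (mskmx P Q M)^T = mskmx Q P M^T.
Proof. by apply/matrixP => i j; rewrite !mxE andbC. Qed.

Lemma mxrank_adds_row m (A : 'M[F]_(m, N)) (w : 'rV[F]_N) :
  \rank (A + w)%MS = (\rank A + ~~ (w <= A)%MS)%N.
Proof.
case: (boolP (w <= A)%MS) => wA /=; first by rewrite addn0; rewrite (addsmx_idPl wA).
have w0 : w != 0 by apply: contraNneq wA => ->; exact: sub0mx.
have := mxrank_sum_cap A w; rewrite (rank_rV w) w0 /= => <-.
suff -> : \rank (A :&: w)%MS = 0%N by rewrite addn0.
apply/eqP; rewrite -leqn0 -ltnS -[1%N]/(true : nat) -{2}w0 -rank_rV ltn_neqAle.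
rewrite (mxrankS (capmxSr _ _)) andbT; apply: contraNneq wA => eqr.
have := mxrank_leqif_sup (capmxSr A w).
by case=> _; rewrite eqr eqxx => /esym wAw; exact: submx_trans wAw (capmxSl _ _).
Qed.

Lemma mskmx_pred1 P P' Q M a : P' =1 [pred i | (i == a) || P i] ->
  (mskmx P' Q M == mskmx P Q M + row a (mskmx (pred1 a) Q M))%MS.
Proof.
move=> P'E; apply/andP; split.
  apply/row_subP => i; case: (eqVneq i a) => [->|ia].
    have -> : row a (mskmx P' Q M) = row a (mskmx (pred1 a) Q M).
      by apply/rowP => j; rewrite !mxE P'E /= eqxx.
    exact: addsmxSr.
  have -> : row i (mskmx P' Q M) = row i (mskmx P Q M).
    by apply/rowP => j; rewrite !mxE P'E /= (negPf ia).
  exact: submx_trans (row_sub _ _) (addsmxSl _ _).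
rewrite addsmx_sub; apply/andP; split; last first.
  have <- : row a (mskmx P' Q M) = row a (mskmx (pred1 a) Q M).
    by apply/rowP => j; rewrite !mxE P'E /= eqxx.
  exact: row_sub.
apply/row_subP => i; case: (boolP (P i)) => Pi; last first.
  suff -> : row i (mskmx P Q M) = 0 by exact: sub0mx.
  by apply/rowP => j; rewrite !mxE (negPf Pi).
have <- : row i (mskmx P' Q M) = row i (mskmx P Q M).
  by apply/rowP => j; rewrite !mxE P'E /= Pi orbT.
exact: row_sub.
Qed.

Lemma mxrank_mskmxD1 P P' Q M a : P' =1 [pred i | (i == a) || P i] ->
  \rank (mskmx P' Q M)
  = (\rank (mskmx P Q M) + ~~ (row a (mskmx (pred1 a) Q M) <= mskmx P Q M)%MS)%N.
Proof.
by move=> P'E; rewrite -mxrank_adds_row (eqmxP (mskmx_pred1 Q M P'E)).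
Qed.

Lemma sub_mskmxP P Q M a :
  reflect (exists c : 'rV[F]_N,
             (forall i, c 0 i != 0 -> P i) /\
             forall j, Q j -> (c *m M) 0 j = M a j)
    (row a (mskmx (pred1 a) Q M) <= mskmx P Q M)%MS.
Proof.
apply: (iffP submxP) => [[c cE] | [c [cP cE]]].
  exists (\row_i if P i then c 0 i else 0); split=> [i|j Qj].
    by rewrite mxE; case: ifP => //; rewrite eqxx.
  move/rowP/(_ j): cE; rewrite !mxE /= eqxx Qj /= => ->.
  by apply: eq_bigr => i _; rewrite !mxE Qj andbT; case: ifP; rewrite ?mul0r ?mulr0.
exists c; apply/rowP => j; rewrite !mxE /= eqxx /=; case: ifP => Qj.
  rewrite -cE // mxE; apply: eq_bigr => i _; rewrite mxE Qj andbT.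
  by case: ifP => // /negP nP; case: (eqVneq (c 0 i) 0) => [->|/cP //];
    rewrite !mul0r.
by rewrite big1 // => i _; rewrite mxE Qj andbF mulr0.
Qed.

(** The same combination still works when there are more rows to combine and fewer columns to
    match. *)
Lemma sub_mskmxS P P' Q Q' M a : {subset P <= P'} -> {subset Q' <= Q} ->
  (row a (mskmx (pred1 a) Q M) <= mskmx P Q M)%MS ->
  (row a (mskmx (pred1 a) Q' M) <= mskmx P' Q' M)%MS.
Proof.
move=> PP' QQ' /sub_mskmxP[c [cP cQ]]; apply/sub_mskmxP; exists c; split.
  by move=> i /cP; exact: PP'.
by move=> j Q'j; apply: cQ; exact: QQ'.
Qed.

Lemma eq_mskmx P P' Q Q' M : P =1 P' -> Q =1 Q' -> mskmx P Q M = mskmx P' Q' M.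
Proof. by move=> PE QE; apply/matrixP => i j; rewrite !mxE PE QE. Qed.

End MaskedMatrices.

(** * Counting solutions of linear systems over a finite field *)

Section Counting.

Variables (F : finFieldType) (N : nat).
Implicit Types (P Q : pred 'I_N) (M : 'M[F]_N).

Lemma card_submx m (K : 'M[F]_(m, N)) :
  #|[set c : 'rV[F]_N | (c <= K)%MS]| = (#|F| ^ \rank K)%N.
Proof.
have injK : injective (fun u : 'rV[F]_(\rank K) => u *m row_base K).
  exact/row_free_injr/row_base_free.
have <- : [set u *m row_base K | u : 'rV[F]_(\rank K)] = [set c | (c <= K)%MS].
  apply/setP => c; rewrite inE; apply/imsetP/idP => [[u _ ->]|].
    by apply: submx_trans (submxMl u _) _; rewrite eq_row_base.
  have KB : (K <= row_base K)%MS by rewrite eq_row_base.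
  by move=> /submx_trans/(_ KB)/submxP[u ->]; exists u.
by rewrite card_imset // card_mx mul1n.
Qed.

(** A solvable system has a coset of the kernel, of dimension N - rank, as its solution set. The
    rank is moved to the left side to avoid a subtraction in the exponent. *)
Lemma card_mulmx_eq m (A : 'M[F]_(N, m)) (w : 'rV[F]_m) :
  (#|[set c : 'rV[F]_N | c *m A == w]| * #|F| ^ \rank A
   = (w <= A)%MS * #|F| ^ N)%N.
Proof.
case: (boolP (w <= A)%MS) => [/submxP[c0 ->]|wA]; last first.
  rewrite mul0n; apply/eqP; rewrite muln_eq0 cards_eq0; apply/orP; left.
  apply/eqP/setP => c; rewrite !inE; apply: contraNF wA => /eqP <-.
  exact: submxMl.
have -> : [set c | c *m A == c0 *m A]
    = [set c + c0 | c in [set c : 'rV[F]_N | (c <= kermx A)%MS]].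
  apply/setP => c; rewrite inE -subr_eq0 -mulmxBl.
  apply/idP/imsetP => [/eqP cA|[d]].
    by exists (c - c0); rewrite ?subrK // inE; apply/sub_kermxP.
  by rewrite inE => /sub_kermxP dA ->; rewrite addrK dA.
rewrite card_imset; last exact: addIr.
by rewrite card_submx -expnD mxrank_ker subnK ?rank_leq_row ?mul1n.
Qed.

Definition suppv P : {set 'rV[F]_N} :=
  [set c : 'rV[F]_N | [forall i, (c 0 i != 0) ==> P i]].

Lemma suppvP P (c : 'rV[F]_N) :
  reflect (forall i, c 0 i != 0 -> P i) (c \in suppv P).
Proof.
by rewrite inE; apply: (iffP forallP) => h i; [exact/implyP|apply/implyP/h].
Qed.

Lemma suppv0 P (c : 'rV[F]_N) i : c \in suppv P -> ~~ P i -> c 0 i = 0.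
Proof. by move=> /suppvP cP; apply: contraNeq => /cP. Qed.

Lemma suppvD P (c d : 'rV[F]_N) :
  c \in suppv P -> d \in suppv P -> c + d \in suppv P.
Proof.
move=> cP dP; apply/suppvP => i; rewrite mxE; apply: contraNT => nPi.
by rewrite !(@suppv0 P) // addr0.
Qed.

Lemma suppvZ P a (c : 'rV[F]_N) : c \in suppv P -> a *: c \in suppv P.
Proof.
move=> cP; apply/suppvP => i; rewrite mxE; apply: contraNT => nPi.
by rewrite (@suppv0 P) // mulr0.
Qed.

Lemma suppvN P (c : 'rV[F]_N) : c \in suppv P -> - c \in suppv P.
Proof. by rewrite -scaleN1r; exact: suppvZ. Qed.

Lemma card_suppv P : #|suppv P| = (#|F| ^ #|P|)%N.
Proof.
rewrite -[#|F|]/#|predT : pred F|.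
have <- := @card_pffun_on _ F 0 P predT.
pose h (c : 'rV[F]_N) := [ffun i => c 0 i].
have injh : injective h.
  by move=> c d /ffunP cd; apply/rowP => i; have := cd i; rewrite !ffunE.
rewrite -(card_imset _ injh) -cardsE; apply: eq_card => f; rewrite inE.
apply/imsetP/pffun_onP => [[c /suppvP cP ->]|[fP _]].
  split=> //; apply/subsetP => i; rewrite inE ffunE; exact: cP.
exists (\row_i f i); last by apply/ffunP => i; rewrite !ffunE mxE.
apply/suppvP => i; rewrite mxE => fi; apply: (subsetP fP); by rewrite inE.
Qed.

(* Splitting a row vector into its parts on [P] and off [P] compares solutions
   supported on [P] with arbitrary solutions of the masked system. *)
Lemma card_suppv_sol P Q M a :
  (#|[set c in suppv P | [forall j, Q j ==> ((c *m M) 0%R j == M a j)]]|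
     * #|F| ^ \rank (mskmx P Q M)
   = (row a (mskmx (pred1 a) Q M) <= mskmx P Q M)%MS * #|F| ^ #|P|)%N.
Proof.
set A := mskmx P Q M; set w := row a _.
set X := [set c in suppv P | _].
have mulA (c : 'rV[F]_N) : c \in suppv P ->
    [forall j, Q j ==> ((c *m M) 0 j == M a j)] = (c *m A == w).
  move=> cP; have cA j : (c *m A) 0 j = if Q j then (c *m M) 0 j else 0.
    rewrite !mxE; case: ifP => Qj; last first.
      by rewrite big1 // => i _; rewrite mxE Qj andbF mulr0.
    apply: eq_bigr => i _; rewrite mxE Qj andbT; case: ifP => // /negbT Pi.
    by rewrite (suppv0 cP Pi) !mul0r.
  apply/forallP/eqP => [h|cAw j].
    apply/rowP => j; rewrite cA !mxE /= eqxx /=; case: ifP => // Qj.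
    by have := implyP (h j) Qj; rewrite mxE => /eqP.
  apply/implyP => Qj; have := congr1 (fun v : 'rV_N => v 0 j) cAw.
  by rewrite cA Qj [in RHS]mxE [in RHS]mxE /= eqxx Qj => ->.
have dA d : d \in suppv (predC P) -> d *m A = 0.
  move=> dP; apply/rowP => j; rewrite !mxE big1 // => i _; rewrite mxE.
  case: (boolP (P i)) => Pi; last by rewrite mulr0.
  by rewrite (suppv0 dP) ?mul0r //= negbK.
have solE : [set c | c *m A == w]
    = [set p.1 + p.2 | p in setX X (suppv (predC P))].
  apply/setP => c; rewrite inE; apply/idP/imsetP => [/eqP cA|[[d d']]]; last first.
    rewrite in_setX /= => /andP[]; rewrite inE => /andP[dP dM] d'P ->.
    by rewrite /= mulmxDl (dA d') // addr0 -mulA.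
  pose d := \row_i if P i then c 0 i else 0.
  pose d' := \row_i if P i then 0 else c 0 i.
  have cdd : c = d + d'.
    by apply/rowP => i; rewrite !mxE; case: ifP; rewrite ?addr0 ?add0r.
  have dP : d \in suppv P.
    by apply/suppvP => i; rewrite mxE; case: ifP => //; rewrite eqxx.
  have d'P : d' \in suppv (predC P).
    by apply/suppvP => i; rewrite mxE /=; case: ifP => //; rewrite eqxx.
  exists (d, d') => //; rewrite in_setX /= d'P andbT inE dP mulA //.
  by rewrite -cA cdd mulmxDl (dA d') // addr0 eqxx.
have inj : {in setX X (suppv (predC P)) &,
    injective (fun p : 'rV[F]_N * 'rV[F]_N => p.1 + p.2)}.
  move=> [c d] [c' d'] /=; rewrite !in_setX /= => /andP[].
  rewrite inE => /andP[cP _] dP /andP[]; rewrite inE => /andP[c'P _] d'P.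
  move/rowP=> cd; congr (_, _); apply/rowP => i; have := cd i; rewrite !mxE.
    case: (boolP (P i)) => Pi; last by rewrite (suppv0 cP) // (suppv0 c'P).
    by rewrite (suppv0 dP) ?(suppv0 d'P) ?addr0 //= negbK.
  case: (boolP (P i)) => Pi; first by rewrite (suppv0 dP) ?(suppv0 d'P) //= negbK.
  by rewrite (suppv0 cP) // (suppv0 c'P) // !add0r.
have := card_mulmx_eq A w.
rewrite solE (card_in_imset inj) cardsX card_suppv.
have -> : (#|F| ^ N = #|F| ^ #|P| * #|F| ^ #|predC P|)%N.
  by rewrite -expnD cardC card_ord.
rewrite mulnA mulnAC.
by move/eqP; rewrite eqn_pmul2r ?expn_gt0 ?(ltnW (card_finNzRing_gt1 F)) // => /eqP.
Qed.

End Counting.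

(** * Orthogonality of additive characters *)

Section AdditiveCharacters.

Variables (F : finFieldType) (C : fieldType) (chi : F -> C).
Hypotheses (chiP : is_add_char chi) (chi_nt : exists a, chi a != 1).

(** Translation by d permutes D and multiplies the sum by [chi (phi d)], which is not 1. *)
Lemma sum_char_eq0 (V : finZmodType) (D : {set V}) (phi : V -> F) (d : V) :
  {morph phi : u w / u + w} -> (forall u, (u + d \in D) = (u \in D)) ->
  chi (phi d) != 1 -> \sum_(u in D) chi (phi u) = 0.
Proof.
move=> phiD Dd chi1; set S := \sum_(u in D) _.
have : S = S * chi (phi d).
  rewrite {1}/S (reindex_inj (addIr d)) mulr_suml; apply: eq_big => // u _.
  by rewrite phiD (chiP.2).
move/eqP; rewrite -{1}[S]mulr1 -subr_eq0 -mulrBr mulf_eq0 subr_eq0 [1 == _]eq_sym.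
by rewrite (negPf chi1) orbF => /eqP.
Qed.

Lemma chi_scale (a : F) : a != 0 -> exists b, chi (b * a) != 1.
Proof. by move=> a0; case: chi_nt => b chib; exists (b / a); rewrite divfK. Qed.

Lemma sum_char_suppv N (Q : pred 'I_N) (u : 'rV[F]_N) :
  \sum_(e in suppv F Q) chi ((e *m u^T) 0 0)
  = ([forall j, Q j ==> (u 0 j == 0)] : nat)%:R * (#|F| ^ #|Q|)%:R.
Proof.
case: (boolP [forall _, _]) => [/forallP h|].
  rewrite mul1r -card_suppv -sum1_card natr_sum; apply: eq_bigr => e eQ.
  rewrite mxE big1 ?(chiP.1) // => j _; rewrite mxE.
  case: (boolP (Q j)) => [/(implyP (h j))/eqP ->|Qj]; first by rewrite mulr0.
  by rewrite (suppv0 eQ Qj) mul0r.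
case/forallPn => j; rewrite negb_imply mul0r => /andP[Qj uj].
have [b chib] := chi_scale uj.
apply: (@sum_char_eq0 _ _ (fun e => (e *m u^T) 0 0) (b *: delta_mx 0 j)).
- by move=> e e'; rewrite mulmxDl mxE.
- have dQ : b *: delta_mx 0 j \in suppv F Q.
    apply: suppvZ; apply/suppvP => i; rewrite mxE eqxx /=.
    by case: (eqVneq i j) => [-> //|]; rewrite eqxx.
  move=> e; apply/idP/idP => [eQ|eQ]; last exact: suppvD.
  by rewrite -[e](addrK (b *: delta_mx 0 j)) suppvD // suppvN.
- by rewrite -scalemxAl mxE -rowE !mxE.
Qed.

End AdditiveCharacters.

(** * Types and cut ranks *)

Section Pivots.

Variables (F : fieldType) (N : nat) (mu : {ffun 'I_N -> bool}).

Definition Slt (a : nat) : pred 'I_N := [pred i | ~~ mu i && (i < a)%N].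
Definition Tge (b : nat) : pred 'I_N := [pred j | mu j && (b <= j)%N].

Variable M : 'M[F]_N.

Local Notation cr := (corner_rank mu M).

Definition sigma_support : {set 'I_N} :=
  [set i | [exists p in sigma_set mu M, (i == p.1) || (i == p.2)]].

Lemma corner_rankE a b : cr a b = \rank (mskmx (Slt a) (Tge b) M).
Proof.
congr (\rank _); apply/matrixP => i j; rewrite !mxE !inE /=.
rewrite /Slt /Tge /=; by case: (mu i); case: (mu j); case: (i < a)%N; case:
  (b <= j)%N.
Qed.

(** For s in S, failure of [rsub s b] is exactly a jump of the corner rank when row s is added below
    the rows < s; for t in T, failure of [csub t a] is one when column t is added to the left of the
    columns > t. *)
Let rsub (s : 'I_N) b :=
  (row s (mskmx (pred1 s) (Tge b) M) <= mskmx (Slt s) (Tge b) M)%MS.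
Let csub (t : 'I_N) a :=
  (row t (mskmx (pred1 t) (Slt a) M^T) <= mskmx (Tge t.+1) (Slt a) M^T)%MS.

Let cr_row (s : 'I_N) b : cr s.+1 b = (cr s b + (~~ mu s && ~~ rsub s b))%N.
Proof.
rewrite !corner_rankE; case: (boolP (mu s)) => ms /=.
  rewrite addn0; congr (\rank _); apply: eq_mskmx => // i; rewrite /Slt /= ltnS.
  rewrite leq_eqVlt; case: (eqVneq (i : nat) s) => //= /val_inj ->.
  by rewrite ms.
apply: mxrank_mskmxD1 => i; rewrite /Slt /= ltnS leq_eqVlt.
rewrite -[(i : nat) == s]/(i == s).
by case: eqVneq => [->|_] /=; rewrite ?ms.
Qed.

Let cr_col a (t : 'I_N) : cr a t = (cr a t.+1 + (mu t && ~~ csub t a))%N.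
Proof.
rewrite !corner_rankE -!(mxrank_tr (mskmx _ _ _)) !mskmx_tr.
case: (boolP (mu t)) => mt /=.
  apply: mxrank_mskmxD1 => i; rewrite /Tge /= [(t <= i)%N]leq_eqVlt eq_sym.
  rewrite -[(i : nat) == t]/(i == t).
  by case: eqVneq => [->|_] /=; rewrite ?mt.
rewrite addn0; congr (\rank _); apply: eq_mskmx => // i; rewrite /Tge /=.
rewrite [(t <= i)%N]leq_eqVlt; case: (eqVneq (t : nat) i) => //= /val_inj <-.
by rewrite (negPf mt).
Qed.

Let cr0 b : cr 0 b = 0%N.
Proof.
rewrite corner_rankE; apply/eqP; rewrite mxrank_eq0; apply/eqP/matrixP => i j.
by rewrite !mxE /Slt /= andbF.
Qed.

Let crN a : cr a N = 0%N.
Proof.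
rewrite corner_rankE; apply/eqP; rewrite mxrank_eq0; apply/eqP/matrixP => i j.
by rewrite !mxE /Tge /= leqNgt ltn_ord !andbF.
Qed.

Let rsubS (s : 'I_N) b b' : (b <= b')%N -> rsub s b -> rsub s b'.
Proof.
move=> bb'; apply: sub_mskmxS => // j; rewrite !unfold_in /= => /andP[->] /=.
exact: leq_trans.
Qed.

Let csubS (t : 'I_N) a a' : (a <= a')%N -> csub t a' -> csub t a.
Proof.
move=> aa'; apply: sub_mskmxS => // j; rewrite !unfold_in /= => /andP[->] /=.
by move=> ja; apply: leq_trans aa'.
Qed.

Let jump (p : pred nat) a b : (a <= b)%N -> ~~ p a -> p b ->
  exists c, [/\ (a <= c)%N, (c < b)%N, ~~ p c & p c.+1].
Proof.
move=> + pa; elim: b => [|b IH]; first by rewrite leqn0 => /eqP <-;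
  rewrite (negPf pa).
rewrite leq_eqVlt => /predU1P[<-|]; first by rewrite (negPf pa).
rewrite ltnS => ab pb; case: (boolP (p b)) => [/(IH ab)[c [ac cb pc pc1]]|pb'].
  by exists c; rewrite ac pc pc1 (leq_trans cb).
by exists b; rewrite ab ltnSn pb' pb.
Qed.

(** As b grows, [rsub s b] can only turn from false to true, and it is true at b = N, where no
    column is left. If it is false at s + 1, the last b at which it fails is a column of T, and (s,
    b) meets the rank conditions of sigma. Conversely, a position (s, t) of sigma makes [rsub s t]
    fail, hence also [rsub s s.+1]. *)
Lemma sigma_support_row (s : 'I_N) : ~~ mu s ->
  (s \in sigma_support) = ~~ rsub s s.+1.
Proof.
move=> ms; rewrite inE; apply/existsP/idP.
  case=> -[s' t'] /=; rewrite !inE /= => /andP[/andP[/and3P[_ mt' st']]].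
  rewrite [in X in _ -> X]eq_sym => /and3P[/eqP c1 _ _] /orP[/eqP ss'|/eqP tt'];
    last by rewrite -tt' (negPf ms) in mt'.
  subst s'; have := cr_row s t'; rewrite ms /= -c1.
  by case: (boolP (rsub s t')) => [|/(contra (rsubS st'))] //=; lia.
move=> nr; have rN : rsub s N.
  have := cr_row s N; rewrite ms !crN /=.
  by case: (rsub s N).
have [b [sb bN nrb rb]] := jump (ltn_ord s) nr rN.
pose t := Ordinal bN.
have mt : mu t.
  have := cr_row s b; have := cr_row s b.+1; rewrite ms (negPf nrb) rb /=.
  have := cr_col s t; have := cr_col s.+1 t; case: (mu t) => //=; lia.
exists (s, t); rewrite !inE /= ms mt sb eqxx /= andbT.
have := cr_row s b; have := cr_row s b.+1; rewrite ms (negPf nrb) rb /=.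
by have := cr_col s t; have := cr_col s.+1 t; rewrite mt /=;
  do 2 case: (csub _ _) => /=; rewrite -![cr _ t]/(cr _ b); lia.
Qed.

(** The transposed argument: [csub t a] holds at a = 0, where no row is left, and fails at a = t;
    the last a at which it holds is the row paired with t. *)
Lemma sigma_support_col (t : 'I_N) : mu t ->
  (t \in sigma_support) = ~~ csub t t.
Proof.
move=> mt; rewrite inE; apply/existsP/idP.
  case=> -[s' t'] /=; rewrite !inE /= => /andP[/andP[/and3P[ms' _ st']]].
  move=> /and3P[_ /eqP c1 _] /orP[/eqP ss'|/eqP tt'];
    first by rewrite -ss' mt in ms'.
  subst t'; have := cr_col s'.+1 t; rewrite mt /= -c1.
  by case: (boolP (csub t s'.+1)) => [|/(contra (csubS st'))] //=; lia.
move=> nc; have c0 : csub t 0.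
  have := cr_col 0 t; rewrite mt !cr0 /=.
  by case: (csub t 0).
have [a [_ a_t]] := @jump (fun a => ~~ csub t a) 0 t (leq0n _) (introT negPn c0) nc.
rewrite negbK => ca nca.
pose s := Ordinal (ltn_trans a_t (ltn_ord t)).
have ms : ~~ mu s.
  have := cr_col a t; have := cr_col a.+1 t; rewrite mt ca (negPf nca) /=.
  have := cr_row s t; have := cr_row s t.+1; case: (mu s) => //=; lia.
exists (s, t); rewrite !inE /= ms mt a_t eqxx /= orbT andbT.
have := cr_col a t; have := cr_col a.+1 t; rewrite mt ca (negPf nca) /=.
by have := cr_row s t; have := cr_row s t.+1; rewrite ms /=;
  do 2 case: (rsub _ _) => /=; rewrite -![cr s _]/(cr a _) -![cr s.+1 _]/(cr a.+1
    _); lia.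
Qed.

Local Notation lam := sigma_support.

Let cut_row (i : 'I_N) : ~~ mu i -> cr i.+1 i.+1 = (cr i i + (i \in lam))%N.
Proof.
move=> mi; rewrite sigma_support_row //.
by have := cr_row i i.+1; have := cr_col i i; rewrite mi (negPf mi) /= addn0 => ->.
Qed.

Let cut_col (i : 'I_N) : mu i -> cr i i = (cr i.+1 i.+1 + (i \in lam))%N.
Proof.
move=> mi; rewrite sigma_support_col //.
by have := cr_row i i.+1; have := cr_col i i; rewrite mi /= addn0 => -> ->.
Qed.

(* [cr i i] is the rank of the block cut out by the rows < i and the columns >= i;
   it changes by at most one at each index, and exactly at those of the type. *)
Let cut_sum a : (a <= N)%N ->
  (cr a a + \sum_(i < N | mu i && (i < a)%N) (i \in lam)
   = \sum_(i < N | ~~ mu i && (i < a)%N) (i \in lam))%N.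
Proof.
elim: a => [_|a IH aN].
  by rewrite cr0 !big_pred0 // => i; rewrite ltn0 andbF.
have := IH (ltnW aN); pose k := Ordinal aN.
have split (P : pred 'I_N) : (\sum_(i < N | P i && (i < a.+1)) (i \in lam)
    = \sum_(i < N | P i && (i < a)) (i \in lam) + (if P k then (k \in lam) : nat
      else 0))%N.
  rewrite (bigID [pred i : 'I_N | (i < a)%N]) /=; congr (_ + _)%N.
    apply: eq_bigl => i; rewrite -andbA; congr (_ && _).
    by apply: andb_idl => /leqW.
  case: (boolP (P k)) => Pk.
    rewrite (big_pred1 k) // => i /=; rewrite ltnS -leqNgt -andbA -eqn_leq.
    rewrite -[RHS]/((i : nat) == a); case: eqP => [ia|]; rewrite ?andbF // andbT.
    by have -> : i = k by apply: val_inj.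
  rewrite big_pred0 // => i; rewrite ltnS -leqNgt -andbA -eqn_leq.
  case: eqP => [ia|]; rewrite ?andbF // andbT.
  by have -> : i = k by [apply: val_inj]; rewrite (negPf Pk).
rewrite !split.
case: (boolP (mu k)) => mk /=.
  by have := cut_col mk => /=; rewrite -[cr k k]/(cr a a); lia.
by have := cut_row mk => /=; rewrite -[cr k k]/(cr a a); lia.
Qed.

Lemma card_setI_sum (A B : {set 'I_N}) :
  #|A :&: B| = (\sum_(i in A) (i \in B))%N.
Proof.
rewrite -sum1_card big_mkcond [RHS]big_mkcond.
by apply: eq_bigr => i _; rewrite inE; case: (i \in A); case: (i \in B).
Qed.

Lemma card_setD_sum (A B : {set 'I_N}) :
  (#|A :\: B| + \sum_(i in A) (i \in B) = #|A|)%N.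
Proof. by rewrite -card_setI_sum addnC cardsID. Qed.

Lemma sigma_support_balanced :
  #|Tset mu :&: lam| = #|Sset mu :&: lam|.
Proof.
have := cut_sum (leqnn N); rewrite crN add0n => E.
rewrite !card_setI_sum; transitivity (\sum_(i < N | mu i && (i < N)%N) (i \in lam))%N.
  by apply: eq_bigl => i; rewrite inE ltn_ord andbT.
by rewrite E; apply: eq_bigl => i; rewrite inE ltn_ord andbT.
Qed.

Lemma sigma_support_half : #|lam|./2 = #|Tset mu :&: lam| /\ ~~ odd #|lam|.
Proof.
have -> : #|lam| = #|Tset mu :&: lam|.*2.
  rewrite -addnn {2}sigma_support_balanced -(cardsID (Tset mu) lam) setIC.
  congr (_ + _)%N; apply: eq_card => i; rewrite !inE; case: (mu i) => //=.
by rewrite doubleK odd_double.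
Qed.

(** For m outside the type the block has the rank D(m), which [cut_sum] expresses as the number of
    type indices below m in S minus the number of those in T. With |lam|/2 = |T meet lam| the type
    indices of T below m cancel, and kappa becomes the exponent that counts solutions in the
    block. *)
Lemma kappa_rank (m : 'I_N) : m \notin lam ->
  (kappa m mu lam + \rank (mskmx (Slt m) (Tge m.+1) M) = #|Slt m| + #|Tge m.+1|)%N.
Proof.
move=> ml; rewrite -corner_rankE /kappa (proj1 sigma_support_half).
have crm : cr m m.+1 = cr m m.
  case: (boolP (mu m)) => mm.
    have := cut_col mm; have := cr_row m m.+1.
    by rewrite mm (negPf ml) /= !addn0 => -> ->.
  by have := cr_col m m; rewrite (negPf mm) /= addn0.
have -> : #|Slt m| = #|[set s in Sset mu | (s < m)%N]|.
  by apply: eq_card => i; rewrite !inE.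
have -> : #|Tge m.+1| = #|[set t in Tset mu | (m < t)%N]|.
  by apply: eq_card => i; rewrite !inE.
rewrite -2!(card_setD_sum [set _ in _ | _] lam) crm.
have : #|Tset mu :&: lam| = (\sum_(i < N | mu i && (i < m)) (i \in lam)
    + \sum_(i in [set t in Tset mu | (m < t)%N]) (i \in lam))%N.
  rewrite card_setI_sum big_mkcond [X in (X + _)%N]big_mkcond.
  rewrite [X in (_ + X)%N]big_mkcond -big_split; apply: eq_bigr => i _ /=.
  rewrite [i \in [set _ in _ | _]]inE ![i \in Tset _]inE; case: (mu i) => //=;
    case: (ltngtP i m) => //=.
  - by rewrite addn0.
  - by move/val_inj => ->; rewrite (negPf ml).
have := cut_sum (ltnW (ltn_ord m)).
have -> : (\sum_(i in [set s in Sset mu | (s < m)%N]) (i \in lam)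
   = \sum_(i < N | ~~ mu i && (i < m)%N) (i \in lam))%N.
  by apply: eq_bigl => i; rewrite !inE.
lia.
Qed.

End Pivots.

(** * Telescoping sums of powers of q *)

Section Telescoping.

Variables (N : nat) (mu : {ffun 'I_N -> bool}) (lam : {set 'I_N}).
Hypotheses (half : #|lam|./2 = #|Tset mu :&: lam|)
           (bal : #|Tset mu :&: lam| = #|Sset mu :&: lam|).

(** An analogue of kappa for a cut between two indices instead of at an index. For m outside [lam]
    the values [f m] and [f m.+1] are kappa and kappa + 1 in the order given by mu_m, so (q - 1)
    q^kappa is a difference of consecutive terms up to sign. *)
Let f (a : nat) : nat :=
  (#|[set s in Sset mu | (s < a)%N] :\: lam|
   + #|[set t in Tset mu | (a <= t)%N] :\: lam| + #|lam|./2)%N.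

Let f0 : f 0 = #|Tset mu|.
Proof.
rewrite /f half -(cardsID lam (Tset mu)) [RHS]addnC; congr (_ + _)%N.
rewrite (_ : [set s in _ | _] = set0) ?set0D ?cards0 //; last first.
  by apply/setP => i; rewrite !inE ltn0 andbF.
by congr #|_ :\: _|; apply/setP => i; rewrite !inE andbT.
Qed.

Let fN : f N = #|Sset mu|.
Proof.
rewrite /f half bal -(cardsID lam (Sset mu)) [RHS]addnC; congr (_ + _)%N.
rewrite [X in (_ + #|X :\: _|)%N](_ : _ = set0) ?set0D ?cards0 ?addn0; last first.
  by apply/setP => i; rewrite !inE leqNgt ltn_ord andbF.
by congr #|_ :\: _|; apply/setP => i; rewrite !inE ltn_ord andbT.
Qed.

Let f_step (m : 'I_N) :
  if m \in lam then f m.+1 = f m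
  else if mu m then f m = (kappa m mu lam).+1 /\ f m.+1 = kappa m mu lam
  else f m.+1 = (kappa m mu lam).+1 /\ f m = kappa m mu lam.
Proof.
have Slt1 : #|[set s in Sset mu | (s < m.+1)%N] :\: lam|
    = (#|[set s in Sset mu | (s < m)%N] :\: lam| + (~~ mu m && (m \notin lam)))%N.
  rewrite (cardsD1 m) !inE ltnSn andbT andbC addnC; congr (_ + _)%N.
  apply: eq_card => i; rewrite !inE ltnS leq_eqVlt -[(i : nat) == m]/(i == m).
  by case: eqVneq => [->|] //=; rewrite ltnn !andbF.
have Tge1 : #|[set t in Tset mu | (m <= t)%N] :\: lam|
    = (#|[set t in Tset mu | (m < t)%N] :\: lam| + (mu m && (m \notin lam)))%N.
  rewrite (cardsD1 m) !inE leqnn andbT andbC addnC; congr (_ + _)%N.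
  apply: eq_card => i; rewrite !inE [(m <= i)%N]leq_eqVlt -[(m : nat) == i]/(m ==
    i) [m == i]eq_sym.
  by case: eqVneq => [->|] //=; rewrite ltnn !andbF.
rewrite /f /kappa Slt1 Tge1.
by case: (m \in lam); case: (mu m) => /=; rewrite ?andbF ?andbT /=; lia.
Qed.

Lemma telescope_kappa (C : fieldType) (q : C) :
  (q - 1) * \sum_(m < N) (if m \in lam then 0
                          else (-1) ^+ (~~ mu m) * q ^+ kappa m mu lam)
  = q ^+ #|Tset mu| - q ^+ #|Sset mu|.
Proof.
have := @telescope_sumr C 0 N (fun a => - q ^+ f a) (leq0n _).
rewrite big_mkord f0 fN opprK addrC => <-; rewrite mulr_sumr.
apply: eq_bigr => m _; have := f_step m.
case: ifP => [_ ->|_]; first by rewrite mulr0 subrr.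
by case: (mu m) => -[-> ->] /=; rewrite ?expr0 ?expr1 ![q ^+ _.+1]exprS; ring.
Qed.

(** The extra factor q comes from (q - 1) q^-kappa = q (q^-kappa - q^-(kappa+1)). *)
Lemma telescope_kappaV (C : fieldType) (q : C) : q != 0 ->
  (q - 1) * \sum_(m < N) (if m \in lam then 0
                          else (-1) ^+ (mu m) * q ^- kappa m mu lam)
  = q * (q ^- #|Tset mu| - q ^- #|Sset mu|).
Proof.
move=> q0.
have := @telescope_sumr C 0 N (fun a => - q ^- f a) (leq0n _).
rewrite big_mkord f0 fN opprK addrC => <-; rewrite !mulr_sumr.
apply: eq_bigr => m _; have := f_step m.
case: ifP => [_ ->|_]; first by rewrite subrr !mulr0.
have k0 := expf_neq0 (kappa m mu lam) q0.
by case: (mu m) => -[-> ->] /=; rewrite ?expr0 ?expr1 ![q ^+ _.+1]exprS; field;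
  rewrite ?k0 ?q0.
Qed.

End Telescoping.

(** * Locations and matrix forms *)

Section Coordinates.

Variables (F : finFieldType) (H : vectType F) (N : nat).
Variables (x : 'I_N.+1 -> {vspace H}) (v : N.-tuple H).
Hypothesis vP : basis_of fullv v.
Hypothesis xE : forall i : 'I_N.+1, x i = <<take i v>>%VS.

Implicit Types (y w z : {vspace H}) (u : H) (mu nu : {ffun 'I_N -> bool}).

Local Notation co i u := (coord v i u).
Local Notation phi i := (linfun (coord v i : H -> F^o)).
Local Notation loc := (location x).
Local Notation mf := (matrix_form x v).

Let coE u : u = \sum_i co i u *: tnth v i.
Proof.
rewrite {1}(coord_basis vP (memvf u)); apply: eq_bigr => i _.
by rewrite (tnth_nth 0).
Qed.

Let co_tnth i j : co i (tnth v j) = (j == i)%:R.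
Proof. by rewrite (tnth_nth 0) coord_free // (basis_free vP). Qed.

Let co_inj u u' : (forall i, co i u = co i u') -> u = u'.
Proof. by move=> uu'; rewrite [u]coE [u']coE; apply: eq_bigr => i _; rewrite uu'. Qed.

Let phiE i u : phi i u = co i u.
Proof. by rewrite lfunE. Qed.

Lemma mem_flag (i : 'I_N.+1) u :
  reflect (forall j : 'I_N, (i <= j)%N -> co j u = 0) (u \in x i).
Proof.
have iv : (i <= size v)%N by rewrite size_tuple -ltnS ltn_ord.
rewrite xE; apply: (iffP idP) => [ux j ij|u0].
  have /subvP/(_ u ux) : (<<take i v>> <= lker (phi j))%VS.
    apply/span_subvP => w /(nthP 0)[k]; rewrite size_takel // => ki <-.
    rewrite nth_take // memv_ker phiE.
    have kN : (k < N)%N by have := leq_trans ki iv; rewrite size_tuple.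
    rewrite -(tnth_nth 0 v (Ordinal kN)) co_tnth;
      case: (eqVneq (Ordinal kN) j) => [jk|_].
      by move: ij; rewrite -jk /= leqNgt ki.
    by rewrite eqxx.
  by rewrite memv_ker phiE => /eqP.
rewrite [u]coE; apply: memv_suml => j _; case: (leqP i j) => ij.
  by rewrite u0 // scale0r mem0v.
apply/memvZ/memv_span/(nthP 0); exists j.
  by rewrite size_takel.
by rewrite nth_take // (tnth_nth 0).
Qed.

Let up (m : 'I_N) : 'I_N.+1 := lift ord0 m.
Let down (m : 'I_N) : 'I_N.+1 := widen_ord (leqnSn N) m.

Let leading y m := (phi m @: (y :&: x (up m)) != 0)%VS.

(** Rank-nullity for the coordinate form [phi m] on the intersection of y with the larger flag
    space: its kernel is the intersection with the smaller one, and its image has dimension at most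
    1. *)
Let dim_step y m :
  \dim (y :&: x (up m))%VS = (\dim (y :&: x (down m))%VS + leading y m)%N.
Proof.
rewrite -(limg_ker_dim (phi m)); congr (_ + _)%N.
  congr (\dim _); apply/vspaceP => u; rewrite !memv_cap memv_ker phiE -andbA.
  case: (u \in y) => //=; apply/andP/mem_flag.
    case=> /mem_flag ux /eqP um j; rewrite leq_eqVlt => /predU1P[mj|].
      by have <- : m = j by apply: val_inj.
    exact: ux.
  move=> u0; split; last by rewrite u0.
  by apply/mem_flag => j mj; apply: u0; apply: ltnW.
rewrite /leading -dimv_eq0.
have := dimvS (subvf (phi m @: (y :&: x (up m)))).
by rewrite dimvf /dim /=; case: (\dim _) => [|[|]].
Qed.

Let leadingP y m :
  reflect (exists u, [/\ u \in y, co m u != 0 &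
             forall j : 'I_N, (m < j)%N -> co j u = 0]) (leading y m).
Proof.
apply: (iffP idP) => [nz|[u [uy um u0]]].
  have := memv_pick (phi m @: (y :&: x (up m))).
  case/memv_imgP => u; rewrite memv_cap => /andP[uy /mem_flag ux] pE.
  exists u; split=> //; apply: contraNneq nz => um.
  by rewrite -vpick0 pE phiE um.
apply: contraNneq um => h; rewrite -[co m u]phiE.
have : phi m u \in (phi m @: (y :&: x (up m)))%VS.
  by apply: memv_img; rewrite memv_cap uy; apply/mem_flag.
by rewrite h memv0.
Qed.

Let leadloc y : {ffun 'I_N -> bool} := [ffun m => leading y m].

Let sum_le_lt (f : 'I_N -> nat) (m : 'I_N) :
  (\sum_(i < N | (i <= m)%N) f i = \sum_(i < N | (i < m)%N) f i + f m)%N.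
Proof.
rewrite (bigD1 m) //= addnC; congr (_ + _)%N; apply: eq_bigl => i.
by rewrite ltn_neqAle andbC.
Qed.

Let dim_flag y (a : 'I_N.+1) :
  \dim (y :&: x a)%VS = (\sum_(i < N | (i < a)%N) leading y i)%N.
Proof.
case: a => a; elim: a => [|a IH] aN.
  rewrite big_pred0 // xE take0 span_nil capv0 dimv0 //.
have aN' : (a < N)%N by [].
have -> : Ordinal aN = up (Ordinal aN') by apply: val_inj.
rewrite dim_step; have -> : down (Ordinal aN') = Ordinal (ltnW aN) by apply: val_inj.
rewrite IH -(sum_le_lt (fun i => leading y i) (Ordinal aN')).
by apply: eq_bigl => i; rewrite ltnS.
Qed.

Lemma is_locationE y mu : is_location x y mu = (mu == leadloc y).
Proof.
apply/forallP/eqP => [h|-> m]; last first.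
  by rewrite dim_flag; apply/eqP/eq_big => i; rewrite ?ffunE.
have E (m : 'I_N) : (\sum_(i < N | (i <= m)%N) mu i
    = \sum_(i < N | (i <= m)%N) leading y i)%N.
  by have := h m; rewrite dim_flag => /eqP <-.
apply/ffunP => -[m mN]; elim/ltn_ind: m mN => m IH mN; rewrite ffunE.
have := E (Ordinal mN).
rewrite (sum_le_lt (fun i => mu i)) (sum_le_lt (fun i => leading y i)).
rewrite (eq_bigr (fun i => leading y i : nat)).
  by move/addnI; case: (mu _); case: (leading _ _).
by move=> [i iN] /= im; rewrite (IH i im) ffunE.
Qed.

Let locE y : loc y = leadloc y.
Proof.
rewrite /location; case: pickP => [mu|/(_ (leadloc y))].
  by rewrite is_locationE => /eqP.
by rewrite is_locationE eqxx.
Qed.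

Lemma is_location_loc y mu : is_location x y mu = (loc y == mu).
Proof. by rewrite is_locationE -locE eq_sym. Qed.

Lemma locationP y m :
  reflect (exists u, [/\ u \in y, co m u != 0 &
             forall j : 'I_N, (m < j)%N -> co j u = 0]) (loc y m).
Proof. by rewrite locE ffunE; exact: leadingP. Qed.

Lemma dim_location y : \dim y = #|Tset (loc y)|.
Proof.
transitivity (\dim (y :&: x ord_max)%VS).
  by rewrite xE take_oversize ?size_tuple // (span_basis vP) capvf.
rewrite dim_flag -sum1_card [RHS]big_mkcond [LHS]big_mkcond /=.
by apply: eq_bigr => i _; rewrite inE ltn_ord locE ffunE; case: leading.
Qed.

Lemma location_sub y w m : (y <= w)%VS -> loc y m -> loc w m.
Proof.
move=> yw /locationP[u [uy um u0]]; apply/locationP; exists u; split=> //.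
exact: subvP yw _ uy.
Qed.

(** The last nonzero coordinate of a nonzero vector of y sits at an index of the location.
    Coordinates are shown to vanish from the top index downwards. *)
Let mem_eq0 y u : u \in y -> (forall t, loc y t -> co t u = 0) -> u = 0.
Proof.
move=> uy u0; apply: co_inj => i; rewrite linear0.
have key n : forall j : 'I_N, (N - n <= j)%N -> co j u = 0.
  elim: n => [|n IH] j; first by rewrite subn0 leqNgt ltn_ord.
  case: (leqP (N - n) j) => [/IH //|jn nj].
  apply/eqP; case: (boolP (loc y j)) => [/u0 -> //|].
  apply: contraNT => uj; apply/locationP; exists u; split=> // k jk.
  by apply: IH; lia.
by apply: (key N); rewrite subnn.
Qed.

Definition bvec mu (Y : 'M[F]_N) t : H :=
  \sum_(s in Sset mu) Y s t *: tnth v s + tnth v t.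

Lemma co_bvec mu Y t i :
  co i (bvec mu Y t) = (if mu i then 0 else Y i t) + (t == i)%:R.
Proof.
rewrite /bvec linearD linear_sum /= co_tnth; congr (_ + _).
under eq_bigr do rewrite linearZ /= co_tnth.
case: ifP => mi.
  rewrite big1 // => s; rewrite inE => ms; case: eqP => [si|_]; last by rewrite mulr0.
  by rewrite si mi in ms.
rewrite (bigD1 i) ?inE ?mi //= eqxx mulr1 big1 ?addr0 // => s /andP[_ /negPf ->].
by rewrite mulr0.
Qed.

Lemma Mspace0 mu (Y : 'M[F]_N) s t :
  Mspace mu Y -> ~~ [&& ~~ mu s, mu t & (s < t)%N] -> Y s t = 0.
Proof.
move=> /forallP/(_ s)/forallP/(_ t); rewrite !inE /= => YB.
by apply: contraNeq; apply/implyP.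
Qed.

Lemma MspaceP mu (Y : 'M[F]_N) :
  reflect (forall s t, Y s t != 0 -> [&& ~~ mu s, mu t & (s < t)%N]) (Mspace mu Y).
Proof.
apply: (iffP idP) => [MY s t|h].
  by apply: contraNT => /(Mspace0 MY) ->.
apply/forallP => s; apply/forallP => t; apply/implyP => /h; by rewrite !inE.
Qed.

(** The reduced echelon basis, built one pivot at a time; its off-pivot coordinates will be the
    entries of the matrix form. *)
Let echelon y : exists b : 'I_N -> H, forall t, loc y t ->
  [/\ b t \in y, forall i, loc y i -> co i (b t) = (t == i)%:R
     & forall i : 'I_N, (t < i)%N -> co i (b t) = 0].
Proof.
suff key n : (n <= N)%N -> exists b : 'I_N -> H, forall t : 'I_N, (t < n)%N -> loc
  y t ->
  [/\ b t \in y, forall i, loc y i -> co i (b t) = (t == i)%:R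
     & forall i : 'I_N, (t < i)%N -> co i (b t) = 0].
  by have [b bP] := key N (leqnn N); exists b => t; apply: bP.
elim: n => [|n IH] nN; first by exists (fun=> 0).
have [b bP] := IH (ltnW nN); pose m := Ordinal nN.
case: (boolP (loc y m)) => ym; last first.
  exists b => t; rewrite ltnS leq_eqVlt => /predU1P[tn|/bP //].
  by have -> : t = m; [apply: val_inj|rewrite (negPf ym)].
have [u [uy um u0]] := locationP y m ym.
(* The earlier basis vectors clear the coordinates of u at the smaller pivots, and scaling makes its
   leading coordinate 1. *)
pose r := (co m u)^-1 *: (u - \sum_(t | loc y t && (t < n)%N) co t u *: b t).
have co_r i : co i r = (co m u)^-1 *
    (co i u - \sum_(t | loc y t && (t < n)%N) co t u * co i (b t)).
  rewrite linearZ /= linearB /= linear_sum /=; congr (_ * (_ - _)).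
  by apply: eq_bigr => t _; rewrite linearZ.
exists (fun t => if t == m then r else b t) => t.
rewrite ltnS leq_eqVlt => tn yt; case: eqVneq => [->|tm]; last first.
  case/predU1P: tn => [tn|tn]; last exact: bP.
  by case/eqP: tm; apply: val_inj.
split=> [|i yi|i mi].
- apply/memvZ/memvB/memv_suml => // t' /andP[yt' t'n].
  by case: (bP t' t'n yt') => bt' _ _; exact: memvZ.
- rewrite co_r; case: (ltngtP i n) => [lt|gt|eq].
  + rewrite (bigD1 i) ?yi //= big1 ?addr0 => [|t' /andP[/andP[yt' t'n] t'i]].
      case: (bP i lt yi) => _ -> // _; rewrite eqxx mulr1 subrr mulr0.
      by case: eqVneq lt => // <-; rewrite ltnn.
    by case: (bP t' t'n yt') => _ -> // _; rewrite (negPf t'i) mulr0.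
  + rewrite (u0 i) // big1 ?subrr ?mulr0 => [|t' /andP[yt' t'n]].
      by case: eqVneq gt => // <-; rewrite ltnn.
    by case: (bP t' t'n yt') => _ _ ->; rewrite ?mulr0 // (ltn_trans t'n).
  + have -> : i = m by apply: val_inj.
    rewrite big1 ?subr0 ?mulVf ?eqxx // => t' /andP[yt' t'n].
    by case: (bP t' t'n yt') => _ _ ->; rewrite ?mulr0.
- rewrite co_r (u0 i) // big1 ?subrr ?mulr0 // => t' /andP[yt' t'n].
  by case: (bP t' t'n yt') => _ _ ->; rewrite ?mulr0 // (ltn_trans t'n).
Qed.

Let mem_bvec y (Y : 'M[F]_N) u : (forall t, loc y t -> bvec (loc y) Y t \in y) ->
  u \in y -> u = \sum_(t | loc y t) co t u *: bvec (loc y) Y t.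
Proof.
move=> Yy uy; apply/eqP; rewrite -subr_eq0; apply/eqP/(@mem_eq0 y).
  by apply/memvB/memv_suml => // t yt; apply/memvZ/Yy.
move=> t yt; rewrite linearB linear_sum /= (bigD1 t) //= big1 ?addr0.
  by rewrite linearZ /= co_bvec yt eqxx add0r mulr1 subrr.
move=> i /andP[_ it]; rewrite linearZ /= co_bvec yt (negPf it).
by rewrite addr0 mulr0.
Qed.

Lemma is_matrix_formP y Y : is_matrix_form x v y Y ->
  Mspace (loc y) Y /\ forall t, loc y t -> bvec (loc y) Y t \in y.
Proof.
case/andP => MY bY; split=> // t yt; apply: (basis_mem bY).
by apply/imageP; exists t; rewrite ?inE.
Qed.

Lemma matrix_formP y :
  Mspace (loc y) (mf y) /\ forall t, loc y t -> bvec (loc y) (mf y) t \in y.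
Proof.
rewrite /matrix_form; case: pickP => [Y /is_matrix_formP //|noY].
(* The default value of [matrix_form] is never reached: the echelon basis provides a matrix form,
   which contradicts [noY]. *)
have [b bP] := echelon y.
pose Y : 'M[F]_N := \matrix_(s, t) if ~~ loc y s && loc y t then co s (b t) else 0.
have bE t : loc y t -> bvec (loc y) Y t = b t.
  move=> yt; case: (bP t yt) => _ bt _; apply: co_inj => i.
  rewrite co_bvec mxE yt andbT; case: (boolP (loc y i)) => yi /=.
    by rewrite bt ?add0r.
  by case: eqVneq => [ti|]; rewrite ?addr0 // -ti yt in yi *.
have Yy t : loc y t -> bvec (loc y) Y t \in y.
  by move=> yt; rewrite bE //; case: (bP t yt).
have := noY Y; rewrite /is_matrix_form; suff -> : Mspace (loc y) Y.
  rewrite basisEdim size_image dim_location leqnn andbT /=.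
  case/negP; apply/subvP => u uy; rewrite (mem_bvec Yy uy).
  apply: memv_suml => t yt; apply/memvZ/memv_span/imageP.
  by exists t; rewrite ?inE.
apply/MspaceP => s t; rewrite mxE; case: (boolP (loc y s)) => ys /=; rewrite ?eqxx //.
case: (boolP (loc y t)) => yt; rewrite ?eqxx //=.
case: (bP t yt) => _ _ b0; apply: contraNT; rewrite -leqNgt leq_eqVlt.
by case/predU1P => [/val_inj ts|/b0 ->] //; rewrite -ts yt in ys.
Qed.

Lemma Mspace_mf y : Mspace (loc y) (mf y).
Proof. by case: (matrix_formP y). Qed.

Lemma mem_matrix_form y u :
  reflect (forall s, ~~ loc y s -> co s u = \sum_(t | loc y t) mf y s t * co t u)
          (u \in y).
Proof.
have [MY Yy] := matrix_formP y.
apply: (iffP idP) => [uy s ys|uE].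
  rewrite {1}(mem_bvec Yy uy) linear_sum /=; apply: eq_bigr => t yt.
  rewrite linearZ /= co_bvec (negPf ys); case: eqVneq => [ts|]; last first.
    by rewrite addr0 mulrC.
  by rewrite -ts yt in ys.
have -> : u = \sum_(t | loc y t) co t u *: bvec (loc y) (mf y) t.
  apply: co_inj => i; rewrite linear_sum /=.
  under eq_bigr do rewrite linearZ /= co_bvec.
  case: (boolP (loc y i)) => yi.
    rewrite (bigD1 i) //= eqxx add0r mulr1 big1 ?addr0 // => t /andP[_ /negPf ->].
    by rewrite addr0 mulr0.
  rewrite uE //; apply: eq_bigr => t yt; case: eqVneq => [ti|]; last first.
    by rewrite addr0 mulrC.
  by rewrite -ti yt in yi.
by apply: memv_suml => t yt; apply/memvZ/Yy.
Qed.

(* The subspace with a given location and matrix form, as the solution set of the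
   equations u_s = \sum_t Y_{s,t} u_t. *)
Definition space_of mu (Y : 'M[F]_N) : {vspace H} :=
  (\bigcap_(s | ~~ mu s) lker (phi s - \sum_(t | mu t) Y s t *: phi t))%VS.

Let mem_space_of mu (Y : 'M[F]_N) u :
  reflect (forall s, ~~ mu s -> co s u = \sum_(t | mu t) Y s t * co t u)
          (u \in space_of mu Y).
Proof.
have memE s : (u \in lker (phi s - \sum_(t | mu t) Y s t *: phi t)%VF)
    = (co s u == \sum_(t | mu t) Y s t * co t u).
  rewrite memv_ker add_lfunE opp_lfunE sum_lfunE phiE subr_eq0; congr (_ == _).
  by apply: eq_bigr => t _; rewrite scale_lfunE phiE.
rewrite memvE; apply: (iffP subv_bigcapP) => h s ms.
  by apply/eqP; rewrite -memE memvE; apply: h.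
by rewrite -memvE memE h.
Qed.

Let bvec_space_of mu (Y : 'M[F]_N) t : mu t -> bvec mu Y t \in space_of mu Y.
Proof.
move=> mt; apply/mem_space_of => s ms; rewrite (bigD1 t) //= big1 => [|i /andP[mi
  it]].
  rewrite !co_bvec mt (negPf ms) eqxx add0r mulr1; case: eqVneq => // ts.
  by rewrite -ts mt in ms.
by rewrite co_bvec mi eq_sym (negPf it) addr0 mulr0.
Qed.

Lemma loc_space_of mu Y : Mspace mu Y -> loc (space_of mu Y) = mu.
Proof.
move=> MY; apply/ffunP => i; case: (boolP (mu i)) => mi.
  apply/locationP; exists (bvec mu Y i); split; first exact: bvec_space_of.
    by rewrite co_bvec mi eqxx add0r oner_eq0.
  move=> j ij; rewrite co_bvec (Mspace0 MY) ?if_same ?add0r; last first.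
    by rewrite ltnNge ltnW ?andbF.
  by case: eqVneq ij => // ->; rewrite ltnn.
apply/negP => /locationP[u [/mem_space_of/(_ i mi) uE ui u0]].
case/eqP: ui; rewrite uE big1 // => t mt; case: (ltnP i t) => it.
  by rewrite u0 ?mulr0.
by rewrite (Mspace0 MY) ?mul0r // mt mi /= -leqNgt.
Qed.

Lemma mf_space_of mu Y : Mspace mu Y -> mf (space_of mu Y) = Y.
Proof.
move=> MY; have lE := loc_space_of MY; have [MZ Zy] := matrix_formP (space_of mu Y).
rewrite lE in MZ Zy; apply/matrixP => s t.
case: (boolP (mu s)) => ms; first by rewrite (Mspace0 MZ) ?(Mspace0 MY) ?ms.
case: (boolP (mu t)) => mt; last first.
  by rewrite (Mspace0 MZ) ?(Mspace0 MY) ?(negPf mt) ?andbF.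
have /mem_space_of/(_ s ms) := Zy t mt.
rewrite co_bvec (negPf ms) (bigD1 t) //= big1 => [|i /andP[mi it]].
  rewrite co_bvec mt eqxx add0r mulr1 addr0; case: eqVneq => [ts|_].
    by rewrite -ts mt in ms.
  by rewrite addr0.
by rewrite co_bvec mi eq_sym (negPf it) addr0 mulr0.
Qed.

Lemma space_ofK y : space_of (loc y) (mf y) = y.
Proof.
by apply/vspaceP => u; apply/mem_space_of/mem_matrix_form.
Qed.

End Coordinates.

(** * Covers in matrix form *)

Section Covers.

Variables (F : finFieldType) (H : vectType F) (N : nat).
Variables (x : 'I_N.+1 -> {vspace H}) (v : N.-tuple H).
Hypothesis vP : basis_of fullv v.
Hypothesis xE : forall i : 'I_N.+1, x i = <<take i v>>%VS.

Implicit Types (y w z : {vspace H}) (mu nu : {ffun 'I_N -> bool}) (m n : 'I_N).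
Implicit Types (Y Z : 'M[F]_N) (c d : 'rV[F]_N).

Local Notation loc := (location x).
Local Notation mf := (matrix_form x v).
Local Notation mcov := (mcovers x).
Local Notation sp := (space_of v).

Let dimE := dim_location vP xE.

Definition addloc mu m : {ffun 'I_N -> bool} := [ffun i => (i == m) || mu i].
Definition subloc mu m : {ffun 'I_N -> bool} := [ffun i => (i != m) && mu i].

Lemma card_Tset_addloc mu m : ~~ mu m -> #|Tset (addloc mu m)| = #|Tset mu|.+1.
Proof.
move=> mm; rewrite (_ : Tset (addloc mu m) = m |: Tset mu).
  by rewrite cardsU1 inE mm.
by apply/setP => i; rewrite !inE ffunE.
Qed.

Lemma mcovers_loc m w y i : mcov m w y -> (loc w i : nat) = (loc y i + (i == m))%N.
Proof. by case/andP => _ /forallP/(_ i)/eqP. Qed.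

Lemma mcoversE m w y :
  mcov m w y = [&& ~~ loc y m, loc w == addloc (loc y) m & (y <= w)%VS].
Proof.
apply/idP/and3P => [wy|[ym /eqP wy yw]].
  have /andP[/andP[yw _] _] := wy.
  have wyE i := mcovers_loc i wy.
  split=> //; first by have := wyE m; rewrite eqxx; case: (loc y m); case: (loc w m).
  apply/eqP/ffunP => i; rewrite ffunE; have := wyE i.
  by case: (loc w i); case: (loc y i); case: eqP.
apply/andP; split; first by rewrite /covers yw !dimE wy card_Tset_addloc /=.
apply/forallP => i; rewrite wy ffunE; case: (eqVneq i m) => [->|_] /=.
  by rewrite (negPf ym).
by rewrite addn0.
Qed.

Lemma addlocK mu m : ~~ mu m -> subloc (addloc mu m) m = mu.
Proof.
move=> mm; apply/ffunP => i; rewrite !ffunE; case: eqVneq => [->|_] //=.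
by rewrite (negPf mm).
Qed.

Lemma sublocK mu m : mu m -> addloc (subloc mu m) m = mu.
Proof.
by move=> mm; apply/ffunP => i; rewrite !ffunE; case: eqVneq => [->|_] /=;
  rewrite ?mm.
Qed.

Lemma mcoversE_sub m w y :
  mcov m w y = [&& loc w m, loc y == subloc (loc w) m & (y <= w)%VS].
Proof.
rewrite mcoversE; apply/and3P/and3P => -[a /eqP b yw].
  by split; rewrite // b ?ffunE ?eqxx // addlocK.
by split; rewrite // b ?ffunE ?eqxx // sublocK.
Qed.

(** Locations grow with the subspace, so one more dimension means exactly one new index. *)
Lemma covers_mcovers w y : (y <= w)%VS -> \dim w = (\dim y).+1 ->
  exists m, mcov m w y.
Proof.
move=> yw; rewrite !dimE => cwy.
have sub : Tset (loc y) \subset Tset (loc w).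
  apply/subsetP => i; rewrite !inE; exact: (location_sub vP xE yw).
have : #|Tset (loc w) :\: Tset (loc y)| = 1%N.
  by rewrite cardsD (setIidPr sub) cwy subSnn.
move/eqP/cards1P => [m mE]; exists m.
have yE i : loc w i && ~~ loc y i = (i == m).
  by move/setP/(_ i): mE; rewrite !inE andbC.
have yi i : loc y i -> loc w i by move/subsetP/(_ i): sub; rewrite !inE.
have := yE m; rewrite eqxx => /andP[wm ym].
rewrite mcoversE ym yw andbT /=; apply/eqP/ffunP => i; rewrite ffunE -yE.
by case: (boolP (loc y i)) => [/yi ->|]; rewrite ?orbT ?andbT ?orbF.
Qed.

Let dim_mcov m w y : mcov m w y -> \dim w = (\dim y).+1.
Proof. by case/andP => /andP[_ /eqP]. Qed.

Let sub_mcov m w y : mcov m w y -> (y <= w)%VS.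
Proof. by case/andP => /andP[]. Qed.

(** A common cover of y and z can only be y + z, and a common lower neighbour can only be their
    intersection; m <> n keeps y and z from being nested. The dimension formula passes from the
    upper half of the square to the lower one and back. *)
Lemma mcovers_diamond m n y z : m != n ->
  (\sum_(w | mcov m w y) (mcov n w z) = \sum_(w | mcov n y w) (mcov m z w))%N.
Proof.
move=> mn.
have up w : mcov m w y -> mcov n w z -> w = (y + z)%VS.
  move=> wy wz; apply/esym/eqP; rewrite eqEdim.
  rewrite subv_add (sub_mcov wy) (sub_mcov wz) (dim_mcov wy) /=.
  rewrite ltnNge; apply/negP => le.
  have yz : (y == y + z)%VS by rewrite eqEdim addvSl le.
  have zy : (z <= y)%VS by rewrite (eqP yz) addvSr.
  have := mcovers_loc m wz; have := mcovers_loc m wy; rewrite eqxx (negPf mn).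
  have := @location_sub _ _ _ _ _ vP xE z y m zy.
  by case: (loc z m) => [->|]; case: (loc y m); case: (loc w m).
have dn w : mcov n y w -> mcov m z w -> w = (y :&: z)%VS.
  move=> yw zw; apply/eqP; rewrite eqEdim.
  rewrite subv_cap (sub_mcov yw) (sub_mcov zw) /= -ltnS -(dim_mcov yw).
  rewrite ltnNge; apply/negP => le.
  have yz : (y :&: z == y)%VS by rewrite eqEdim capvSl le.
  have yz' : (y <= z)%VS by rewrite -(eqP yz) capvSr.
  have := mcovers_loc n yw; have := mcovers_loc n zw; rewrite eqxx eq_sym (negPf mn).
  have := @location_sub _ _ _ _ _ vP xE y z n yz'.
  by case: (loc y n) => [->|]; case: (loc w n); case: (loc z n).
have -> : (\sum_(w | mcov m w y) (mcov n w z)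
    = mcov m (y + z)%VS y && mcov n (y + z)%VS z)%N.
  case: (boolP (mcov m (y + z)%VS y)) => h /=.
    rewrite (bigD1 (y + z)%VS) //= big1 ?addn0 // => w /andP[wy wyz].
    by case: (boolP (mcov n w z)) => // /(up _ wy) wE; rewrite wE eqxx in wyz.
  rewrite big1 // => w wy; case: (boolP (mcov n w z)) => // /(up _ wy) wE.
  by rewrite wE (negPf h) in wy.
have -> : (\sum_(w | mcov n y w) (mcov m z w)
    = mcov n y (y :&: z)%VS && mcov m z (y :&: z)%VS)%N.
  case: (boolP (mcov n y (y :&: z)%VS)) => h /=.
    rewrite (bigD1 (y :&: z)%VS) //= big1 ?addn0 // => w /andP[wy wyz].
    by case: (boolP (mcov m z w)) => // /(dn _ wy) wE; rewrite wE eqxx in wyz.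
  rewrite big1 // => w wy; case: (boolP (mcov m z w)) => // /(dn _ wy) wE.
  by rewrite wE (negPf h) in wy.
congr (nat_of_bool _).
have dims : (\dim (y + z) + \dim (y :&: z) = \dim y + \dim z)%N by exact:
  dimv_sum_cap.
have nm : (n == m) = false by rewrite eq_sym (negPf mn).
apply/andP/andP => -[h1 h2].
  have dh1 := dim_mcov h1; have dh2 := dim_mcov h2.
  have [|i hi] := @covers_mcovers y (y :&: z)%VS (capvSl _ _); first by lia.
  have [|j hj] := @covers_mcovers z (y :&: z)%VS (capvSr _ _); first by lia.
  (* Both paths from the intersection to the sum add up to the same change of location, so opposite
     edges of the square carry the same label. *)
  have E k : ((k == i) + (k == m) = (k == j) + (k == n))%N.
    apply: (@addnI (loc (y :&: z)%VS k)).
    by rewrite !addnA -(mcovers_loc k hi) -(mcovers_loc k hj)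
      -(mcovers_loc k h1) (mcovers_loc k h2).
  have ni : n = i.
    by apply/eqP; have := E n; rewrite eqxx nm; case: (n == i) => //; case: (n == j).
  have mj : m = j.
    by apply/eqP; have := E m; rewrite eqxx (negPf mn); case: (m == j) => //; case:
      (m == i).
  by rewrite ni mj.
have dh1 := dim_mcov h1; have dh2 := dim_mcov h2.
have [|i hi] := @covers_mcovers (y + z)%VS y (addvSl _ _); first by lia.
have [|j hj] := @covers_mcovers (y + z)%VS z (addvSr _ _); first by lia.
have E k : ((k == n) + (k == i) = (k == m) + (k == j))%N.
  apply: (@addnI (loc (y :&: z)%VS k)).
  by rewrite !addnA -(mcovers_loc k h1) -(mcovers_loc k h2)
    -(mcovers_loc k hi) (mcovers_loc k hj).
have mi : m = i.
  by apply/eqP; have := E m; rewrite eqxx (negPf mn); case: (m == i) => //; case: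
    (m == j).
have nj : n = j.
  by apply/eqP; have := E n; rewrite eqxx nm; case: (n == j) => //; case: (n == i).
by rewrite mi nj.
Qed.

(* [upmx m Y c] is the matrix form of the subspace that m-covers the one of form Y
   and has column m equal to c; [dnmx m Z d] is the form of the subspace that is
   m-covered by the one of form Z and has row m equal to d. *)
Definition upmx m Y c : 'M[F]_N :=
  Y - (c + delta_mx 0 m)^T *m row m Y + c^T *m delta_mx 0 m.
Definition dnmx m Z d : 'M[F]_N :=
  Z - col m Z *m delta_mx 0 m + (col m Z + (delta_mx 0 m)^T) *m d.

Lemma upmxE m Y c i j :
  upmx m Y c i j = Y i j - (c 0 i + (i == m)%:R) * Y m j + c 0 i * (j == m)%:R.
Proof. by rewrite !mxE !big_ord1 !mxE eqxx. Qed.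

Lemma dnmxE m Z d i j :
  dnmx m Z d i j = Z i j - Z i m * (j == m)%:R + (Z i m + (i == m)%:R) * d 0 j.
Proof. by rewrite !mxE !big_ord1 !mxE eqxx. Qed.

Lemma upmx_dnmx m Y Z :
  (Z == upmx m Y (col m Z)^T) = (Y == dnmx m Z (row m Y)).
Proof.
apply/eqP/eqP => /matrixP E; apply/matrixP => i j; have := E i j.
  by rewrite upmxE dnmxE !mxE => ->; ring.
by rewrite upmxE dnmxE !mxE => ->; ring.
Qed.

(** On y the coordinate u_m equals the sum of the Y_{m,t} u_t. Substituted into the equations of w,
    with matrix form Z, containment becomes Y_{s,t} = Z_{s,t} + Z_{s,m} Y_{m,t}, which fixes every
    column of Z except column m. *)
Lemma sub_upmx m y w : ~~ loc y m -> loc w = addloc (loc y) m ->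
  (y <= w)%VS = (mf w == upmx m (mf y) (col m (mf w))^T).
Proof.
move=> ym wE; have [MY Yy] := matrix_formP vP xE y.
have [MZ _] := matrix_formP vP xE w; rewrite wE in MZ.
have sumE s u : ~~ loc w s ->
    \sum_(t | loc w t) mf w s t * coord v t u
    = mf w s m * coord v m u + \sum_(t | loc y t) mf w s t * coord v t u.
  move=> _; rewrite wE (bigD1 m) ?ffunE ?eqxx //=; congr (_ + _).
  by apply: eq_bigl => t; rewrite ffunE; case: eqVneq => [->|];
    rewrite ?andbF ?andbT // (negPf ym).
apply/idP/eqP => [yw|/matrixP E].
  apply/matrixP => i j; rewrite upmxE !mxE.
  have addm : addloc (loc y) m m by rewrite ffunE eqxx.
  case: (boolP (loc w i)) => wi.
    have Zi k : mf w i k = 0 by rewrite (Mspace0 MZ) // -wE wi.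
    rewrite !Zi mul0r addr0 add0r.
    move: wi; rewrite wE ffunE; case: eqVneq => [-> _|_ /= yi].
      by rewrite mul1r subrr.
    by rewrite mul0r subr0 (Mspace0 MY) ?yi.
  have im : i == m = false by apply: contraNF wi => /eqP ->; rewrite wE.
  have yi : ~~ loc y i by move: wi; rewrite wE ffunE im.
  rewrite im addr0; case: (boolP (loc y j)) => yj.
    have jm : j == m = false by apply: contraTF yj => /eqP ->.
    have /(mem_matrix_form vP xE)/(_ i wi) : bvec v (loc y) (mf y) j \in w.
      exact: subvP yw _ (Yy j yj).
    rewrite sumE // !(co_bvec vP) (negPf yi) (negPf ym) jm mulr0 !addr0.
    have -> : (j == i) = false by apply: contraTF yj => /eqP ->.
    rewrite addr0 => ->; rewrite (bigD1 j) //= big1 => [|t /andP[yt tj]].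
      by rewrite (co_bvec vP) yj eqxx add0r mulr1 addr0 addrC addKr.
    by rewrite (co_bvec vP) yt eq_sym (negPf tj) addr0 mulr0.
  rewrite !(Mspace0 MY (t := j)) ?(negPf yj) ?andbF //.
  case: eqVneq => [->|jm]; first by rewrite mulr0 subr0 add0r mulr1.
  rewrite !mulr0 subr0 addr0 (Mspace0 MZ) //.
  by rewrite [X in _ && (X && _)]ffunE (negPf jm) (negPf yj) /= andbF.
apply/subvP => u uy; apply/(mem_matrix_form vP xE) => s ws.
have sm : s == m = false by apply: contraNF ws => /eqP ->; rewrite wE ffunE eqxx.
have ys : ~~ loc y s by move: ws; rewrite wE ffunE sm.
have uP := mem_matrix_form vP xE y u uy.
rewrite sumE // (uP s ys) (uP m ym) mulr_sumr -big_split; apply: eq_bigr => t yt /=.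
have tm : t == m = false by apply: contraTF yt => /eqP ->.
have := E s t; rewrite upmxE !mxE sm tm !mulr0n => ->; ring.
Qed.

Lemma suppv_col m Z mu : Mspace (addloc mu m) Z -> (col m Z)^T \in suppv F (Slt mu m).
Proof.
move=> MZ; apply/suppvP => i; rewrite !mxE => /(MspaceP _ _ MZ).
by rewrite ffunE negb_or -andbA => /and4P[_ mi _ im]; rewrite /Slt /= mi.
Qed.

Lemma suppv_row m Y mu : Mspace mu Y -> row m Y \in suppv F (Tge mu m.+1).
Proof.
by move=> MY; apply/suppvP => i; rewrite !mxE => /(MspaceP _ _ MY) /and3P[_ mi im];
  apply/andP.
Qed.

Lemma Mspace_upmx m Y mu c : ~~ mu m -> Mspace mu Y -> c \in suppv F (Slt mu m) ->
  Mspace (addloc mu m) (upmx m Y c).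
Proof.
move=> mm MY cS; apply/MspaceP => i j; rewrite upmxE !ffunE.
have c0 k : ~~ [&& ~~ mu k & (k < m)%N] -> c 0 k = 0 by exact: (suppv0 cS).
have Y0 := Mspace0 MY.
case: (eqVneq i m) => [->|im] /=.
  by rewrite c0 ?ltnn ?andbF // mul0r add0r mul1r subrr addr0 eqxx.
rewrite addr0; case: (boolP (mu i)) => mi /=.
  by rewrite Y0 ?mi // c0 ?mi // !mul0r subr0 addr0 eqxx.
case: (eqVneq j m) => [->|jm] /=.
  rewrite !(Y0 _ m) ?(negPf mm) ?andbF // mulr0 subr0 add0r mulr1.
  by apply: contraNT => im'; rewrite c0 // (negPf im') andbF.
case: (boolP (mu j)) => mj /=; last first.
  by rewrite !(Y0 _ j) ?(negPf mj) ?andbF // !mulr0 subr0 addr0 eqxx.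
apply: contraNT => ij; rewrite Y0 ?(negPf ij) ?andbF // mulr0 addr0 sub0r oppr_eq0.
case: (ltnP i m) => im'; last by rewrite c0 ?mul0r // ltnNge im' andbF.
rewrite (Y0 m) ?mulr0 // ltnNge -ltnNge; apply: contra ij => /and3P[_ _].
by apply: ltn_trans.
Qed.

Lemma Mspace_dnmx m Z nu d : nu m -> Mspace nu Z -> d \in suppv F (Tge nu m.+1) ->
  Mspace (subloc nu m) (dnmx m Z d).
Proof.
move=> nm MZ dT; apply/MspaceP => i j; rewrite dnmxE !ffunE.
have d0 k : ~~ [&& nu k & (m < k)%N] -> d 0 k = 0 by exact: (suppv0 dT).
have Z0 := Mspace0 MZ.
case: (eqVneq j m) => [->|jm] /=.
  by rewrite d0 ?ltnn ?andbF // !mulr0 mulr1 subrr addr0 eqxx.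
rewrite mulr0 subr0; case: (boolP (nu j)) => nj /=; last first.
  by rewrite Z0 ?(negPf nj) ?andbF // d0 ?(negPf nj) // mulr0 addr0 eqxx.
case: (eqVneq i m) => [->|im] /=.
  rewrite !(Z0 m) ?nm // !add0r mul1r.
  by apply: contraNT => mj; rewrite d0 // (negPf mj) andbF.
rewrite addr0; case: (boolP (nu i)) => ni /=.
  by rewrite !(Z0 i) ?ni // mul0r addr0 eqxx.
apply: contraNT => ij; rewrite Z0 ?(negPf ij) ?andbF // add0r.
case: (ltnP m j) => mj; last by rewrite d0 ?mulr0 // ltnNge mj andbF.
rewrite (Z0 i) ?mul0r //; apply: contra ij => /and3P[_ _ im'].
exact: ltn_trans mj.
Qed.

Lemma col_upmx m Y mu c : ~~ mu m -> Mspace mu Y -> col m (upmx m Y c) = c^T.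
Proof.
move=> mm MY; apply/matrixP => i j; rewrite mxE upmxE !mxE ord1 eqxx.
by rewrite !(Mspace0 MY (t := m)) ?(negPf mm) ?andbF // mulr0 subr0 add0r mulr1.
Qed.

Lemma row_dnmx m Z nu d : nu m -> Mspace nu Z -> row m (dnmx m Z d) = d.
Proof.
move=> nm MZ; apply/matrixP => i j; rewrite mxE dnmxE !(ord1 i) eqxx.
by rewrite !(Mspace0 MZ (s := m)) ?nm // mul0r subr0 !add0r mul1r.
Qed.

Let Mmf := Mspace_mf vP xE.
Let loc_sp := loc_space_of vP xE.
Let mf_sp := mf_space_of vP xE.
Let spK := space_ofK vP xE.

(** The m-covers of y are parametrised by column m of their matrix form, which can be any vector
    supported on the rows of S before m. *)
Lemma sum_up (V : nmodType) (G : {vspace H} -> V) m y : ~~ loc y m ->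
  \sum_(w | mcov m w y) G w
  = \sum_(c in suppv F (Slt (loc y) m)) G (sp (addloc (loc y) m) (upmx m (mf y) c)).
Proof.
move=> ym; pose h c := sp (addloc (loc y) m) (upmx m (mf y) c).
have MU c := @Mspace_upmx m (mf y) _ c ym (Mmf y).
rewrite (reindex_onto h (fun w => (col m (mf w))^T)) /= => [|w]; last first.
  rewrite mcoversE => /and3P[_ /eqP wE]; rewrite (sub_upmx ym wE) => /eqP mfw.
  by rewrite /h -mfw -wE spK.
apply: eq_bigl => c; apply/idP/idP => [/andP[]|cS].
  rewrite mcoversE => /and3P[_ /eqP wE _] /eqP <-; apply: suppv_col.
  by rewrite -wE; exact: Mmf.
have wE : loc (h c) = addloc (loc y) m by apply/loc_sp/MU.
have mfw : mf (h c) = upmx m (mf y) c by apply/mf_sp/MU.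
have colE : (col m (mf (h c)))^T = c by rewrite mfw (col_upmx c ym (Mmf y)) trmxK.
by rewrite mcoversE ym wE eqxx (sub_upmx ym wE) colE mfw !eqxx.
Qed.

Lemma sum_down (V : nmodType) (G : {vspace H} -> V) m w : loc w m ->
  \sum_(y | mcov m w y) G y
  = \sum_(d in suppv F (Tge (loc w) m.+1)) G (sp (subloc (loc w) m) (dnmx m (mf w)
    d)).
Proof.
move=> wm; pose h d := sp (subloc (loc w) m) (dnmx m (mf w) d).
have MU d := @Mspace_dnmx m (mf w) _ d wm (Mmf w).
have subE y : loc y = subloc (loc w) m ->
    (y <= w)%VS = (mf y == dnmx m (mf w) (row m (mf y))).
  move=> yE; rewrite -upmx_dnmx; apply: sub_upmx; first by rewrite yE ffunE eqxx.
  by rewrite yE sublocK.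
have TgeE : Tge (subloc (loc w) m) m.+1 =1 Tge (loc w) m.+1.
  by move=> i; rewrite /Tge /= ffunE; case: eqVneq => [->|] //=; rewrite ltnn andbF.
rewrite (reindex_onto h (fun y => row m (mf y))) /= => [|y]; last first.
  rewrite mcoversE_sub => /and3P[_ /eqP yE]; rewrite (subE _ yE) => /eqP mfy.
  by rewrite /h -mfy -yE spK.
apply: eq_bigl => d; apply/idP/idP => [/andP[]|dS].
  rewrite mcoversE_sub => /and3P[_ /eqP yE _] /eqP <-.
  have /suppvP dS := suppv_row m (Mmf (h d)).
  by apply/suppvP => i /dS; rewrite yE TgeE.
have yE : loc (h d) = subloc (loc w) m by apply/loc_sp/MU.
have mfy : mf (h d) = dnmx m (mf w) d by apply/mf_sp/MU.
have rowE : row m (mf (h d)) = d by rewrite mfy (row_dnmx d wm (Mmf w)).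
by rewrite mcoversE_sub wm yE eqxx (subE _ yE) rowE mfy !eqxx.
Qed.

(** Exchanging the two covering steps shears the column of m': its entry at m is eliminated by means
    of the new column c. *)
Lemma upmxC m m' Y c c' : m != m' -> c 0 m' = 0 ->
  upmx m (upmx m' Y c') c = upmx m' (upmx m Y c) (c' - c' 0 m *: (delta_mx 0 m + c)).
Proof.
move=> mm' cm'; apply/matrixP => i j; rewrite !upmxE !mxE /= cm' [m' == m]eq_sym.
by rewrite (negPf mm') /=; case: (eqVneq i m) => _ /=; ring.
Qed.

(** The shear maps onto the vectors that vanish at m, and its fibre over d is the line of all d + a
    (e_m + c). The size |F| of these fibres is the q in L_m' L_m = q L_m L_m'. *)
Let sum_shear (V : nmodType) (mu : {ffun 'I_N -> bool}) m m' (c : 'rV[F]_N)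
    (f : 'rV[F]_N -> V) :
  (m < m')%N -> ~~ mu m -> c \in suppv F (Slt mu m) ->
  \sum_(c' in suppv F (Slt mu m')) f (c' - c' 0 m *: (delta_mx 0 m + c))
  = (\sum_(c' in suppv F (Slt (addloc mu m) m')) f c') *+ #|F|.
Proof.
move=> mm' mm cS; pose p c' := c' - c' 0 m *: (delta_mx 0 m + c) : 'rV[F]_N.
have cm : c 0 m = 0 by rewrite (suppv0 cS) // /Slt /= ltnn andbF.
have gS : delta_mx 0 m + c \in suppv F (Slt mu m').
  apply: suppvD; apply/suppvP => i.
    rewrite mxE /=; case: (eqVneq i m) => [-> _|_]; last by rewrite eqxx.
    by rewrite /Slt /= mm.
  by move/(suppvP _ _ cS) => /andP[mi im]; rewrite /Slt /= mi (ltn_trans im).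
have pS c' : c' \in suppv F (Slt mu m') -> p c' \in suppv F (Slt (addloc mu m) m').
  move=> c'S; have := suppvD c'S (suppvN (suppvZ (c' 0 m) gS)) => /suppvP pS.
  apply/suppvP => i; rewrite /Slt /= ffunE; case: (eqVneq i m) => [->|im];
    last exact: pS.
  by rewrite !mxE !eqxx cm addr0 mulr1 subrr eqxx.
rewrite (partition_big p (mem (suppv F (Slt (addloc mu m) m')))) //= -sumrMnl.
apply: eq_bigr => d dS.
have dm : d 0 m = 0 by rewrite (suppv0 dS) // /Slt /= ffunE eqxx.
rewrite (eq_bigr (fun=> f d)) => [|c' /andP[_ /eqP <- //]].
rewrite sumr_const; congr (_ *+ _).
have inj : injective (fun a : F => d + a *: (delta_mx 0 m + c)).
  move=> a b /addrI/rowP/(_ m); rewrite !mxE !eqxx cm addr0 !mulr1; exact.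
rewrite -(card_imset _ inj); apply: eq_card => c'; rewrite unfold_in /=.
apply/andP/imsetP => [[c'S /eqP <-]|[a _ ->]].
  by exists (c' 0 m) => //; rewrite subrK.
split.
  apply: suppvD; last exact: suppvZ.
  apply/suppvP => i /(suppvP _ _ dS); rewrite /Slt /= ffunE negb_or -andbA.
  by case/and3P => _ -> ->.
by rewrite /p !mxE !eqxx cm dm addr0 add0r mulr1 addrK.
Qed.

(** When m' is added before m, the column of m' still has a free entry at the row m < m'; when m is
    added first, m has already left S. The two parametrisations of the chains from y to z differ by
    this one entry. *)
Lemma mcovers_qcomm (m m' : 'I_N) y z : (m < m')%N ->
  (\sum_(w | mcov m' w y) (mcov m z w)
   = #|F| * \sum_(w | mcov m w y) (mcov m' z w))%N.
Proof.
move=> mm'; have neq : m != m' by apply: contraTneq mm' => ->; rewrite ltnn.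
(* The indicator is rewritten as a sum over the covers of w, so that [sum_up] can be applied a
   second time. *)
have delta n w : (mcov n z w : nat) = (\sum_(z' | mcov n z' w) (z' == z))%N.
  rewrite big_mkcond (bigD1 z) //= big1 ?addn0 ?eqxx; first by case: mcov.
  by move=> i /negPf ->; rewrite if_same.
case: (boolP (loc y m')) => ym'.
  rewrite big_pred0 => [|w]; last by rewrite mcoversE ym'.
  rewrite big1 ?muln0 // => w; rewrite mcoversE => /and3P[_ /eqP wE _].
  by rewrite mcoversE wE ffunE ym' orbT.
case: (boolP (loc y m)) => ym.
  rewrite [in RHS]big_pred0 ?muln0 => [|w]; last by rewrite mcoversE ym.
  rewrite big1 // => w; rewrite mcoversE => /and3P[_ /eqP wE _].
  by rewrite mcoversE wE ffunE ym orbT.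
have addC : addloc (addloc (loc y) m') m = addloc (addloc (loc y) m) m'.
  by apply/ffunP => i; rewrite !ffunE orbCA.
(* As m < m', the support of column m consists of rows before m', so adding m' first leaves the
   choices for c unchanged. *)
have SltE : Slt (addloc (loc y) m') m =1 Slt (loc y) m.
  move=> i; rewrite /Slt /= ffunE; case: (eqVneq i m') => [->|] //=.
  by rewrite [(m' < m)%N]ltnNge ltnW ?andbF.
have suppE : suppv F (Slt (addloc (loc y) m') m) = suppv F (Slt (loc y) m).
  by apply/setP => c; apply/suppvP/suppvP => h i /h; rewrite SltE.
transitivity (\sum_(c' in suppv F (Slt (loc y) m')) \sum_(c in suppv F (Slt (loc y)
  m))
    (sp (addloc (addloc (loc y) m) m') (upmx m (upmx m' (mf y) c') c) == z))%N.
  rewrite (sum_up (fun w => (mcov m z w : nat)) ym'); apply: eq_bigr => c' c'S.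
  have MU := Mspace_upmx ym' (Mmf y) c'S.
  rewrite delta sum_up; last by rewrite (loc_sp MU) ffunE (negPf neq).
  by rewrite (loc_sp MU) (mf_sp MU) suppE addC.
rewrite exchange_big /= (sum_up (fun w => (mcov m' z w : nat)) ym) big_distrr /=.
apply: eq_bigr => c cS; have MU := Mspace_upmx ym (Mmf y) cS.
have cm' : c 0 m' = 0.
  by rewrite (suppv0 cS) // /Slt /= ltnNge (ltnW mm') andbF.
rewrite delta sum_up; last by rewrite (loc_sp MU) ffunE eq_sym (negPf neq).
rewrite (loc_sp MU) (mf_sp MU).
under eq_bigr do rewrite upmxC //.
have := sum_shear
  (fun d => (sp (addloc (addloc (loc y) m) m') (upmx m' (upmx m (mf y) c) d) == z :
    nat))
  mm' ym cS.
by rewrite -mulr_natl natn.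
Qed.

End Covers.

(** * Eigenvalues on the characters *)

Section Operators.

Variables (F : finFieldType) (H : vectType F) (N : nat) (C : numClosedFieldType).
Variables (x : 'I_N.+1 -> {vspace H}) (v : N.-tuple H) (chi : F -> C).
Hypothesis vP : basis_of fullv v.
Hypothesis xE : forall i : 'I_N.+1, x i = <<take i v>>%VS.
Hypotheses (chiP : is_add_char chi) (chi_nt : exists a, chi a != 1).

Local Notation P := {vspace H}.
Local Notation dimV := #|{: P}|.
Local Notation q := (#|F|%:R : C).
Local Notation loc := (location x).
Local Notation mf := (matrix_form x v).
Local Notation mcov := (mcovers x).
Local Notation sp := (space_of v).
Local Notation L := (Lmat C x).
Local Notation R := (Rmat C x).

Implicit Types (y w z : P) (m n : 'I_N).

Let q0 : q != 0.
Proof. by rewrite pnatr_eq0 -lt0n ltnW // card_finNzRing_gt1. Qed.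

Lemma big_enum_val_all (V : nmodType) (f : P -> V) :
  \sum_(i < dimV) f (enum_val i) = \sum_w f w.
Proof.
rewrite (reindex (enum_val : 'I_dimV -> P)) //.
exact/onW_bij/enum_val_bij.
Qed.

Lemma mulmx_on (f g : P -> P -> C) :
  mx_on f *m mx_on g = mx_on (fun y z => \sum_w f y w * g w z).
Proof.
apply/matrixP => i j; rewrite !mxE -big_enum_val_all.
by apply: eq_bigr => k _; rewrite !mxE.
Qed.

Lemma mulmx_cv_on (f : P -> P -> C) (g : P -> C) :
  mx_on f *m cv_on g = cv_on (fun y => \sum_w f y w * g w).
Proof.
apply/matrixP => i j; rewrite !mxE -big_enum_val_all.
by apply: eq_bigr => k _; rewrite !mxE.
Qed.

Lemma Rmat_on m : R m = mx_on (fun y z => (mcov m y z)%:R).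
Proof. by apply/matrixP => i j; rewrite !mxE. Qed.

Let natr_sum_mul (a b : pred P) :
  \sum_w (a w)%:R * (b w)%:R = (\sum_(w | a w) b w)%N%:R :> C.
Proof.
rewrite natr_sum [RHS]big_mkcond; apply: eq_bigr => w _.
by case: (a w); rewrite ?mul1r ?mul0r.
Qed.

Lemma Lmat_nilp m : L m *m L m = 0.
Proof.
rewrite mulmx_on; apply/matrixP => i j; rewrite !mxE natr_sum_mul.
rewrite big1 // => w; rewrite (mcoversE_sub vP xE) => /and3P[wm _ _].
by rewrite (mcoversE vP xE) wm.
Qed.

Lemma Lmat_qcomm (m m' : 'I_N) : (m < m')%N -> L m' *m L m = q *: (L m *m L m').
Proof.
move=> mm'; rewrite !mulmx_on; apply/matrixP => i j; rewrite !mxE !natr_sum_mul.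
by rewrite (mcovers_qcomm vP xE) // natrM.
Qed.

Lemma Lmat_Rmat_comm m n : m != n -> L m *m R n = R n *m L m.
Proof.
move=> mn; rewrite Rmat_on !mulmx_on; apply/matrixP => i j;
  rewrite !mxE !natr_sum_mul.
by rewrite (mcovers_diamond vP xE).
Qed.

Definition chi_val y z : C :=
  if loc z == loc y then chi (\tr (mf y *m (mf z)^T)) else 0.

Let trivial_mf y : trivial_loc (loc y) -> mf y = 0.
Proof.
move=> ty; apply/matrixP => s t; rewrite mxE; apply: (Mspace0 (Mspace_mf vP xE y)).
by case/orP: ty => /eqP ->; rewrite !ffunE /= ?andbF.
Qed.

(** For a constant location the matrix form is 0 and the location alone determines y, so the
    indicator vector is also given by the character formula and needs no separate treatment
    afterwards. *)
Lemma chi_vecE y : chi_vec x v chi y = cv_on (chi_val y).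
Proof.
rewrite /chi_vec; case: ifP => ty; apply/colP => i; rewrite !mxE /chi_val.
  case: eqVneq => [->|ne]; first by rewrite eqxx trivial_mf // mul0mx mxtrace0
    (chiP.1).
  case: eqP => // lE; case/eqP: ne.
  have mi : mf (enum_val i) = 0 by rewrite trivial_mf // lE.
  by rewrite -[LHS](space_ofK vP xE) -[RHS](space_ofK vP xE) lE mi trivial_mf.
by rewrite (is_location_loc vP xE).
Qed.

Lemma vtypeE y : vtype x v y = sigma_support (loc y) (mf y).
Proof.
rewrite /vtype; case: ifP => // ty; apply/setP => i; rewrite inE in_set.
apply/esym/negbTE/existsP => -[[s t]]; rewrite !inE /= => /andP[/andP[]].
by case/orP: ty => /eqP ->; rewrite !ffunE //= andbF.
Qed.

(** The eigenvalue of A_m on [chi_y]. *)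
Definition theta m y : C :=
  if m \in vtype x v y then 0 else q ^+ kappa m (loc y) (vtype x v y).

Let chiD a b : chi (a + b) = chi a * chi b. Proof. exact: chiP.2. Qed.

(** By orthogonality the sum over e is q^|T| if the combination c + e_m of the rows of M vanishes on
    T, and 0 otherwise. The outer sum then counts, up to the sign of c, the ways to express row m on
    T by the rows in S. *)
Let sum_solutions (S T : pred 'I_N) (M : 'M[F]_N) m :
  \sum_(c in suppv F S) \sum_(e in suppv F T)
     chi ((e *m ((c + delta_mx 0 m) *m M)^T) 0 0)
  = ((row m (mskmx (pred1 m) T M) <= mskmx S T M)%MS : nat)%:R
    * q ^+ #|S| / q ^+ \rank (mskmx S T M) * q ^+ #|T|.
Proof.
under eq_bigr do rewrite (sum_char_suppv chiP chi_nt).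
rewrite -mulr_suml natrX; congr (_ * _).
have := card_suppv_sol S T M m => /(congr1 (fun k => k%:R : C)).
rewrite !natrM !natrX => E; rewrite -E mulfK ?expf_neq0 //.
rewrite -sum1_card natr_sum big_mkcond [RHS]big_mkcond /=.
rewrite (reindex_inj (@oppr_inj _)) /=; apply: eq_bigr => c _.
rewrite [in RHS]inE.
have -> : (- c \in suppv F S) = (c \in suppv F S).
  by apply/idP/idP => /suppvN //; rewrite opprK.
case: (c \in suppv F S) => //=.
have -> : [forall j, T j ==> ((((- c) + delta_mx 0 m) *m M) 0 j == 0)]
    = [forall j, T j ==> ((c *m M) 0 j == M m j)].
  apply: eq_forallb => j; congr (_ ==> _).
  have -> : ((- c + delta_mx 0 m) *m M) 0 j = M m j - (c *m M) 0 j.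
    by rewrite mulmxDl mulNmx -rowE addrC !mxE.
  by rewrite subr_eq0 eq_sym.
by case: ifP.
Qed.

(** Going up with column c and down with row d adds (c + e_m)^T (d - row m Z) to the form Z, so the
    character of the result is its value at Z times a factor that, after a translation of d, is
    independent of Z. The sum of these factors is [sum_solutions] for the form of y;
    [sigma_support_row] tells when it vanishes and [kappa_rank] gives its exponent. *)
Lemma LR_chi m y : L m *m R m *m chi_vec x v chi y
  = (if loc y m then 0 else theta m y) *: chi_vec x v chi y.
Proof.
rewrite chi_vecE -mulmxA Rmat_on !mulmx_cv_on; apply/colP => i; rewrite !mxE.
set z := enum_val i.
transitivity (\sum_(w | mcov m w z) \sum_(z' | mcov m w z') chi_val y z').
  rewrite [RHS]big_mkcond; apply: eq_bigr => w _.
  case: (mcov m w z); rewrite ?mul0r // mul1r [RHS]big_mkcond.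
  by apply: eq_bigr => z' _; case: (mcov m w z'); rewrite ?mul0r ?mul1r.
rewrite {2}/chi_val; case: eqVneq => [zy|zy]; last first.
  rewrite mulr0 big1 // => w; rewrite (mcoversE vP xE) => /and3P[zm /eqP wE _].
  rewrite big1 // => z'; rewrite (mcoversE_sub vP xE) => /and3P[_ /eqP z'E _].
  by rewrite /chi_val z'E wE addlocK // (negPf zy).
case: (boolP (loc y m)) => ym.
  by rewrite mul0r big_pred0 // => w; rewrite (mcoversE vP xE) zy ym.
have zm : ~~ loc z m by rewrite zy.
rewrite (sum_up vP xE _ zm).
set W := mf y; set Z := mf z.
transitivity (\sum_(c in suppv F (Slt (loc y) m))
    \sum_(d in suppv F (Tge (loc y) m.+1))
      chi (\tr (W *m Z^T)) * chi (\tr (W *m ((c + delta_mx 0 m)^T *m (d - row m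
        Z))^T))).
  rewrite -zy; apply: eq_bigr => c cS.
  have MU := Mspace_upmx zm (Mspace_mf vP xE z) cS.
  rewrite (sum_down vP xE); last by rewrite (loc_space_of vP xE MU) ffunE eqxx.
  rewrite (loc_space_of vP xE MU) (mf_space_of vP xE MU).
  have TE : suppv F (Tge (addloc (loc z) m) m.+1) = suppv F (Tge (loc z) m.+1).
    apply/setP => d; apply/suppvP/suppvP => h i0 /h; rewrite /Tge /= ffunE;
      by case: (eqVneq i0 m) => [->|] //=; rewrite ltnn andbF.
  rewrite TE; apply: eq_bigr => d dS.
  have addm : addloc (loc z) m m by rewrite ffunE eqxx.
  have MD : Mspace (subloc (addloc (loc z) m) m) (dnmx m (upmx m Z c) d).
    by apply: Mspace_dnmx => //; rewrite TE.
  rewrite /chi_val (loc_space_of vP xE MD) (mf_space_of vP xE MD) addlocK // zy eqxx.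
  rewrite -chiD -mxtraceD -mulmxDr -linearD /=; congr (chi (\tr (_ *m _^T))).
  rewrite /dnmx (col_upmx _ zm (Mspace_mf vP xE z)) /upmx -linearD /=.
  by rewrite -/Z mulmxBr addrK addrAC addrA.
rewrite mulrC; under eq_bigr do rewrite -mulr_sumr.
rewrite -mulr_sumr; congr (_ * _).
have rZ : row m Z \in suppv F (Tge (loc y) m.+1).
  by rewrite -zy; apply/suppv_row/(Mspace_mf vP xE).
transitivity (\sum_(c in suppv F (Slt (loc y) m)) \sum_(e in suppv F (Tge (loc y)
  m.+1))
     chi ((e *m ((c + delta_mx 0 m) *m W)^T) 0 0)).
  apply: eq_bigr => c _; rewrite (reindex_inj (addIr (row m Z))).
  apply: eq_big => [e|e _].
    apply/idP/idP => [/suppvD/(_ (suppvN rZ))|/suppvD/(_ rZ) //].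
    by rewrite addrK.
  rewrite addrK trmx_mul trmxK mulmxA mxtrace_mulC -mxtrace_tr mulmxA.
  by rewrite trmx_mul trmxK /mxtrace big_ord1.
rewrite sum_solutions /theta vtypeE.
have := sigma_support_row W ym; rewrite -/W => sE.
have := @kappa_rank _ _ (loc y) W m; rewrite sE.
case: (row m _ <= _)%MS => /= [/(_ isT) kE|_]; last by rewrite !mul0r.
rewrite mul1r mulrAC -exprD -kE exprD mulfK // expf_neq0 //.
Qed.

(** Going down with row d and up with column c adds (c - (col m Z)^T)^T (e_m - d). The roles of rows
    and columns are exchanged, so the linear system is the one of column m in the transposed form of
    y. *)
Lemma RL_chi m y : R m *m L m *m chi_vec x v chi y
  = (if loc y m then theta m y else 0) *: chi_vec x v chi y.
Proof.
rewrite chi_vecE -mulmxA Rmat_on !mulmx_cv_on; apply/colP => i; rewrite !mxE.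
set w := enum_val i.
transitivity (\sum_(z | mcov m w z) \sum_(w' | mcov m w' z) chi_val y w').
  rewrite [RHS]big_mkcond; apply: eq_bigr => z _.
  case: (mcov m w z); rewrite ?mul0r // mul1r [RHS]big_mkcond.
  by apply: eq_bigr => w' _; case: (mcov m w' z); rewrite ?mul0r ?mul1r.
rewrite {2}/chi_val; case: eqVneq => [wy|wy]; last first.
  rewrite mulr0 big1 // => z; rewrite (mcoversE_sub vP xE) => /and3P[wm /eqP zE _].
  rewrite big1 // => w'; rewrite (mcoversE vP xE) => /and3P[_ /eqP w'E _].
  by rewrite /chi_val w'E zE sublocK // (negPf wy).
case: (boolP (loc y m)) => ym; last first.
  by rewrite mul0r big_pred0 // => z; rewrite (mcoversE_sub vP xE) wy (negPf ym).
have wm : loc w m by rewrite wy.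
rewrite (sum_down vP xE _ wm).
set W := mf y; set Z := mf w.
transitivity (\sum_(d in suppv F (Tge (loc y) m.+1))
    \sum_(c in suppv F (Slt (loc y) m))
      chi (\tr (W *m Z^T)) * chi (\tr (W *m ((c - (col m Z)^T)^T *m (delta_mx 0 m -
        d))^T))).
  rewrite -wy; apply: eq_bigr => d dS.
  have MD := Mspace_dnmx wm (Mspace_mf vP xE w) dS.
  have subm : ~~ subloc (loc w) m m by rewrite ffunE eqxx.
  rewrite (sum_up vP xE); last by rewrite (loc_space_of vP xE MD).
  rewrite (loc_space_of vP xE MD) (mf_space_of vP xE MD).
  have SE : suppv F (Slt (subloc (loc w) m) m) = suppv F (Slt (loc w) m).
    apply/setP => c; apply/suppvP/suppvP => h i0 /h; rewrite /Slt /= ffunE;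
      by case: (eqVneq i0 m) => [->|] //=; rewrite ltnn andbF.
  rewrite SE; apply: eq_bigr => c cS.
  have MU : Mspace (addloc (subloc (loc w) m) m) (upmx m (dnmx m Z d) c).
    by apply: Mspace_upmx => //; rewrite SE.
  rewrite /chi_val (loc_space_of vP xE MU) (mf_space_of vP xE MU) sublocK // wy eqxx.
  rewrite -chiD -mxtraceD -mulmxDr -linearD /=; congr (chi (\tr (_ *m _^T))).
  rewrite /upmx (row_dnmx _ wm (Mspace_mf vP xE w)) /dnmx -/Z.
  by apply/matrixP => a b; rewrite !mxE !big_ord1 !mxE; ring.
rewrite mulrC; under eq_bigr do rewrite -mulr_sumr.
rewrite -mulr_sumr; congr (_ * _).
have cZ : (col m Z)^T \in suppv F (Slt (loc y) m).
  rewrite -wy.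
  have : Mspace (addloc (subloc (loc w) m) m) Z by rewrite sublocK //; apply:
    Mspace_mf.
  move=> /suppv_col /suppvP h; apply/suppvP => i0 /h; rewrite /Slt /= !ffunE.
  by case: (eqVneq i0 m) => [->|] //=; rewrite ltnn ?andbF.
transitivity (\sum_(d in suppv F (Tge (loc y) m.+1)) \sum_(e in suppv F (Slt (loc
  y) m))
     chi ((e *m ((d + delta_mx 0 m) *m W^T)^T) 0 0)).
  rewrite [RHS](reindex_inj (@oppr_inj _)) /=; apply: eq_big => [d|d _].
    by apply/idP/idP => /suppvN //; rewrite opprK.
  rewrite (reindex_inj (addIr (col m Z)^T)).
  apply: eq_big => [e|e _].
    apply/idP/idP => [/suppvD/(_ (suppvN cZ))|/suppvD/(_ cZ) //].
    by rewrite addrK.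
  rewrite addrK trmx_mul trmxK mulmxA mxtrace_mulC mulmxA.
  by rewrite trmx_mul trmxK [_ + delta_mx _ _]addrC /mxtrace big_ord1 mulmxA.
rewrite sum_solutions /theta vtypeE.
have := sigma_support_col W ym; rewrite -/W => sE.
have := @kappa_rank _ _ (loc y) W m; rewrite sE.
rewrite -(mxrank_tr (mskmx (Slt _ _) _ _)) mskmx_tr.
case: (row m _ <= _)%MS => /= [/(_ isT) kE|_]; last by rewrite !mul0r.
rewrite mul1r mulrAC -exprD addnC -kE exprD mulfK // expf_neq0 //.
Qed.

End Operators.

(** * The module structure *)

Section MatrixFacts.

(** For a real matrix the transpose is the adjoint, so the squared norm of A u is u^* A^T A u =
    0. *)
Lemma real_gram_eq0 (C : numClosedFieldType) m n (A : 'M[C]_(m, n)) (u : 'cV[C]_n) :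
  map_mx Num.conj A = A -> A^T *m A *m u = 0 -> A *m u = 0.
Proof.
move=> Areal AAu; set w := A *m u.
have ww : ((map_mx Num.conj w)^T *m w) 0 0 = 0.
  by rewrite /w map_mxM Areal trmx_mul -!mulmxA [A^T *m _]mulmxA AAu mulmx0 mxE.
have w2 i : 0 <= `|w i 0| ^+ 2 by exact: exprn_ge0.
have : \sum_i `|w i 0| ^+ 2 = 0.
  rewrite -[RHS]ww mxE; apply: eq_bigr => i _.
  by rewrite !mxE normCK mulrC.
move/psumr_eq0P => w0; apply/colP => i; rewrite [RHS]mxE; apply/eqP.
by rewrite -normr_eq0 -sqrf_eq0 w0.
Qed.

Lemma prod_diag_mx (C : comNzRingType) n (I : Type) (r : seq I) (d : I -> 'rV[C]_n) :
  \prod_(m <- r) diag_mx (d m) = diag_mx (\row_i \prod_(m <- r) d m 0 i).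
Proof.
elim: r => [|m r IH].
  rewrite big_nil; apply/matrixP => i j; rewrite !mxE big_nil; by case: eqP.
rewrite big_cons IH [LHS]mulmx_diag; congr diag_mx.
by apply/rowP => i; rewrite !mxE big_cons.
Qed.

Lemma mul_diag_delta (C : comNzRingType) n (d : 'rV[C]_n) i :
  diag_mx d *m delta_mx i 0 = d 0 i *: (delta_mx i 0 : 'cV[C]_n).
Proof.
apply/colP => j; rewrite mul_diag_mx !mxE eqxx andbT.
by case: (eqVneq j i) => [->|_]; rewrite ?mulr0.
Qed.

Lemma invmx_eq (C : fieldType) n (A B : 'M[C]_n) : A *m B = 1%:M -> invmx A = B.
Proof.
move=> AB; have [Au _] := mulmx1_unit AB.
by rewrite -[RHS](mulKmx Au) AB mulmx1.
Qed.

Section QuantumIntegers.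

Variables (C : fieldType) (t : C) (a b n : nat).
Hypotheses (ban : (b + a)%N = n) (t0 : t != 0) (t2 : t ^+ 2 - 1 != 0).

Let nz k : t ^+ k != 0. Proof. exact: expf_neq0. Qed.

Let expz_sub (i : int) (k l : nat) : i = k%:Z - l%:Z -> t ^ i = t ^+ k / t ^+ l.
Proof. by move=> ->; rewrite expfzDr // exprnN. Qed.

Let sqr_exp k : (t ^+ 2) ^+ k = (t ^+ k) ^+ 2.
Proof. by rewrite -!exprM mulnC. Qed.

(** With q = t^2 and n = a + b, both sides are the quantum integer [a - b]_t: the factor t^(1-n)
    symmetrises (q^a - q^b) / (q - 1). For a = dim y and b = N - dim y this is the normalisation
    q^((1-N)/2) of e_0^+. *)
Lemma quantum_integer (S : C) :
  (t ^+ 2 - 1) * S = (t ^+ 2) ^+ a - (t ^+ 2) ^+ b ->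
  t ^ (1 - n%:Z) * S
  = (t - t^-1)^-1 * (t ^ (- n%:Z + 2 * a%:Z) - t ^ (n%:Z + -2 * a%:Z)).
Proof.
move=> E; have -> : S = (t ^+ a ^+ 2 - t ^+ b ^+ 2) / (t ^+ 2 - 1).
  by rewrite -!sqr_exp -E mulrAC mulfV ?mul1r.
rewrite (@expz_sub _ 1 n) // (@expz_sub (- _ + _) a b); last by lia.
rewrite (@expz_sub (_ + -2 * _) b a); last by lia.
rewrite expr1 -ban exprD; move: (nz a) (nz b); move: (t ^+ a) (t ^+ b) => A B A0 B0.
by field; rewrite t0 A0 B0 t2.
Qed.

(** Here both sides are [b - a]_t. *)
Lemma quantum_integerV (S : C) :
  (t ^+ 2 - 1) * S = t ^+ 2 * ((t ^+ 2) ^- a - (t ^+ 2) ^- b) ->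
  t ^ (n%:Z - 1) * S
  = (t - t^-1)^-1 * (t ^ (n%:Z + -2 * a%:Z) - t ^ (- n%:Z + 2 * a%:Z)).
Proof.
move=> E; have -> : S = t ^+ 2 * (t ^+ a ^- 2 - t ^+ b ^- 2) / (t ^+ 2 - 1).
  by rewrite -!sqr_exp -E mulrAC mulfV ?mul1r.
rewrite (@expz_sub _ n 1) // (@expz_sub (- _ + _) a b); last by lia.
rewrite (@expz_sub (_ + -2 * _) b a); last by lia.
rewrite expr1 -ban exprD; move: (nz a) (nz b); move: (t ^+ a) (t ^+ b) => A B A0 B0.
by field; rewrite t0 A0 B0 t2.
Qed.

End QuantumIntegers.

End MatrixFacts.

(** * The characters as a common eigenbasis *)

Section FourierBasis.

Variables (F : finFieldType) (H : vectType F) (N : nat) (C : numClosedFieldType).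
Variables (x : 'I_N.+1 -> {vspace H}) (v : N.-tuple H) (chi : F -> C).
Hypothesis vP : basis_of fullv v.
Hypothesis xE : forall i : 'I_N.+1, x i = <<take i v>>%VS.
Hypotheses (chiP : is_add_char chi) (chi_nt : exists a, chi a != 1).

Local Notation P := {vspace H}.
Local Notation dimV := #|{: P}|.
Local Notation q := (#|F|%:R : C).
Local Notation loc := (location x).
Local Notation mf := (matrix_form x v).
Local Notation mcov := (mcovers x).
Local Notation sp := (space_of v).
Local Notation L := (Lmat C x).
Local Notation R := (Rmat C x).
Local Notation chiv := (chi_vec x v chi).
Local Notation vt := (vtype x v).

Implicit Types (y w z : P) (m n : 'I_N) (mu : {ffun 'I_N -> bool}).
Implicit Types (lam : {set 'I_N}).

Lemma sum_location (V : nmodType) mu (f : 'M[F]_N -> V) :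
  \sum_(z | loc z == mu) f (mf z) = \sum_(Z | Mspace mu Z) f Z.
Proof.
rewrite (reindex_onto (sp mu) mf) /= => [|z /eqP <-]; last exact: space_ofK vP xE z.
apply: eq_big => [Z|Z /andP[_ /eqP -> //]].
apply/idP/idP => [/andP[/eqP lE /eqP <-]|MZ].
  by have := Mspace_mf vP xE (sp mu Z); rewrite lE.
by rewrite (loc_space_of vP xE MZ) (mf_space_of vP xE MZ) !eqxx.
Qed.

Let cardM mu : C := #|[set Z : 'M[F]_N | Mspace mu Z]|%:R.

Let cardM_neq0 mu : cardM mu != 0.
Proof.
rewrite pnatr_eq0 -lt0n; apply/card_gt0P; exists 0; rewrite inE.
by apply/MspaceP => s t; rewrite mxE eqxx.
Qed.

Lemma sum_char_Mspace mu (D : 'M[F]_N) : Mspace mu D ->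
  \sum_(Z | Mspace mu Z) chi (\tr (D *m Z^T)) = (D == 0)%:R * cardM mu.
Proof.
move=> MD; case: eqP => [->|/eqP D0].
  rewrite mul1r /cardM -sum1_card natr_sum; apply: eq_big => [Z|Z _].
    by rewrite inE.
  by rewrite mul0mx mxtrace0 (chiP.1).
rewrite mul0r.
have /matrix0Pn[s [t Dst]] := D0.
have [b chib] := chi_scale chi_nt Dst.
under eq_bigl do rewrite -[Mspace mu _](in_set (Mspace mu)).
have trD : \tr (D *m (b *: delta_mx s t)^T) = b * D s t.
  rewrite linearZ /= -scalemxAr linearZ /=; congr (_ * _).
  rewrite /mxtrace (bigD1 s) //= big1 => [|i is_]; last first.
    by rewrite mxE big1 // => j _; rewrite !mxE (negPf is_) mulr0.
  rewrite addr0 mxE (bigD1 t) //= !mxE !eqxx mulr1 big1 ?addr0 // => j jt.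
  by rewrite !mxE (negPf jt) andbF mulr0.
apply: (@sum_char_eq0 _ _ _ chiP _ _ _ (b *: delta_mx s t)); last by rewrite trD.
  by move=> Z Z'; rewrite linearD mulmxDr mxtraceD.
move=> Z; rewrite !inE.
have Mst := MspaceP _ _ MD _ _ Dst.
have key a (Z' : 'M[F]_N) : Mspace mu Z' -> Mspace mu (Z' + a *: delta_mx s t).
  move=> MZ; apply/MspaceP => i j; rewrite !mxE.
  case: (boolP ((i == s) && (j == t))) => [/andP[/eqP -> /eqP ->] _ //|_].
  by rewrite mulr0 addr0; apply: MspaceP.
apply/idP/idP => [/(key (- b))|/key //].
by rewrite scaleNr addrK.
Qed.

(** The columns of [X] are the [chi_y]. Location by location it is the Fourier matrix of the
    additive group of matrix forms, and [Xi] is its inverse, made of the opposite characters divided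
    by the order of the group. *)
Let X : 'M[C]_dimV := mx_on (fun z y => chi_val x v chi y z).
Let Xi : 'M[C]_dimV := mx_on (fun y z =>
  if loc z == loc y then chi (\tr (- mf y *m (mf z)^T)) / cardM (loc y) else 0).

Let XiX : Xi *m X = 1%:M.
Proof.
rewrite mulmx_on; apply/matrixP => i j; rewrite !mxE -(inj_eq enum_val_inj).
set y := enum_val i; set y' := enum_val j.
case: (eqVneq (loc y') (loc y)) => [lE|lN]; last first.
  rewrite big1 => [|z _]; first by case: (eqVneq y y') lN => [->|//]; rewrite eqxx.
  rewrite /chi_val; case: eqP => [->|_]; last by rewrite mul0r.
  by rewrite eq_sym (negPf lN) mulr0.
transitivity ((\sum_(z | loc z == loc y) chi (\tr ((mf y' - mf y) *m (mf z)^T)))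
    / cardM (loc y)).
  rewrite mulr_suml [RHS]big_mkcond; apply: eq_bigr => z _; rewrite /chi_val lE.
  case: ifP => _; last by rewrite mul0r.
  by rewrite mulrAC -(chiP.2) -mxtraceD -mulmxDl [- _ + _]addrC.
have My := Mspace_mf vP xE y.
have My' : Mspace (loc y) (mf y') by rewrite -lE; apply: Mspace_mf.
rewrite (sum_location (loc y) (fun Z => chi (\tr ((mf y' - mf y) *m Z^T)))).
rewrite sum_char_Mspace; last first.
  apply/MspaceP => s t; rewrite !mxE; apply: contraNT => nB.
  by rewrite (Mspace0 My) ?(Mspace0 My') ?subrr.
rewrite mulfK //; congr ((nat_of_bool _)%:R); rewrite subr_eq0 eq_sym.
apply/idP/idP => [/eqP mE|/eqP -> //].
by rewrite -(space_ofK vP xE y) -(space_ofK vP xE y') lE mE.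
Qed.

Let XXi : X *m Xi = 1%:M. Proof. exact/mulmx1C/XiX. Qed.

Let col_X i : col i X = chiv (enum_val i).
Proof. by rewrite (chi_vecE vP xE chiP); apply/colP => k; rewrite !mxE. Qed.

(** As X is invertible, the [chi_y] form a basis; the spectral identities below are checked on
    it. *)
Lemma mx_eq_chi (A B : 'M[C]_dimV) :
  (forall y, A *m chiv y = B *m chiv y) -> A = B.
Proof.
move=> AB; suff AX : A *m X = B *m X by rewrite -[A]mulmx1 -XXi mulmxA AX -mulmxA
  XXi mulmx1.
apply/matrixP => i j.
have colM (D : 'M[C]_dimV) : (D *m X) i j = (D *m chiv (enum_val j)) i 0.
  by rewrite -col_X colE mulmxA -colE [RHS]mxE.
by rewrite !colM AB.
Qed.

Let Xi_chi y : Xi *m chiv y = delta_mx (enum_rank y) 0.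
Proof.
by rewrite -{1}(enum_rankK y) -col_X colE mulmxA XiX mul1mx.
Qed.

Let Vtype_coord lam i u : u \in Vtype x v chi lam -> vt (enum_val i) != lam ->
  row i Xi *m u = 0.
Proof.
move=> uV ilam; have /subvP/(_ u uV) : (Vtype x v chi lam <= lker (linfun (mulmx
  (row i Xi))))%VS.
  apply/span_subvP => w /imageP[y]; rewrite inE => /eqP ylam ->.
  rewrite memv_ker lfunE /= -row_mul Xi_chi; apply/eqP/rowP => k;
    rewrite !mxE ord1 eqxx andbT.
  case: (eqVneq i (enum_rank y)) => [iE|_]; last exact: mulr0n.
  by rewrite iE enum_rankK ylam eqxx in ilam.
by rewrite memv_ker lfunE /= => /eqP.
Qed.

Local Notation Vrest lam :=
  (\sum_(lam' : {set 'I_N} | ~~ odd #|lam'| && (lam' != lam)) Vtype x v chi lam')%VS.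

Let Vtype_disjoint lam : (Vtype x v chi lam :&: Vrest lam = 0)%VS.
Proof.
apply/vspaceP => u; rewrite memv0 memv_cap; apply/andP/eqP => [[uV uR]|->];
  last first.
  by rewrite !mem0v.
suff Xiu : Xi *m u = 0 by rewrite -[u]mul1mx -XXi -mulmxA Xiu mulmx0.
apply/row_matrixP => i; rewrite row_mul row0.
case: (eqVneq (vt (enum_val i)) lam) => [ilam|ilam]; last exact: Vtype_coord uV ilam.
have /subvP/(_ u uR) : (Vrest lam <= lker (linfun (mulmx (row i Xi))))%VS.
  apply/subv_sumP => lam' /andP[_ lam'N]; apply/subvP => w wV.
  by rewrite memv_ker lfunE /= (Vtype_coord wV) // ilam eq_sym.
by rewrite memv_ker lfunE /= => /eqP.
Qed.

Let mem_Vtype y : chiv y \in Vtype x v chi (vt y).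
Proof. by apply/memv_span/imageP; exists y; rewrite ?inE. Qed.

Lemma vtype_even y : ~~ odd #|vt y|.
Proof. by rewrite vtypeE //; case: (sigma_support_half (loc y) (mf y)). Qed.

Let EtypeE lam u : Etype x v chi lam *m u = daddv_pi (Vtype x v chi lam) (Vrest
  lam) u.
Proof.
rewrite [in RHS](matrix_sum_delta u) linear_sum /=.
apply/colP => i; rewrite mxE summxE; apply: eq_bigr => j _.
by rewrite big_ord1 linearZ /= !mxE mulrC.
Qed.

(** Types have even size, so a [chi_y] of another type does lie in the complementary sum, on which
    the projection is zero. *)
Lemma Etype_chi lam y : ~~ odd #|lam| ->
  Etype x v chi lam *m chiv y = (vt y == lam)%:R *: chiv y.
Proof.
move=> lamE; rewrite EtypeE; case: eqVneq => [ylam|ylam].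
  by rewrite scale1r daddv_pi_id // -ylam mem_Vtype.
have yR : chiv y \in Vrest lam.
  by apply: subvP (mem_Vtype y); apply: (sumv_sup (vt y)) => //; rewrite vtype_even.
have := @daddv_pi_add _ _ (Vtype x v chi lam) (Vrest lam) (chiv y) (Vtype_disjoint
  lam).
rewrite [X in _ + X]daddv_pi_id //; last by rewrite capvC Vtype_disjoint.
move=> /(_ (subvP (addvSr _ _) _ yR)).
by rewrite -[RHS]add0r => /addIr ->; rewrite mulr0n scale0r.
Qed.

Lemma Estar_chi mu y : Estar C x mu *m chiv y = (loc y == mu)%:R *: chiv y.
Proof.
rewrite (chi_vecE vP xE chiP) mulmx_cv_on; apply/colP => i; rewrite !mxE.
rewrite (bigD1 (enum_val i)) //= big1 ?addr0 => [|w wi].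
  rewrite eqxx (is_location_loc vP xE) /= /chi_val.
  by case: (eqVneq (loc (enum_val i)) (loc y)) => [->|]; rewrite ?mulr0.
by rewrite eq_sym (negPf wi) mul0r.
Qed.

Let sum_kappa_chi (A : 'M[C]_dimV) m y :
  (\sum_mu \sum_(lam : {set 'I_N} | ~~ odd #|lam|)
    q ^- kappa m mu lam *: (A *m Estar C x mu *m Etype x v chi lam)) *m chiv y
  = q ^- kappa m (loc y) (vt y) *: (A *m chiv y).
Proof.
have term mu lam : ~~ odd #|lam| ->
    q ^- kappa m mu lam *: (A *m Estar C x mu *m Etype x v chi lam) *m chiv y
    = ((vt y == lam)%:R * (loc y == mu)%:R * q ^- kappa m mu lam) *: (A *m chiv y).
  move=> lamE; rewrite -scalemxAl -!mulmxA Etype_chi // -!scalemxAr Estar_chi.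
  by rewrite -!scalemxAr !scalerA mulrC.
rewrite mulmx_suml (bigD1 (loc y)) //= [X in _ + X]big1 => [|mu muy]; last first.
  rewrite mulmx_suml big1 // => lam lamE; rewrite term //.
  by rewrite [loc y == mu]eq_sym (negPf muy) mulr0 mul0r scale0r.
rewrite addr0 mulmx_suml (bigD1 (vt y)) ?vtype_even //= big1 => [|lam /andP[lamE
  lamy]].
  by rewrite addr0 term ?vtype_even // !eqxx !mul1r.
by rewrite term // eq_sym (negPf lamy) !mul0r scale0r.
Qed.

Local Notation th m y := (theta C x v m y).

(** This is A_m^+, diagonal in the basis of characters. The convention 0^-1 = 0 of the field gives
    the right value on the kernel of A_m. *)
Definition pseudo_inv m : 'M[C]_dimV :=
  X *m diag_mx (\row_i (th m (enum_val i))^-1) *m Xi.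

Lemma pseudo_inv_chi m y : pseudo_inv m *m chiv y = (th m y)^-1 *: chiv y.
Proof.
rewrite -mulmxA Xi_chi -mulmxA mul_diag_delta mxE enum_rankK.
by rewrite -scalemxAr -colE col_X enum_rankK.
Qed.

Let Lreal m : map_mx Num.conj (L m) = L m.
Proof. by apply/matrixP => i j; rewrite !mxE rmorph_nat. Qed.

Let Rreal m : map_mx Num.conj (R m) = R m.
Proof. by apply/matrixP => i j; rewrite !mxE rmorph_nat. Qed.

(** Both L_m^T L_m = R_m L_m and R_m^T R_m = L_m R_m kill [chi_y], and these are Gram matrices of
    real matrices. *)
Let theta0_chi m y : m \in vt y -> L m *m chiv y = 0 /\ R m *m chiv y = 0.
Proof.
move=> my; have th0 : th m y = 0 by rewrite /theta my.
split; apply: real_gram_eq0 => //.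
  by rewrite -[(L m)^T]/(R m) (RL_chi vP xE chiP chi_nt) th0 if_same scale0r.
by rewrite [(R m)^T]trmxK (LR_chi vP xE chiP chi_nt) th0 if_same scale0r.
Qed.

Lemma LRVL_pseudo_inv m : LRVL x v chi m = L m *m pseudo_inv m.
Proof.
apply: mx_eq_chi => y; rewrite sum_kappa_chi -mulmxA pseudo_inv_chi -scalemxAr.
(* Outside the type q^-kappa is the inverse eigenvalue; inside it the two coefficients differ, but
   L_m already kills [chi_y]. *)
case: (boolP (m \in vt y)) => my; last by rewrite /theta (negPf my).
by rewrite (proj1 (theta0_chi my)) !scaler0.
Qed.

Lemma RLVR_pseudo_inv m : RLVR x v chi m = R m *m pseudo_inv m.
Proof.
apply: mx_eq_chi => y; rewrite sum_kappa_chi -mulmxA pseudo_inv_chi -scalemxAr.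
case: (boolP (m \in vt y)) => my; last by rewrite /theta (negPf my).
by rewrite (proj2 (theta0_chi my)) !scaler0.
Qed.

Local Notation Q m := (L m *m R m + R m *m L m).

Let Q_chi m y : Q m *m chiv y = th m y *: chiv y.
Proof.
rewrite mulmxDl (LR_chi vP xE chiP chi_nt) (RL_chi vP xE chiP chi_nt) -scalerDl.
by case: (loc y m); rewrite ?addr0 ?add0r.
Qed.

Lemma pseudo_invC m : Q m *m pseudo_inv m = pseudo_inv m *m Q m.
Proof.
apply: mx_eq_chi => y.
rewrite -[Q m *m _ *m chiv y]mulmxA -[pseudo_inv m *m _ *m chiv y]mulmxA.
rewrite pseudo_inv_chi Q_chi -!scalemxAr.
by rewrite pseudo_inv_chi Q_chi !scalerA mulrC.
Qed.

Lemma pseudo_invK1 m : Q m *m pseudo_inv m *m Q m = Q m.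
Proof.
apply: mx_eq_chi => y; rewrite -[_ *m Q m *m chiv y]mulmxA Q_chi -scalemxAr.
rewrite -[Q m *m _ *m chiv y]mulmxA pseudo_inv_chi -scalemxAr Q_chi !scalerA.
congr (_ *: _).
by case: (eqVneq (th m y) 0) => [->|h]; rewrite ?mul0r // mulfV ?mul1r.
Qed.

Lemma pseudo_invK2 m : pseudo_inv m *m Q m *m pseudo_inv m = pseudo_inv m.
Proof.
apply: mx_eq_chi => y; rewrite -[_ *m pseudo_inv m *m chiv y]mulmxA.
rewrite pseudo_inv_chi -scalemxAr -[_ *m Q m *m chiv y]mulmxA Q_chi -scalemxAr.
rewrite pseudo_inv_chi !scalerA; congr (_ *: _).
by case: (eqVneq (th m y) 0) => [->|h]; rewrite ?invr0 ?mul0r // mulVf ?mul1r.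
Qed.

Let g (i : 'I_dimV) : int := (\dim (enum_val i))%:Z.

Let loc_dim y z : loc y = loc z -> \dim y = \dim z.
Proof. by move=> lE; rewrite !(dim_location vP xE) lE. Qed.

Lemma homog_Lmat m : homog g (-1) (L m).
Proof.
move=> i j; rewrite !mxE /g; case: (boolP (mcov _ _ _)) => [|_]; last by rewrite eqxx.
by case/andP => /andP[_ /eqP ->] _ _; rewrite intS addrC addKr.
Qed.

Lemma homog_pseudo_inv m : homog g 0 (pseudo_inv m).
Proof.
have hXi : homog g 0 Xi.
  move=> i j; rewrite !mxE /g addr0.
  case: (eqVneq (loc (enum_val j)) (loc (enum_val i))) => [lE _|_];
    last by rewrite eqxx.
  by rewrite (loc_dim lE).
have hX : homog g 0 X.
  move=> i j; rewrite !mxE /g addr0 /chi_val.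
  case: (eqVneq (loc (enum_val i)) (loc (enum_val j))) => [lE _|_];
    last by rewrite eqxx.
  by rewrite (loc_dim lE).
have hD (d : 'rV[C]_dimV) : homog g 0 (diag_mx d).
  move=> i j; rewrite !mxE addr0; case: (eqVneq i j) => [-> _ //|_].
  by rewrite mulr0n eqxx.
by rewrite /pseudo_inv -[0]addr0; apply: homogM => //; rewrite -[0]addr0; apply:
  homogM.
Qed.

Lemma diag_chi (f : nat -> C) y :
  diag_mx (\row_i f (\dim (enum_val i : P))) *m chiv y = f (\dim y) *: chiv y.
Proof.
rewrite (chi_vecE vP xE chiP); apply/colP => i; rewrite mul_diag_mx !mxE /chi_val.
by case: eqP => [lE|]; rewrite ?mulr0 // (loc_dim lE).
Qed.

Local Notation t := (qhalf F C).

Lemma qhalf_sqr : t ^+ 2 = q. Proof. exact: sqrtCK. Qed.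

Lemma qhalf_gt1 : 1 < t.
Proof.
have t_ge0 : 0 <= t by rewrite sqrtC_ge0 ler0n.
by rewrite -(expr_gt1 (n := 2)) // qhalf_sqr ltr1n card_finNzRing_gt1.
Qed.

Let t0 : t != 0. Proof. by rewrite gt_eqF // (lt_trans ltr01 qhalf_gt1). Qed.
Let q0 : q != 0. Proof. by rewrite -qhalf_sqr expf_neq0. Qed.

Let t2m1 : t ^+ 2 - 1 != 0.
Proof. by rewrite subr_eq0 gt_eqF // exprn_egt1 ?qhalf_gt1. Qed.

Let card_ST y : (#|Sset (loc y)| + \dim y = N)%N.
Proof.
rewrite (dim_location vP xE) -[RHS]card_ord -(cardC (mem (Tset (loc y)))) addnC.
by congr (_ + _)%N; apply: eq_card => i; rewrite !inE.
Qed.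

Let half y := proj1 (sigma_support_half (loc y) (mf y)).
Let bal y := sigma_support_balanced (loc y) (mf y).

(** On [chi_y] the sum is the telescoping one with end values q^(dim y) and q^(N - dim y), and both
    diagonal matrices are scalars, since [chi_y] is supported on subspaces of one dimension. *)
Lemma sum_RL_LR :
  t ^ (1 - N%:Z) *: \sum_m (R m *m L m - L m *m R m)
  = (t - t^-1)^-1 *: (diag_mx (\row_i t ^ (- N%:Z + 2 * g i))
                      - diag_mx (\row_i t ^ (N%:Z + -2 * g i))).
Proof.
apply: mx_eq_chi => y; rewrite -!scalemxAl mulmxBl mulmx_suml.
rewrite (diag_chi (fun d => t ^ (- N%:Z + 2 * d%:Z))).
rewrite (diag_chi (fun d => t ^ (N%:Z + -2 * d%:Z))) -scalerBl.
rewrite (eq_bigr (fun m => (if m \in vt y then 0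
   else (-1) ^+ (~~ loc y m) * q ^+ kappa m (loc y) (vt y)) *: chiv y)); last first.
  move=> m _; rewrite mulmxBl (LR_chi vP xE chiP chi_nt) (RL_chi vP xE chiP chi_nt).
  rewrite -scalerBl /theta; congr (_ *: _).
  by move: (m \in vt y) (loc y m) (q ^+ _) => [] [] a; rewrite /= ?expr0; ring.
rewrite -scaler_suml !scalerA; congr (_ *: _).
apply: (quantum_integer (card_ST y)) => //; rewrite qhalf_sqr.
have := telescope_kappa (half y) (bal y) q; rewrite -vtypeE => ->.
by rewrite (dim_location vP xE).
Qed.

Lemma sum_LR_RL :
  t ^ (N%:Z - 1) *: \sum_m (L m *m R m - R m *m L m) *m (pseudo_inv m *m pseudo_inv m)
  = (t - t^-1)^-1 *: (diag_mx (\row_i t ^ (N%:Z + -2 * g i))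
                      - diag_mx (\row_i t ^ (- N%:Z + 2 * g i))).
Proof.
apply: mx_eq_chi => y; rewrite -!scalemxAl mulmxBl mulmx_suml.
rewrite (diag_chi (fun d => t ^ (- N%:Z + 2 * d%:Z))).
rewrite (diag_chi (fun d => t ^ (N%:Z + -2 * d%:Z))) -scalerBl.
rewrite (eq_bigr (fun m => (if m \in vt y then 0
   else (-1) ^+ (loc y m) * q ^- kappa m (loc y) (vt y)) *: chiv y)); last first.
  move=> m _; rewrite -mulmxA -[_ *m pseudo_inv m *m _]mulmxA.
  rewrite pseudo_inv_chi -!scalemxAr pseudo_inv_chi -!scalemxAr mulmxBl.
  rewrite (LR_chi vP xE chiP chi_nt) (RL_chi vP xE chiP chi_nt).
  rewrite -scalerBl !scalerA /theta; congr (_ *: _).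
  have k0 := expf_neq0 (kappa m (loc y) (vt y)) q0.
  by move: (m \in vt y) (loc y m) (q ^+ _) k0 => [] [] a k0;
    rewrite /= ?invr0 ?expr0; field.
rewrite -scaler_suml !scalerA; congr (_ *: _).
apply: (quantum_integerV (card_ST y)) => //; rewrite qhalf_sqr.
have := telescope_kappaV (half y) (bal y) q0; rewrite -vtypeE => ->.
by rewrite (dim_location vP xE).
Qed.

Let sum_loc (i : 'I_dimV) :
  \sum_(m < N) (1 - 2 * (loc (enum_val i) m : nat)%:Z) = N%:Z + -2 * g i.
Proof.
rewrite sumrB sumr_const card_ord -mulr_sumr mulNr; congr (_ - _ * _); first exact:
  natz.
rewrite /g (dim_location vP xE) -natz -sum1_card natr_sum.
rewrite [RHS]big_mkcond; apply: eq_bigr => m _; rewrite inE.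
by case: (loc _ m).
Qed.

Let Kmat_diag m : Kmat C x m
  = diag_mx (\row_i t ^ (1 - 2 * (loc (enum_val i) m : nat)%:Z)).
Proof.
apply/matrixP => i j; rewrite !mxE (inj_eq enum_val_inj).
by case: eqP => [->|]; rewrite ?mulr1n ?mulr0n.
Qed.

Let invKmat_diag m : invmx (Kmat C x m)
  = diag_mx (\row_i t ^ (- (1 - 2 * (loc (enum_val i) m : nat)%:Z))).
Proof.
apply: invmx_eq; rewrite Kmat_diag mulmx_diag; apply/matrixP => i j; rewrite !mxE.
by rewrite -expfzDr // subrr expr0z.
Qed.

Let prod_exp (f : 'I_N -> int) : \prod_(m < N) t ^ f m = t ^ (\sum_(m < N) f m).
Proof.
by apply/esym/(big_morph (fun k : int => t ^ k)) => // k l; rewrite expfzDr.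
Qed.

Lemma prod_Kmat : \prod_(m < N) Kmat C x m = diag_mx (\row_i t ^ (N%:Z + -2 * g i)).
Proof.
rewrite (eq_bigr _ (fun m _ => Kmat_diag m)) prod_diag_mx; congr diag_mx.
apply/rowP => i; rewrite !mxE -sum_loc -prod_exp; apply: eq_bigr => m _.
by rewrite mxE.
Qed.

Lemma prod_invKmat :
  \prod_(m < N) invmx (Kmat C x m) = diag_mx (\row_i t ^ (- N%:Z + 2 * g i)).
Proof.
rewrite (eq_bigr _ (fun m _ => invKmat_diag m)) prod_diag_mx; congr diag_mx.
apply/rowP => i; rewrite !mxE.
have -> : - N%:Z + 2 * g i = - (N%:Z + -2 * g i) by rewrite mulNr opprD opprK.
rewrite -sum_loc -sumrN -prod_exp; apply: eq_bigr => m _.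
by rewrite mxE.
Qed.

Lemma uq_module (alpha : 'I_N -> C) :
  \dim (fullv : {vspace H}) = N -> (forall m, alpha m != 0) ->
  exists rho : {lrmorphism uq_sl2hat t -> 'M[C]_dimV},
    [/\ rho (uq_e t true ord0) = t ^ (1 - N%:Z) *: \sum_(m < N) alpha m *: R m,
        rho (uq_e t true ord_max) = t ^ (N%:Z - 1) *: \sum_(m < N) LRVL x v chi m,
        rho (uq_e t false ord0) = \sum_(m < N) (alpha m)^-1 *: L m
      & rho (uq_e t false ord_max) = \sum_(m < N) RLVR x v chi m]
    /\
    [/\ rho (uq_k t ord0) = \prod_(m < N) invmx (Kmat C x m),
        rho (uq_kV t ord0) = \prod_(m < N) Kmat C x m,
        rho (uq_k t ord_max) = \prod_(m < N) Kmat C x m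
      & rho (uq_kV t ord_max) = \prod_(m < N) invmx (Kmat C x m)].
Proof.
move=> dimH alpha0; rewrite prod_Kmat prod_invKmat.
rewrite (eq_bigr _ (fun m _ => LRVL_pseudo_inv m)).
rewrite (eq_bigr _ (fun m _ => RLVR_pseudo_inv m)).
apply: uq_from_raising_lowering => //.
- exact: qhalf_gt1.
- by move=> i; rewrite /g lez_nat -dimH dimvS ?subvf.
- exact: homog_Lmat.
- exact: homog_pseudo_inv.
- exact: (Lmat_nilp C vP xE).
- by move=> m m' mm'; rewrite qhalf_sqr; apply: (Lmat_qcomm C vP xE).
- exact: (Lmat_Rmat_comm C vP xE).
- exact: pseudo_invC.
- exact: pseudo_invK1.
- exact: pseudo_invK2.
- exact: sum_RL_LR.
- exact: sum_LR_RL.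
Qed.

End FourierBasis.

Unset Implicit Arguments.
Set Strict Implicit.
Set Printing Implicit Defensive.

(* A U-module structure on C^P is an algebra morphism from U to Mat_P(C), which
   acts on the column vectors on the left. *)
Theorem theorem13p1
    (R : realType) (F : finFieldType) (N : nat) (H : vectType F)
    (x : 'I_N.+1 -> {vspace H}) (v : N.-tuple H) (chi : F -> R[i])
    (alpha : 'I_N -> R[i]) :
  (0 < N)%N ->
  \dim (fullv : {vspace H}) = N ->
  full_flag x ->
  basis_of fullv v ->
  (forall i : 'I_N.+1, x i = <<take i v>>%VS) ->
  is_add_char chi -> (exists a, chi a != 1) ->
  (forall m, alpha m != 0) ->
  let t : R[i] := qhalf F R[i] in
  exists rho : {lrmorphism uq_sl2hat t -> 'M[R[i]]_#|{: {vspace H}}|},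
    [/\ rho (uq_e t true ord0) =
          t ^ (1 - N%:Z) *: \sum_(m < N) alpha m *: Rmat R[i] x m,
        rho (uq_e t true ord_max) =
          t ^ (N%:Z - 1) *: \sum_(m < N) LRVL x v chi m,
        rho (uq_e t false ord0) =
          \sum_(m < N) (alpha m)^-1 *: Lmat R[i] x m
      & rho (uq_e t false ord_max) = \sum_(m < N) RLVR x v chi m]
    /\
    [/\ rho (uq_k t ord0) = \prod_(m < N) invmx (Kmat R[i] x m),
        rho (uq_kV t ord0) = \prod_(m < N) Kmat R[i] x m,
        rho (uq_k t ord_max) = \prod_(m < N) Kmat R[i] x m
      & rho (uq_kV t ord_max) = \prod_(m < N) invmx (Kmat R[i] x m)].
Proof.
move=> _ dimH _ vP xE chiP chi_nt alpha0 t.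
exact: uq_module.
Qed.
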